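(* Let $\omega\in\widehat{\mathcal{D}}$. Then the following statements are equivalent: (i) $T(D^1_\omega,H^\infty)$ consists of constant functions only; (ii) $\displaystyle\sup_{0\le r<1}\frac{1-r}{\widehat\omega(r)}=\infty$; (iii) $\displaystyle\sup_{0\le r<1}\left((1-r)\sum_{k=1}^\infty\frac{r^k}{(k+1)\omega_k}\right)=\infty$; (iv) the identity map $I:D^1_\omega\to D^1_0$ is not bounded.
   Context: $\mathbb{D}$ is the open unit disc, $\mathcal{H}(\mathbb{D})$ the analytic functions on it, $dA(z)=\frac{dx\,dy}{\pi}$. A radial weight is a non-negative $\omega\in L^1([0,1))$ extended by $\omega(z)=\omega(|z|)$; always assume $\widehat\omega(r)=\int_r^1\omega(s)\,ds>0$ for all $0\le r<1$. $\omega\in\widehat{\mathcal{D}}$ means there is $C\ge1$ with $\widehat\omega(r)\le C\widehat\omega(\frac{1+r}{2})$ for all $0\le r<1$. Moments: $\omega_x=\int_0^1 r^x\omega(r)\,dr$. $D^1_\omega$ consists of $f\in\mathcal H(\mathbb D)$ with $\|f\|_{D^1_\omega}=\int_{\mathbb D}|f'|\omega\,dA+|f(0)|<\infty$; $D^1_0$ is the case $\omega\equiv1$. For $g\in\mathcal H(\mathbb D)$, $T_g(f)(z)=\int_0^z f(\zeta)g'(\zeta)\,d\zeta$. $T(X,H^\infty)$ is the set of $g\in\mathcal H(\mathbb D)$ such that $T_g:X\to H^\infty$ is bounded. *)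

(* Defs.v *)
From HB Require Import structures.
From mathcomp Require Import all_boot all_order all_algebra.
From mathcomp Require Import all_classical all_reals all_analysis.
From mathcomp Require Import complex.
Set Implicit Arguments. Unset Strict Implicit. Unset Printing Implicit Defensive.
Import Order.TTheory GRing.Theory Num.Theory.
Import numFieldNormedType.Exports.
Local Open Scope classical_set_scope.
Local Open Scope ring_scope.

Section Defs.
Variable R : realType.
Local Notation C := (R[i]).

Definition cnorm (z : C) : R := Normc.normc z.

Definition disc : set C := [set z | cnorm z < 1].

Definition has_cderiv (f : C -> C) (z d : C) : Prop :=
  forall e : R, 0 < e -> exists2 del : R, 0 < del &
    forall h : C, 0 < cnorm h < del ->
      cnorm (f (z + h) - f z - d * h) <= e * cnorm h.

Definition analytic_disc (f f' : C -> C) : Prop :=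
  forall z, disc z -> has_cderiv f z (f' z).

Definition radial_weight (w : R -> R) : Prop :=
  (forall s, 0 <= s < 1 -> 0 <= w s) /\
  (@lebesgue_measure R).-integrable `[0, 1[ (EFin \o w).

Definition omega_hat (w : R -> R) (r : R) : R :=
  Rintegral (@lebesgue_measure R) `[r, 1[ w.

Definition Dhat (w : R -> R) : Prop :=
  exists2 K : R, 1 <= K &
    forall r, 0 <= r < 1 -> omega_hat w r <= K * omega_hat w ((1 + r) / 2).

Definition moment (w : R -> R) (x : nat) : R :=
  Rintegral (@lebesgue_measure R) `[0, 1[ (fun s => s ^+ x * w s).

Definition area_int (E : set C) (F : C -> R) : \bar R :=
  ((pi^-1)%:E *
   \int[((@lebesgue_measure R) \x (@lebesgue_measure R))%E]_(p in
        [set p : R * R | E (p.1 +i* p.2)%C]) (F (p.1 +i* p.2)%C)%:E)%E.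

Definition D1_norm (w : R -> R) (f f' : C -> C) : \bar R :=
  (area_int disc (fun z => (cnorm (f' z) * w (cnorm z))%R) + (cnorm (f 0))%:E)%E.

Definition in_D1 (w : R -> R) (f f' : C -> C) : Prop :=
  analytic_disc f f' /\ (D1_norm w f f' < +oo)%E.

Definition one_weight : R -> R := fun _ => 1.

(* T_g(f)(z) = \int_0^z f(\zeta) g'(\zeta) d\zeta, along the segment [0,z]:
   \int_0^1 f(tz) g'(tz) z dt *)
Definition Tg (g' f : C -> C) (z : C) : C :=
  let F := fun t : R => f (t%:C * z)%C * g' (t%:C * z)%C * z in
  (Rintegral (@lebesgue_measure R) `[0, 1] (fun t => complex.Re (F t)) +i*
   Rintegral (@lebesgue_measure R) `[0, 1] (fun t => complex.Im (F t)))%C.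

Definition Tg_bounded_D1_Hinf (w : R -> R) (g' : C -> C) : Prop :=
  exists K : R, forall f f', in_D1 w f f' ->
    forall z, disc z -> ((cnorm (Tg g' f z))%:E <= K%:E * D1_norm w f f')%E.

Definition in_T_D1_Hinf (w : R -> R) (g g' : C -> C) : Prop :=
  analytic_disc g g' /\ Tg_bounded_D1_Hinf w g'.

Definition id_D1_bounded (w : R -> R) : Prop :=
  exists K : R, forall f f', in_D1 w f f' ->
    (D1_norm one_weight f f' <= K%:E * D1_norm w f f')%E.

End Defs.

(* Main.v *)
(* Let (T) be the negation of (ii): [1 - r <= K * omega_hat w r] for some [K].

   (T) implies that the identity is bounded: the circular means of [|f'|] are nondecreasing in the
   radius, and by the layer cake formula a nondecreasing function integrates against [dr] to at
   most [K] times its integral against [w(r) dr].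

   If the identity is bounded then [g(z) = z] is a symbol: integration by parts gives
   [|T_g f(s e)| <= |f(0)| + \int_0^s (1 - t) |f'(t e)| dt] for [|e| = 1], and the mean value
   property of [f'] on discs of radius [(1 - t)/2] bounds the last integral by the area integral
   of [|f'|].

   If [g] is a nonconstant symbol, apply [T_g] to [f_a(z) = z^n (1 - conj(a) z)^-2] with
   [|a| = 1 - 1/(2n)], whose norm is [O(n^2 omega_n)]. A Cauchy estimate for [T_g f_a] at [a] gives
   [|g'(a)| <= C n omega_n] on the whole circle, so [n omega_n] is bounded below because [g'] is not
   identically zero. Under the doubling condition this lower bound gives back (T), and it is also
   what the failure of (iii) amounts to.

   Complex differentiability is only assumed pointwise, so the function theory starts from Goursat's
   theorem, with integrals over a circle replaced by averages over the [N]-th roots of unity. For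
   the Poisson kernel [P] these are exact: the mean of [P(w zeta)] over [zeta^N = 1] is [P(w^N)]. *)

(* The estimates bear on [f'] and [g'], so the derivative of a merely differentiable function must
   itself be shown holomorphic. Cauchy's formula is therefore proved for a primitive [G] of [f]: the
   difference quotients of [G] are differentiable by a second-order Taylor estimate, and [f] and
   [f'] then arise by differentiating the Cauchy kernel.

   Means over roots of unity reach area integrals through rotation invariance: averaging rotated
   copies of a function leaves its circular integrals unchanged, so a pointwise bound on the
   discrete mean becomes a bound on the circular one. Fatou's lemma supplies the limit in [N] for
   the monotonicity of circular means.

   In the test function, [|1 - conj(a) z|^-2] is a Poisson kernel up to the factor [1 - |a z|^2], so
   its circular means are O(1/(1 - |a|)) = O(n), while [z^n] turns the radial integral into a
   moment. With [1 - |a| = 1/(2n)] the factor [|a|^n] stays above 1/2, so [|f_a(a)|] is of order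
   [n^2]; this cancels the [n^2] of the norm and leaves only the factor [n] lost in the Cauchy
   estimate. *)
Require Import Defs.
From HB Require Import structures.
From mathcomp Require Import all_boot all_order all_algebra.
From mathcomp Require Import all_classical all_reals all_analysis.
From mathcomp Require Import measurable_realfun complex ring lra zify.
Set Implicit Arguments. Unset Strict Implicit. Unset Printing Implicit Defensive.
Import Order.TTheory GRing.Theory Num.Theory.
Import numFieldNormedType.Exports.
Local Open Scope classical_set_scope.
Local Open Scope complex_scope.
Local Open Scope ring_scope.

#[global] Arguments cnorm {R} z : simpl never.

(** * Complex derivatives *)

Section ComplexDerivative.
Variable R : realType.
Local Notation C := (complex R).
Implicit Types (z w h d : C) (f g : C -> C).

Lemma cnorm_ge0 z : 0 <= cnorm z.
Proof. by case: z => a b; exact: sqrtr_ge0. Qed.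

Lemma cnorm0 : cnorm (0 : C) = 0.
Proof. exact: Normc.normc0. Qed.

Lemma cnorm1 : cnorm (1 : C) = 1.
Proof. exact: Normc.normc1. Qed.

Lemma cnorm_eq0 z : (cnorm z == 0) = (z == 0).
Proof.
by apply/eqP/eqP => [/Normc.eq0_normc//|->]; exact: cnorm0.
Qed.

Lemma cnorm_gt0 z : (0 < cnorm z) = (z != 0).
Proof. by rewrite lt0r cnorm_ge0 andbT cnorm_eq0. Qed.

Lemma cnormM z w : cnorm (z * w) = cnorm z * cnorm w.
Proof. exact: Normc.normcM. Qed.

Lemma cnormV z : cnorm z^-1 = (cnorm z)^-1.
Proof. exact: Normc.normcV. Qed.

Lemma cnormN z : cnorm (- z) = cnorm z.
Proof. exact: normcN. Qed.

Lemma cnormX z n : cnorm (z ^+ n) = cnorm z ^+ n.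
Proof. by elim: n => [|n ih]; rewrite ?expr0 ?cnorm1// !exprS cnormM ih. Qed.

Lemma cnormD z w : cnorm (z + w) <= cnorm z + cnorm w.
Proof. exact: le_normcD. Qed.

Lemma cnormB z w : cnorm (z - w) <= cnorm z + cnorm w.
Proof. by rewrite -(cnormN w) cnormD. Qed.

Lemma cnorm_distC z w : cnorm (z - w) = cnorm (w - z).
Proof. by rewrite -cnormN opprB. Qed.

Lemma cnormB_ge z w : cnorm z - cnorm w <= cnorm (z - w).
Proof. by rewrite lerBlDr -{1}(subrK w z) cnormD. Qed.

Lemma cnorm_real (x : R) : cnorm x%:C = `|x|.
Proof. by rewrite /cnorm /= expr0n /= addr0 sqrtr_sqr. Qed.

Lemma cnorm_sqr z : cnorm z ^+ 2 = complex.Re z ^+ 2 + complex.Im z ^+ 2.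
Proof. by case: z => a b; rewrite sqr_sqrtr// addr_ge0// sqr_ge0. Qed.

Lemma cnormJ z : cnorm z^* = cnorm z.
Proof. by case: z => a b; rewrite /cnorm /= sqrrN. Qed.

Lemma mulcJ z : z * z^* = (cnorm z ^+ 2)%:C.
Proof. by rewrite cnorm_sqr; case: z => a b; simpc; congr (_ +i* _); ring. Qed.

Lemma cnorm_Re z : `|complex.Re z| <= cnorm z.
Proof.
rewrite -(ger0_norm (cnorm_ge0 z)) -ler_sqr ?nnegrE// !real_normK ?num_real//.
by rewrite cnorm_sqr lerDl sqr_ge0.
Qed.

Lemma cnorm_Im z : `|complex.Im z| <= cnorm z.
Proof.
rewrite -(ger0_norm (cnorm_ge0 z)) -ler_sqr ?nnegrE// !real_normK ?num_real//.
by rewrite cnorm_sqr lerDr sqr_ge0.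
Qed.

Lemma cnorm_le_ReIm z : cnorm z <= `|complex.Re z| + `|complex.Im z|.
Proof.
rewrite -ler_sqr ?nnegrE ?cnorm_ge0 ?addr_ge0// cnorm_sqr sqrrD.
by rewrite !real_normK ?num_real// -addrA lerD2l lerDr mulrn_wge0 ?mulr_ge0.
Qed.

Lemma cnorm_sum (I : Type) (r : seq I) (P : pred I) (F : I -> C) :
  cnorm (\sum_(i <- r | P i) F i) <= \sum_(i <- r | P i) cnorm (F i).
Proof.
elim/big_rec2: _ => [|i x y _ le]; first by rewrite cnorm0.
by rewrite (le_trans (cnormD _ _))// lerD2l.
Qed.

Lemma real_complexD (x y : R) : (x + y)%:C = x%:C + y%:C.
Proof. exact: rmorphD. Qed.

Lemma real_complexM (x y : R) : (x * y)%:C = x%:C * y%:C.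
Proof. exact: rmorphM. Qed.

Lemma Re_realM (x : R) z : complex.Re (x%:C * z) = x * complex.Re z.
Proof. by case: z => a b /=; ring. Qed.

Lemma Im_realM (x : R) z : complex.Im (x%:C * z) = x * complex.Im z.
Proof. by case: z => a b /=; ring. Qed.

Lemma ReD z w : complex.Re (z + w) = complex.Re z + complex.Re w.
Proof. by case: z; case: w. Qed.

Lemma ImD z w : complex.Im (z + w) = complex.Im z + complex.Im w.
Proof. by case: z; case: w. Qed.

Lemma ReN z : complex.Re (- z) = - complex.Re z.
Proof. by case: z. Qed.

Lemma ImN z : complex.Im (- z) = - complex.Im z.
Proof. by case: z. Qed.

(** The point [h = 0] is not excluded, so [q 0 = 0] is forced. Such functions therefore compose
    without any condition on where the inner one vanishes. *)
Definition null (q : C -> C) := forall e : R, 0 < e ->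
  exists2 del : R, 0 < del & forall h, cnorm h < del -> cnorm (q h) <= e.

Definition locbnd (q : C -> C) := exists M : R,
  exists2 del : R, 0 < del & forall h, cnorm h < del -> cnorm (q h) <= M.

Lemma null_eq (p q : C -> C) : p =1 q -> null p -> null q.
Proof.
by move=> pq np e /np[d d0 H]; exists d => // h hd; rewrite -pq; exact: H.
Qed.

Lemma null_id : null id.
Proof. by move=> e e0; exists e => // h /ltW. Qed.

Lemma null0 : null (fun=> 0).
Proof. by move=> e e0; exists 1 => // h _; rewrite cnorm0 ltW. Qed.

Lemma nullD (p q : C -> C) : null p -> null q -> null (fun h => p h + q h).
Proof.
move=> np nq e e0; have e20 : 0 < e / 2 by rewrite divr_gt0.
have [d1 d10 H1] := np _ e20; have [d2 d20 H2] := nq _ e20.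
exists (Num.min d1 d2) => [|h]; first by rewrite lt_min d10.
rewrite lt_min => /andP[/H1 h1 /H2 h2].
by rewrite (le_trans (cnormD _ _))// (splitr e) lerD.
Qed.

Lemma null_locbnd (q : C -> C) : null q -> locbnd q.
Proof. by move=> /(_ 1 ltr01)[d d0 H]; exists 1, d. Qed.

Lemma locbnd_cst z : locbnd (fun=> z).
Proof. by exists (cnorm z), 1. Qed.

Lemma locbndD (p q : C -> C) : locbnd p -> locbnd q -> locbnd (fun h => p h + q h).
Proof.
move=> [M1 [d1 d10 H1]] [M2 [d2 d20 H2]].
exists (M1 + M2), (Num.min d1 d2) => [|h]; first by rewrite lt_min d10.
rewrite lt_min => /andP[/H1 h1 /H2 h2].
by rewrite (le_trans (cnormD _ _))// lerD.
Qed.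

Lemma nullM (p q : C -> C) : locbnd p -> null q -> null (fun h => p h * q h).
Proof.
move=> [M [d1 d10 H1]] nq e e0.
have M0 : 0 < `|M| + 1 by rewrite ltr_wpDl.
have [d2 d20 H2] := nq _ (divr_gt0 e0 M0).
exists (Num.min d1 d2) => [|h]; first by rewrite lt_min d10.
rewrite lt_min => /andP[/H1 h1 /H2 h2].
rewrite cnormM -(divfK (lt0r_neq0 M0) e) mulrC ler_pM ?cnorm_ge0//.
by rewrite (le_trans h1)// (le_trans (ler_norm _))// lerDl.
Qed.

Lemma nullZ z (q : C -> C) : null q -> null (fun h => z * q h).
Proof. exact/nullM/locbnd_cst. Qed.

Lemma null_comp (p q : C -> C) : null p -> null q -> null (p \o q).
Proof.
move=> np nq e /np[d d0 H].
have [d1 d10 H1] := nq (d / 2) (divr_gt0 d0 (ltr0Sn _ 1)).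
exists d1 => // h /H1 h1; apply: H; apply: (le_lt_trans h1).
by rewrite ltr_pdivrMr// ltr_pMr// ltr1n.
Qed.

(* Caratheodory's form of differentiability *)
Lemma has_cderivP f z d : has_cderiv f z d <->
  exists2 q : C -> C, null q & forall h, f (z + h) = f z + (d + q h) * h.
Proof.
split=> [H|[q nq qE] e e0].
  exists (fun h => (f (z + h) - f z - d * h) / h).
    move=> e e0; have [del del0 {}H] := H e e0; exists del => // h hd.
    have [->|h0] := eqVneq h 0; first by rewrite invr0 mulr0 cnorm0 ltW.
    rewrite cnormM cnormV ler_pdivrMr ?cnorm_gt0//; apply: H.
    by rewrite cnorm_gt0 h0.
  move=> h; have [->|h0] := eqVneq h 0; first by rewrite mulr0 !addr0.
  by field.
have [del del0 H] := nq _ e0; exists del => // h /andP[_ hd].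
rewrite qE (_ : _ - _ - _ = q h * h); last by ring.
by rewrite cnormM ler_wpM2r ?cnorm_ge0// H.
Qed.

Lemma has_cderiv_ext f g z d : f =1 g -> has_cderiv f z d -> has_cderiv g z d.
Proof. by move=> fg H e /H[del del0 {}H]; exists del => // h; rewrite -!fg; exact: H. Qed.

Lemma has_cderiv_near f g z d (r : R) : 0 < r ->
  (forall h, cnorm h < r -> f (z + h) = g (z + h)) ->
  has_cderiv f z d -> has_cderiv g z d.
Proof.
move=> r0 fg H e /H[del del0 {}H]; exists (Num.min del r) => [|h].
  by rewrite lt_min del0.
rewrite lt_min => /and3P[h0 hd hr]; rewrite -fg// -{2}(addr0 z) -fg ?cnorm0//.
by rewrite addr0 H// h0.
Qed.

Lemma has_cderiv_cst c z : has_cderiv (fun=> c) z 0.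
Proof. by apply/has_cderivP; exists (fun=> 0); [exact: null0|move=> h; ring]. Qed.

Lemma has_cderiv_id z : has_cderiv id z 1.
Proof. by apply/has_cderivP; exists (fun=> 0); [exact: null0|move=> h; ring]. Qed.

Lemma has_cderivD f g z d d' : has_cderiv f z d -> has_cderiv g z d' ->
  has_cderiv (fun z => f z + g z) z (d + d').
Proof.
move=> /has_cderivP[p np pE] /has_cderivP[q nq qE]; apply/has_cderivP.
by exists (fun h => p h + q h); [exact: nullD|move=> h; rewrite pE qE; ring].
Qed.

Lemma null_cont f z d : has_cderiv f z d -> null (fun h => f (z + h) - f z).
Proof.
move=> /has_cderivP[q nq qE].
apply: (@null_eq (fun h => (d + q h) * h)); first by move=> h; rewrite qE; ring.
by apply: nullM null_id; apply: locbndD; [exact: locbnd_cst|exact: null_locbnd].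
Qed.

Lemma has_cderivM f g z d d' : has_cderiv f z d -> has_cderiv g z d' ->
  has_cderiv (fun z => f z * g z) z (d * g z + f z * d').
Proof.
move=> Hf Hg; have ng := null_cont Hg.
move: Hf Hg => /has_cderivP[p np pE] /has_cderivP[q nq qE]; apply/has_cderivP.
exists (fun h => (g z * p h + f z * q h) + (d + p h) * (g (z + h) - g z)).
  apply: nullD; first by apply: nullD; exact: nullZ.
  by apply: nullM ng; apply: locbndD; [exact: locbnd_cst|exact: null_locbnd].
by move=> h; rewrite pE qE; ring.
Qed.

Lemma has_cderivZ c f z d : has_cderiv f z d ->
  has_cderiv (fun z => c * f z) z (c * d).
Proof.
by move=> /(has_cderivM (has_cderiv_cst c z)); rewrite mul0r add0r.
Qed.

Lemma has_cderivN f z d : has_cderiv f z d -> has_cderiv (fun z => - f z) z (- d).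
Proof.
move=> /(has_cderivZ (-1)); rewrite mulN1r.
by apply: has_cderiv_ext => x; rewrite mulN1r.
Qed.

Lemma has_cderivB f g z d d' : has_cderiv f z d -> has_cderiv g z d' ->
  has_cderiv (fun z => f z - g z) z (d - d').
Proof. by move=> Hf /has_cderivN; exact: has_cderivD. Qed.

Lemma has_cderiv_comp f g z d d' : has_cderiv g z d' -> has_cderiv f (g z) d ->
  has_cderiv (fun z => f (g z)) z (d * d').
Proof.
move=> Hg Hf; have ng := null_cont Hg.
move: Hf Hg => /has_cderivP[p np pE] /has_cderivP[q nq qE]; apply/has_cderivP.
pose k h := g (z + h) - g z.
have gk h : g (z + h) = g z + k h by rewrite /k; ring.
exists (fun h => d * q h + (d' + q h) * p (k h)).
  apply: nullD; first exact: nullZ.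
  apply: nullM; last exact: null_comp np ng.
  by apply: locbndD; [exact: locbnd_cst|exact: null_locbnd].
move=> h; rewrite gk pE; have -> : k h = (d' + q h) * h by rewrite /k qE; ring.
by ring.
Qed.

Lemma has_cderiv_affine f a b z d : has_cderiv f (a + b * z) d ->
  has_cderiv (fun z => f (a + b * z)) z (d * b).
Proof.
apply: (@has_cderiv_comp f (fun z => a + b * z)); rewrite -[X in has_cderiv _ _ X]add0r.
apply: has_cderivD; first exact: has_cderiv_cst.
by rewrite -[X in has_cderiv _ _ X]mulr1; apply: has_cderivZ; exact: has_cderiv_id.
Qed.

Lemma has_cderivV z : z != 0 -> has_cderiv (fun z => z^-1) z (- z ^- 2).
Proof.
move=> z0; have z0' : 0 < cnorm z by rewrite cnorm_gt0.
have e0 : 0 < cnorm z / 2 by rewrite divr_gt0.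
have zh h : cnorm h < cnorm z / 2 -> cnorm z / 2 <= cnorm (z + h).
  move=> hd; have := cnormB_ge z (- h); rewrite cnormN opprK; apply: le_trans.
  by lra.
have zh0 h : cnorm h < cnorm z / 2 -> z + h != 0.
  by move=> /zh; rewrite -cnorm_gt0; apply: lt_le_trans.
(* Caratheodory's identity is asked for all increments, including [h = - z], where the inverse has
   the default value 0. Away from [z] the inverse is replaced by its tangent, so the error term is 0
   there. *)
suff : has_cderiv (fun y => if cnorm (y - z) < cnorm z / 2 then y^-1 else
     z^-1 + - z ^-2 * (y - z)) z (- z ^- 2).
  apply: (has_cderiv_near e0) => h hd.
  by rewrite (_ : z + h - z = h) ?hd//; ring.
apply/has_cderivP.
pose q h := if cnorm h < cnorm z / 2 then h * ((z + h)^-1 * z^-2) else 0.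
exists q.
  apply: (@null_eq (fun h => (if cnorm h < cnorm z / 2 then (z + h)^-1 * z^-2 else 0) * h)).
    by move=> h; rewrite /q; case: ifP => // _; ring.
  apply: nullM null_id; exists ((cnorm z / 2)^-1 * cnorm (z ^- 2)), (cnorm z / 2) => // h hd.
  rewrite hd cnormM ler_wpM2r ?cnorm_ge0// cnormV lef_pV2 ?posrE//;
    first [exact: zh | by rewrite cnorm_gt0 zh0].
move=> h; rewrite subrr cnorm0 e0 (_ : z + h - z = h); last by ring.
rewrite /q; case: ifP => [hd|_]; last by ring.
by field; rewrite z0 zh0.
Qed.

Lemma has_cderiv_unique f z d d' : has_cderiv f z d -> has_cderiv f z d' -> d = d'.
Proof.
move=> Hf Hg; apply/eqP; rewrite -subr_eq0 -cnorm_eq0 eq_le cnorm_ge0 andbT.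
apply/ler_addgt0Pr => e e0; rewrite add0r.
have e20 : 0 < e / 2 by rewrite divr_gt0.
have [d1 d10 H1] := Hf _ e20; have [d2 d20 H2] := Hg _ e20.
pose m := Num.min d1 d2 / 2.
have m0 : 0 < m by rewrite divr_gt0// lt_min d10.
have mlt : m < Num.min d1 d2 by rewrite /m ltr_pdivrMr ?ltr_pMr ?ltr1n// lt_min d10.
have mE : cnorm (m%:C) = m by rewrite cnorm_real gtr0_norm.
move: mlt; rewrite lt_min => /andP[m1 m2].
have := H1 m%:C; have := H2 m%:C; rewrite mE m0 m1 m2 => /(_ isT) h2 /(_ isT) h1.
rewrite -(ler_pM2r m0) -{1}mE -cnormM.
rewrite (_ : _ * _ = (f (z + m%:C) - f z - d' * m%:C) - (f (z + m%:C) - f z - d * m%:C)).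
  by rewrite (le_trans (cnormB _ _))// (splitr e) mulrDl lerD.
by ring.
Qed.

Lemma has_cderivXn z n : has_cderiv (fun z => z ^+ n) z (n%:R * z ^+ n.-1).
Proof.
elim: n => [|n ih]; first by rewrite mul0r; apply: has_cderiv_cst.
have -> : n.+1%:R * z ^+ n.+1.-1 = 1 * z ^+ n + z * (n%:R * z ^+ n.-1).
  by rewrite -natr1 /=; case: n ih => [|n] _ /=; rewrite ?exprS; ring.
by apply: has_cderiv_ext (has_cderivM (has_cderiv_id z) ih) => x; rewrite exprS.
Qed.

End ComplexDerivative.

(** * Curves of a real variable: mean value inequality and primitives *)

Section Curves.
Variable R : realType.
Local Notation C := (complex R).
Implicit Types (x t a b : R) (phi B : R -> R) (g G : R -> C).

Lemma is_derive1P phi x d : is_derive x 1 phi d <->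
  forall e, 0 < e -> exists2 del, 0 < del &
    forall h, `|h| < del -> `|phi (x + h) - phi x - d * h| <= e * `|h|.
Proof.
split=> [[dphi dE] e e0|H].
  have : h^-1 *: (phi (h *: 1 + x) - phi x) @[h --> 0^'] --> d by rewrite -dE.
  move=> /cvgrPdist_le/(_ _ e0)/nbhs_ballP[del /= del0 H].
  exists del => // h hd; have [->|h0] := eqVneq h 0.
    by rewrite addr0 mulr0 !subrr normr0 mulr0.
  have := H h; rewrite /ball /= sub0r normrN => /(_ hd h0).
  rewrite /GRing.scale /= mulr1 (addrC h) => le.
  rewrite -ler_pdivrMr ?normr_gt0// -normrV ?unitfE// -normrM.
  apply: le_trans le; rewrite -normrN le_eqVlt; apply/orP; left; apply/eqP.
  by congr `|_|; field.
have K : h^-1 *: (phi (h *: 1 + x) - phi x) @[h --> 0^'] --> d.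
  apply/cvgrPdist_le => e /H[del del0 {}H]; apply/nbhs_ballP; exists del => //= h.
  rewrite /ball /= sub0r normrN => hd h0.
  rewrite /GRing.scale /= mulr1 (addrC h) distrC.
  rewrite (_ : _ - d = (phi (x + h) - phi x - d * h) / h); last by field.
  by rewrite normrM normfV ler_pdivrMr ?normr_gt0//; exact: H.
by split; [apply/cvg_ex; exists d|exact: cvg_lim K].
Qed.

(** The error [q] lives on the complex plane although it is read only at real points; this lets the
    calculus of [null] functions serve for curves as well. *)
Definition has_rderiv g t d :=
  exists2 q : C -> C, null q & forall x, g (t + x) = g t + (d + q x%:C) * x%:C.

Lemma has_rderivP g t d : has_rderiv g t d <->
  forall e : R, 0 < e -> exists2 del, 0 < del &
    forall x, `|x| < del -> cnorm (g (t + x) - g t - d * x%:C) <= e * `|x|.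
Proof.
split=> [[q nq qE] e /nq[del del0 H]|H].
  exists del => // x xd; rewrite qE (_ : _ - _ = q x%:C * x%:C); last by ring.
  by rewrite cnormM cnorm_real ler_wpM2r// H// cnorm_real.
exists (fun h => if complex.Im h == 0 then
    (g (t + complex.Re h) - g t - d * h) / h else 0).
  move=> e e0; have [del del0 {}H] := H e e0; exists del => // -[x y] /=.
  case: eqP => [->|_ _]; last by rewrite cnorm0 ltW.
  rewrite complexr0 cnorm_real => xd; have [->|x0] := eqVneq x 0.
    by rewrite invr0 mulr0 cnorm0 ltW.
  by rewrite cnormM cnormV cnorm_real ler_pdivrMr ?normr_gt0//; exact: H.
move=> x; rewrite /= eqxx; have [->|x0] := eqVneq x 0; first by rewrite !addr0 mulr0 addr0.
have xC0 : x%:C != 0 by rewrite -cnorm_gt0 cnorm_real normr_gt0.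
by field.
Qed.

Lemma has_rderiv_comp (f : C -> C) g t d v :
  has_rderiv g t v -> has_cderiv f (g t) d -> has_rderiv (fun t => f (g t)) t (d * v).
Proof.
move=> [p np pE] /has_cderivP[q nq qE].
exists (fun h => d * p h + (v + p h) * q ((v + p h) * h)) => [|x]; last first.
  by rewrite pE qE; ring.
have bp : locbnd (fun h => v + p h).
  by apply: locbndD; [exact: locbnd_cst|exact: null_locbnd].
apply: nullD; first exact: nullZ.
by apply: (nullM bp); apply: (null_comp nq); apply: (nullM bp); exact: null_id.
Qed.

Lemma has_rderiv_affine (a b : C) t : has_rderiv (fun t => a + t%:C * b) t b.
Proof.
exists (fun=> 0); first exact: null0.
by move=> x; rewrite real_complexD; ring.
Qed.

Lemma has_rderiv_line (f : C -> C) (a b : C) t d : has_cderiv f (a + t%:C * b) d ->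
  has_rderiv (fun t => f (a + t%:C * b)) t (d * b).
Proof. exact/has_rderiv_comp/has_rderiv_affine. Qed.

Lemma has_rderivD g G t v d : has_rderiv g t v -> has_rderiv G t d ->
  has_rderiv (fun t => g t + G t) t (v + d).
Proof.
move=> [p np pE] [q nq qE]; exists (fun h => p h + q h); first exact: nullD.
by move=> x; rewrite pE qE; ring.
Qed.

Lemma has_rderivZ c g t v : has_rderiv g t v -> has_rderiv (fun t => c * g t) t (c * v).
Proof.
move=> [p np pE]; exists (fun h => c * p h); first exact: nullZ.
by move=> x; rewrite pE; ring.
Qed.

Lemma has_rderiv_ext g G t v : g =1 G -> has_rderiv g t v -> has_rderiv G t v.
Proof. by move=> gG [p np pE]; exists p => // x; rewrite -!gG. Qed.

Lemma has_rderiv_Re g t v : has_rderiv g t v ->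
  is_derive t 1 (fun t => complex.Re (g t)) (complex.Re v).
Proof.
move=> /has_rderivP H; apply/is_derive1P => e /H[del del0 {}H].
exists del => // x /H; apply: le_trans; rewrite -[X in `|X|](_ :
  complex.Re (g (t + x) - g t - v * x%:C) = _) ?cnorm_Re//.
by rewrite !ReD !ReN mulrC Re_realM mulrC.
Qed.

Lemma has_rderiv_Im g t v : has_rderiv g t v ->
  is_derive t 1 (fun t => complex.Im (g t)) (complex.Im v).
Proof.
move=> /has_rderivP H; apply/is_derive1P => e /H[del del0 {}H].
exists del => // x /H; apply: le_trans; rewrite -[X in `|X|](_ :
  complex.Im (g (t + x) - g t - v * x%:C) = _) ?cnorm_Im//.
by rewrite !ImD !ImN mulrC Im_realM mulrC.
Qed.

Lemma has_rderiv_pair phi B t d d' : is_derive t 1 phi d -> is_derive t 1 B d' ->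
  has_rderiv (fun t => phi t +i* B t) t (d +i* d').
Proof.
move=> /is_derive1P H1 /is_derive1P H2; apply/has_rderivP => e e0.
have e20 : 0 < e / 2 by rewrite divr_gt0.
have [d1 d10 {}H1] := H1 _ e20; have [d2 d20 {}H2] := H2 _ e20.
exists (Num.min d1 d2) => [|x]; first by rewrite lt_min d10.
rewrite lt_min => /andP[/H1 h1 /H2 h2].
rewrite (le_trans (cnorm_le_ReIm _))//= (splitr e) mulrDl lerD//.
  by rewrite mulr0 subr0.
by rewrite mulr0 add0r.
Qed.

Lemma is_derive1_nondecreasing B (B' : R -> R) a b : a <= b ->
  (forall t, a <= t <= b -> is_derive t 1 B (B' t)) ->
  (forall t, a <= t <= b -> 0 <= B' t) -> B a <= B b.
Proof.
move=> ab HB B0; rewrite -subr_ge0.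
have [| |c cab ->] := @MVT_segment R B B' a b ab _ _.
- by move=> x; rewrite in_itv/= => /andP[/ltW ax /ltW xb]; apply: HB; rewrite ax.
- by apply: derivable_within_continuous => x; rewrite in_itv/= => /HB[].
- by rewrite mulr_ge0 ?subr_ge0// B0//; move: cab; rewrite in_itv.
Qed.

(** Testing against the fixed direction [u], the conjugate of [g b - g a], reduces to a real
    function: [|u| B - Re (u g)] is nondecreasing, and comparing its endpoints gives
    [|u|^2 <= |u| (B b - B a)]. *)
Lemma mean_value_ineq g (g' : R -> C) B (B' : R -> R) a b : a <= b ->
  (forall t, a <= t <= b -> has_rderiv g t (g' t)) ->
  (forall t, a <= t <= b -> is_derive t 1 B (B' t)) ->
  (forall t, a <= t <= b -> cnorm (g' t) <= B' t) ->
  cnorm (g b - g a) <= B b - B a.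
Proof.
move=> ab Hg HB le; set u := (g b - g a)^*.
have uE : cnorm u = cnorm (g b - g a) by rewrite cnormJ.
have [u0|u0] := eqVneq (cnorm u) 0.
  rewrite -uE u0 subr_ge0; apply: (is_derive1_nondecreasing ab HB) => t /le.
  exact/le_trans/cnorm_ge0.
have : cnorm u * B a - complex.Re (u * g a) <= cnorm u * B b - complex.Re (u * g b).
  apply: (@is_derive1_nondecreasing (fun t => cnorm u * B t - complex.Re (u * g t))
    (fun t => cnorm u * B' t - complex.Re (u * g' t))) => // t tab.
    have h1 := HB _ tab; have h2 := has_rderiv_Re (has_rderivZ u (Hg _ tab)).
    exact: is_deriveB.
  rewrite subr_ge0 (le_trans (ler_norm _))// (le_trans (cnorm_Re _))// cnormM.
  by rewrite ler_wpM2l ?cnorm_ge0// le.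
rewrite -subr_ge0 (_ : _ - _ = cnorm u * (B b - B a) - complex.Re ((g b - g a) * u)).
  by rewrite mulcJ /= -uE subr_ge0 expr2 ler_pM2l// lt0r u0 cnorm_ge0.
by rewrite (mulrC (g b - g a)) (mulrBr u) ReD ReN; ring.
Qed.

Lemma mean_value_bound g (g' : R -> C) (M : R) a b : a <= b ->
  (forall t, a <= t <= b -> has_rderiv g t (g' t)) ->
  (forall t, a <= t <= b -> cnorm (g' t) <= M) ->
  cnorm (g b - g a) <= M * (b - a).
Proof.
move=> ab Hg le; rewrite mulrBr.
apply: (mean_value_ineq (B := fun t => M * t) (B' := fun=> M) ab Hg) => // t _.
by apply: is_derive_eq; rewrite scaler1.
Qed.

Lemma mean_value_segment (f f' : C -> C) (z h c : C) (M : R) :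
  (forall t : R, 0 <= t <= 1 -> has_cderiv f (z + t%:C * h) (f' (z + t%:C * h))) ->
  (forall t : R, 0 <= t <= 1 -> cnorm (f' (z + t%:C * h) - c) <= M) ->
  cnorm (f (z + h) - f z - c * h) <= M * cnorm h.
Proof.
move=> Hf le; pose g t := f (z + t%:C * h) + t%:C * (- (c * h)).
have := @mean_value_bound g (fun t => (f' (z + t%:C * h) - c) * h) (M * cnorm h) 0 1 ler01.
have C0 : (0 : R)%:C = 0 :> C by [].
have C1 : (1 : R)%:C = 1 :> C by [].
rewrite subr0 mulr1 /g C0 C1 !mul1r !mul0r !addr0.
rewrite (_ : f (z + h) + - _ - f z = f (z + h) - f z - c * h); last by ring.
apply => t t01; last by rewrite cnormM ler_wpM2r ?cnorm_ge0// le.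
rewrite mulrBl; apply: has_rderivD; first exact/has_rderiv_line/Hf.
have := has_rderiv_affine 0 (- (c * h)) t.
by apply: has_rderiv_ext => x; rewrite add0r.
Qed.

(** Continuity of a curve at [t] is phrased with the increment [complex.Re h] so that it too is a
    [null] condition on the plane; continuity of curves is assumed in this form below. *)
Lemma has_rderiv_cont g t d : has_rderiv g t d ->
  null (fun h => g (t + complex.Re h) - g t).
Proof.
move=> [q nq qE] e e0.
have : null (fun h => (d + q h) * h).
  by apply: nullM (@null_id R); apply: locbndD; [exact: locbnd_cst|exact: null_locbnd].
move=> /(_ e e0)[del del0 H]; exists del => // h hd.
rewrite qE [X in cnorm X](_ : _ = (d + q (complex.Re h)%:C) * (complex.Re h)%:C).
  by apply: H; rewrite cnorm_real (le_lt_trans (cnorm_Re _)).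
by ring.
Qed.

Lemma continuous_primitive phi a b : {in `[a, b], continuous phi} ->
  exists F, forall x, a <= x <= b -> is_derive x 1 F (phi x).
Proof.
move=> cphi; have [ab|ba] := leP a b; last first.
  by exists phi => x /andP[ax xb]; have := le_lt_trans (le_trans ax xb) ba; rewrite ltxx.
(* Clamping to [[a, b]] extends [phi] continuously to the whole line, which gives two-sided
   derivatives at the ends; [a - 1] and [b + 1] provide the room. *)
pose cl x := Num.max a (Num.min x b).
have clab x : cl x \in `[a, b].
  by rewrite in_itv /= le_max lexx /= ge_max ab ge_min lexx orbT.
have ccl : continuous cl.
  move=> x; apply: (@continuous_max R R (fun=> a) (fun x => Num.min x b) x).
    exact: cst_continuous.
  by apply: (@continuous_min R R id (fun=> b) x) => //; exact: cst_continuous.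
have cpsi : continuous (phi \o cl).
  by move=> x; apply: continuous_comp; [exact: ccl|exact: cphi].
exists (fun x => \int[lebesgue_measure]_(t in [set` `[a - 1, x]]) (phi \o cl) t) => x /andP[ax xb].
have cE : cl x = x by rewrite /cl min_l// max_r.
have := @continuous_FTC1_closed R (phi \o cl) (a - 1) x (b + 1) _ _ _ (cpsi x).
case.
- by lra.
- apply: continuous_compact_integrable; first exact: segment_compact.
  exact/continuous_subspaceT.
- by lra.
- by move=> dF dE; apply: DeriveDef => //; rewrite -derive1E dE /= cE.
Qed.

Lemma curve_primitive g a b :
  (forall t, a <= t <= b -> null (fun h => g (t + complex.Re h) - g t)) ->
  exists G, forall t, a <= t <= b -> has_rderiv G t (g t).
Proof.
move=> cg.
have ct (p : C -> R) : (forall z w, p (z - w) = p z - p w) ->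
    (forall z, `|p z| <= cnorm z) -> {in `[a, b], continuous (fun t => p (g t))}.
  move=> pB pn t; rewrite in_itv/= => /cg H; apply/cvgrPdist_le => e /H[del del0 {}H].
  apply/nbhs_ballP; exists del => //= y; rewrite /ball /= => yd.
  rewrite distrC -pB (le_trans (pn _))// -(subrKC t y).
  by have := H (y - t)%:C; rewrite cnorm_real distrC; exact.
have [F1 H1] := continuous_primitive (ct (@complex.Re R) (fun z w => etrans (ReD _ _)
   (congr1 _ (ReN _))) (@cnorm_Re R)).
have [F2 H2] := continuous_primitive (ct (@complex.Im R) (fun z w => etrans (ImD _ _)
   (congr1 _ (ImN _))) (@cnorm_Im R)).
exists (fun t => F1 t +i* F2 t) => t tab.
have -> : g t = complex.Re (g t) +i* complex.Im (g t) by case: (g t).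
by apply: has_rderiv_pair; [exact: H1|exact: H2].
Qed.

End Curves.

(** * Goursat's theorem *)

Section Goursat.
Variable R : realType.
Local Notation C := (complex R).
Implicit Types (x y t a b c d : R) (f : C -> C).

(** The first hypothesis says that [v] is a unit vector orthogonal to [u]. The line then meets the
    closed disc in a chord [|t| <= s] or not at all, so one primitive covers the whole
    intersection. *)
Lemma slice_primitive f (u v : C) (r : R) :
  (forall t, cnorm (u + t%:C * v) ^+ 2 = cnorm u ^+ 2 + t ^+ 2) ->
  (forall t, cnorm (u + t%:C * v) <= r -> exists d : C, has_cderiv f (u + t%:C * v) d) ->
  exists G : R -> C, forall t, cnorm (u + t%:C * v) <= r ->
    has_rderiv G t (f (u + t%:C * v)).
Proof.
move=> uv df; pose s := Num.sqrt (r ^+ 2 - cnorm u ^+ 2).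
have [r0|r0] := ltP r 0.
  by exists (fun=> 0) => t /le_lt_trans/(_ r0); rewrite ltNge cnorm_ge0.
have [ur|ur] := leP (cnorm u) r; last first.
  exists (fun=> 0) => t; rewrite leNgt -ltr_sqr ?nnegrE ?cnorm_ge0// uv.
  by rewrite ltr_wpDr ?sqr_ge0// ltr_sqr ?nnegrE ?cnorm_ge0// .
have sP t : (cnorm (u + t%:C * v) <= r) = (- s <= t <= s).
  rewrite -ler_norml -ler_sqr ?nnegrE ?cnorm_ge0// uv -lerBrDl.
  rewrite -ler_sqrt; last by rewrite subr_ge0 ler_sqr ?nnegrE ?cnorm_ge0.
  by rewrite sqrtr_sqr.
have [|G HG] := @curve_primitive R (fun t => f (u + t%:C * v)) (- s) s.
  by move=> t; rewrite -sP => /df[d /has_rderiv_line/has_rderiv_cont].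
by exists G => t; rewrite sP => /HG.
Qed.

Lemma nested_intervals (u v : nat -> R) : (forall n, u n <= u n.+1) ->
  (forall n, v n.+1 <= v n) -> (forall n, u n <= v n) ->
  exists x, forall n, u n <= x <= v n.
Proof.
move=> uS vS uv.
have um : {homo u : m n / (m <= n)%N >-> m <= n} by apply/nondecreasing_seqP.
have vm : {homo v : m n / (n <= m)%N >-> m <= n}.
  by move=> m n nm; apply: (iffLR (nonincreasing_seqP v) vS n m nm).
have uvmn m n : u m <= v n.
  by rewrite (le_trans (um _ _ (leq_maxl m n)))// (le_trans (uv _))// vm// leq_maxr.
exists (sup (range u)) => n; apply/andP; split.
  by apply: ub_le_sup; [exists (v 0) => _ [m _ <-]|exists n].
by apply: ge_sup; [exists (u 0), 0|move=> _ [m _ <-]].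
Qed.

Lemma geometric_small (L e : R) : 0 < e -> exists n, L / 2 ^+ n < e.
Proof.
move=> e0; have [n Hn] : exists n : nat, `|L| / e < n%:R.
  by exists (Num.bound (`|L| / e)); apply: archi_boundP; rewrite divr_ge0// ltW.
exists n; rewrite ltr_pdivrMr ?exprn_gt0//.
apply: (le_lt_trans (ler_norm _)); rewrite mulrC -ltr_pdivrMr// (lt_trans Hn)//.
by rewrite -natrX ltr_nat ltn_expl.
Qed.

(** Compactness by bisection: a rectangle where [P] fails has a quarter where it fails, and the
    nested quarters shrink to a point that contradicts the local hypothesis. Degenerate rectangles,
    with [c = d], give the same principle on an interval. *)
Lemma quarter_bisection (P : R -> R -> R -> R -> Prop) a0 b0 c0 d0 :
  a0 <= b0 -> c0 <= d0 ->
  (forall a b c d, a0 <= a -> a <= b -> b <= b0 -> c0 <= c -> c <= d -> d <= d0 ->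
    let m := (a + b) / 2 in let n := (c + d) / 2 in
    P a m c n -> P m b c n -> P a m n d -> P m b n d -> P a b c d) ->
  (forall x y, a0 <= x <= b0 -> c0 <= y <= d0 -> exists2 e, 0 < e &
    forall a b c d, a0 <= a -> b <= b0 -> c0 <= c -> d <= d0 ->
      a <= x <= b -> c <= y <= d -> (b - a) + (d - c) < e -> P a b c d) ->
  P a0 b0 c0 d0.
Proof.
move=> ab0 cd0 HP Hloc; apply: contrapT => nP.
pose T := (R * R * (R * R))%type.
pose ok (Q : T) := [/\ a0 <= Q.1.1, Q.1.1 <= Q.1.2 & Q.1.2 <= b0] /\
   [/\ c0 <= Q.2.1, Q.2.1 <= Q.2.2 & Q.2.2 <= d0].
pose bad (Q : T) := ok Q /\ ~ P Q.1.1 Q.1.2 Q.2.1 Q.2.2.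
pose sub (Q Q' : T) := [/\ Q.1.1 <= Q'.1.1, Q'.1.2 <= Q.1.2,
  Q'.1.2 - Q'.1.1 = (Q.1.2 - Q.1.1) / 2 &
  [/\ Q.2.1 <= Q'.2.1, Q'.2.2 <= Q.2.2 & Q'.2.2 - Q'.2.1 = (Q.2.2 - Q.2.1) / 2]].
have /choice[step stepP] : forall Q, exists Q', bad Q -> bad Q' /\ sub Q Q'.
  move=> [[a b] [c d]]; apply: contrapT => /forallNP H.
  have [[/= [a1 a2 a3] [c1 c2 c3]] /= nP1] : bad ((a, b), (c, d)).
    by apply: contrapT => nb; apply: (H ((a, b), (c, d))) => /nb.
  set m := (a + b) / 2; set n := (c + d) / 2.
  have am : a <= m by rewrite /m; lra.
  have mb : m <= b by rewrite /m; lra.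
  have cn : c <= n by rewrite /n; lra.
  have nd : n <= d by rewrite /n; lra.
  have dec (Q : T) : (sub ((a, b), (c, d)) Q /\ ok Q) -> P Q.1.1 Q.1.2 Q.2.1 Q.2.2.
    by move=> [sQ oQ]; apply: contrapT => nQ; apply: (H Q) => _; split.
  apply: nP1; apply: HP => //.
  - by apply: (dec ((a, m), (c, n))); split; split=> //=;
      try split => //=; rewrite /m /n; lra.
  - by apply: (dec ((m, b), (c, n))); split; split=> //=;
      try split => //=; rewrite /m /n; lra.
  - by apply: (dec ((a, m), (n, d))); split; split=> //=;
      try split => //=; rewrite /m /n; lra.
  - by apply: (dec ((m, b), (n, d))); split; split=> //=;
      try split => //=; rewrite /m /n; lra.
pose S n := iter n step ((a0, b0), (c0, d0)).
have badS n : bad (S n).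
  by elim: n => [|n ih]; [split|rewrite /S iterS; have [] := stepP _ ih].
have subS n : sub (S n) (S n.+1) by have [] := stepP _ (badS n).
have [|||x Hx] := @nested_intervals (fun n => (S n).1.1) (fun n => (S n).1.2).
- by move=> n; have [] := subS n.
- by move=> n; have [] := subS n.
- by move=> n; have [[[]]] := badS n.
have [|||y Hy] := @nested_intervals (fun n => (S n).2.1) (fun n => (S n).2.2).
- by move=> n; have [_ _ _ []] := subS n.
- by move=> n; have [_ _ _ []] := subS n.
- by move=> n; have [[_ []]] := badS n.
have [e e0 He] := Hloc x y (Hx 0) (Hy 0).
have szE n : ((S n).1.2 - (S n).1.1) + ((S n).2.2 - (S n).2.1) =
    ((b0 - a0) + (d0 - c0)) / 2 ^+ n.
  elim: n => [|n ih]; first by rewrite expr0 divr1.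
  have [_ _ -> [_ _ ->]] := subS n.
  by rewrite exprSr invfM mulrA -ih -mulrDl.
have [n Hn] := geometric_small ((b0 - a0) + (d0 - c0)) e0.
have [[[u1 u2 u3] [v1 v2 v3]]] := badS n; apply; apply: He => //.
by rewrite szE.
Qed.

Section rectangle.
Variables (f : C -> C) (r : R) (H V : R -> R -> C).
Hypothesis df : forall z, cnorm z <= r -> exists d : C, has_cderiv f z d.
Hypothesis dH : forall x y, cnorm (x +i* y) <= r -> has_rderiv (H y) x (f (x +i* y)).
Hypothesis dV : forall x y, cnorm (x +i* y) <= r -> has_rderiv (V x) y (f (x +i* y)).

(** This is the integral of [f] over the boundary of the rectangle, counterclockwise from the lower
    side, expressed through primitives of [f] along horizontal lines ([H]) and vertical lines
    ([V]). *)
Let Phi a b c d : C := (H c b - H c a) + 'i%C * (V b d - V b c)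
  - (H d b - H d a) - 'i%C * (V a d - V a c).

Let horE x y : (0 +i* y) + x%:C * 1 = x +i* y :> C.
Proof. by simpc. Qed.
Let verE x y : x%:C + y%:C * 'i%C = x +i* y :> C.
Proof. by simpc. Qed.

(** The bound [e * L^2], with [L] half the perimeter, is additive under quartering, so bisection
    reduces it to small rectangles around a point [z0]. There [f] differs by at most a small
    multiple of [L] from its first-order expansion, whose boundary integral vanishes. *)
Lemma goursat_rect a b c d : a <= b -> c <= d ->
  (forall x y, a <= x <= b -> c <= y <= d -> cnorm (x +i* y) <= r) ->
  Phi a b c d = 0.
Proof.
move=> ab cd inr; apply/eqP; rewrite -cnorm_eq0 eq_le cnorm_ge0 andbT.
set L := (b - a) + (d - c).
have L0 : 0 <= L by rewrite addr_ge0 ?subr_ge0.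
suff K e : 0 < e -> cnorm (Phi a b c d) <= e * L ^+ 2.
  apply/ler_addgt0Pr => e e0; rewrite add0r.
  have LL : 0 < L ^+ 2 + 1 by rewrite ltr_wpDl// sqr_ge0.
  apply: (le_trans (K _ (divr_gt0 e0 LL))).
  by rewrite -mulrA ler_piMr ?ltW// mulrC ltr_pdivrMr// mul1r ltrDl.
move=> e0.
apply: (@quarter_bisection (fun a b c d => cnorm (Phi a b c d) <= e * ((b - a) + (d - c)) ^+ 2)) => //.
  move=> a1 b1 c1 d1 _ _ _ _ _ _ m n P1 P2 P3 P4.
  rewrite (_ : Phi _ _ _ _ = (Phi a1 m c1 n + Phi m b1 c1 n) + (Phi a1 m n d1 + Phi m b1 n d1)); last first.
    by rewrite /Phi; ring.
  rewrite (_ : e * _ = (e * (m - a1 + (n - c1)) ^+ 2 + e * (b1 - m + (n - c1)) ^+ 2) +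
     (e * (m - a1 + (d1 - n)) ^+ 2 + e * (b1 - m + (d1 - n)) ^+ 2)); last first.
    by rewrite /m /n; field.
  do 2?[rewrite (le_trans (cnormD _ _))//]; rewrite lerD//.
    by rewrite (le_trans (cnormD _ _))// lerD.
  by rewrite (le_trans (cnormD _ _))// lerD.
move=> x0 y0 x0ab y0cd; set z0 := x0 +i* y0.
have [D HD] := df (inr _ _ x0ab y0cd).
(* Half of [e], because the horizontal and the vertical sides each come in pairs. *)
have [del del0 Hdel] := HD _ (divr_gt0 e0 (ltr0Sn _ 1)).
exists del => // a1 b1 c1 d1 aa1 b1b cc1 d1d x0ab1 y0cd1 small.
set L1 := (b1 - a1) + (d1 - c1) in small *.
have L10 : 0 <= L1 by rewrite /L1; lra.
have {Hdel} Hdel z : cnorm (z - z0) <= L1 -> cnorm (f z - (f z0 + D * (z - z0))) <= e / 2 * L1.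
  move=> zL; have [->|zz0] := eqVneq z z0.
    by rewrite !subrr mulr0 addr0 subrr cnorm0 mulr_ge0// divr_ge0// ltW.
  have := Hdel (z - z0); rewrite cnorm_gt0 subr_eq0 zz0 (le_lt_trans zL small).
  move=> /(_ isT); rewrite subrKC opprD addrA => /le_trans; apply.
  by rewrite ler_wpM2l// divr_ge0// ltW.
(* A primitive of the first-order Taylor polynomial of [f] at [z0]. *)
pose P (z : C) := f z0 * z + D * ((z - z0) * (z - z0) / 2).
have dP z : has_cderiv P z (f z0 + D * (z - z0)).
  have h1 : has_cderiv (fun z => z - z0) z 1.
    rewrite -[X in has_cderiv _ _ X]subr0.
    by apply: has_cderivB; [exact: has_cderiv_id|exact: has_cderiv_cst].
  have := has_cderivD (has_cderivZ (f z0) (has_cderiv_id z))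
     (has_cderivZ (D / 2) (has_cderivM h1 h1)).
  rewrite (_ : _ + _ = f z0 + D * (z - z0)); last by field.
  by apply: has_cderiv_ext => y; rewrite /P; ring.
have near x y : a1 <= x <= b1 -> c1 <= y <= d1 -> cnorm ((x +i* y) - z0) <= L1.
  move=> xab ycd; apply: (le_trans (cnorm_le_ReIm _)) => /=; rewrite /L1 lerD//.
    by rewrite ler_norml; apply/andP; split; lra.
  by rewrite ler_norml; apply/andP; split; lra.
have ab1 : a1 <= b1 by lra. have cd1 : c1 <= d1 by lra.
have hor y : c1 <= y <= d1 -> cnorm ((H y b1 - H y a1) - (P (b1 +i* y) - P (a1 +i* y)))
    <= e / 2 * L1 * (b1 - a1).
  move=> ycd; pose g t := H y t + (-1) * P ((0 +i* y) + t%:C * 1).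
  have := @mean_value_bound R g (fun t => f (t +i* y) - (f z0 + D * ((t +i* y) - z0)))
    (e / 2 * L1) _ _ ab1.
  rewrite /g !horE !mulN1r (_ : H y b1 - _ - _ = (H y b1 - H y a1) - (P (b1 +i* y) - P (a1 +i* y))); last by ring.
  apply=> t tab.
    apply: has_rderivD; first by apply/dH/inr; lra.
    rewrite -[X in has_rderiv _ _ X]mulN1r; apply: has_rderivZ; rewrite -[X in has_rderiv _ _ X]mulr1.
    by apply: has_rderiv_line; rewrite horE; exact: dP.
  by apply/Hdel/near.
have ver x : a1 <= x <= b1 -> cnorm ('i%C * (V x d1 - V x c1) - (P (x +i* d1) - P (x +i* c1)))
    <= e / 2 * L1 * (d1 - c1).
  move=> xab; pose g t := 'i%C * V x t + (-1) * P (x%:C + t%:C * 'i%C).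
  have := @mean_value_bound R g (fun t => 'i%C * (f (x +i* t) - (f z0 + D * ((x +i* t) - z0))))
    (e / 2 * L1) _ _ cd1.
  rewrite /g !verE !mulN1r (_ : 'i%C * V x d1 - _ - _ = 'i%C * (V x d1 - V x c1) - (P (x +i* d1) - P (x +i* c1))); last by ring.
  apply=> t tcd.
    rewrite mulrBr; apply: has_rderivD; first by apply/has_rderivZ/dV/inr; lra.
    rewrite -[X in has_rderiv _ _ X]mulN1r; apply: has_rderivZ; rewrite mulrC.
    by apply: has_rderiv_line; rewrite verE; exact: dP.
  rewrite cnormM (_ : cnorm 'i%C = 1) ?mul1r; first by apply/Hdel/near.
  by rewrite /cnorm /= expr0n /= add0r expr1n sqrtr1.
have c1cd : c1 <= c1 <= d1 by rewrite lexx.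
have d1cd : c1 <= d1 <= d1 by rewrite lexx andbT.
have a1ab : a1 <= a1 <= b1 by rewrite lexx.
have b1ab : a1 <= b1 <= b1 by rewrite lexx andbT.
have := conj (conj (hor _ c1cd) (hor _ d1cd)) (conj (ver _ a1ab) (ver _ b1ab)).
set u1 := (X in cnorm X <= _); set u2 := (X in (_ /\ cnorm X <= _) /\ _).
set u3 := (X in _ /\ (cnorm X <= _ /\ _)); set u4 := (X in _ /\ (_ /\ cnorm X <= _)).
move=> [[k1 k2] [k3 k4]].
rewrite (_ : Phi _ _ _ _ = (u1 + u4) - (u2 + u3)); last first.
  by rewrite /Phi /u1 /u2 /u3 /u4; ring.
rewrite (le_trans (cnormB _ _))//.
rewrite (_ : e * _ = (e / 2 * L1 * (b1 - a1) + e / 2 * L1 * (d1 - c1)) +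
   (e / 2 * L1 * (b1 - a1) + e / 2 * L1 * (d1 - c1))); last by rewrite /L1; field.
by rewrite lerD// (le_trans (cnormD _ _))// lerD.
Qed.

(** One side lies on the real axis, so the two opposite corners control the rectangle: its points
    have [|y| <= |d|] and [|x| <= max(|a|, |b|)]. The signs of [d] and [b - a] are free since [Phi]
    is antisymmetric in each pair of bounds. *)
Lemma goursat_corner a b d : cnorm (a +i* d) <= r -> cnorm (b +i* d) <= r ->
  Phi a b 0 d = 0.
Proof.
move=> ad bd; have r0 : 0 <= r by apply: le_trans ad; exact: cnorm_ge0.
have key x y : a <= x <= b \/ b <= x <= a -> 0 <= y <= d \/ d <= y <= 0 ->
    cnorm (x +i* y) <= r.
  move=> xab yd; have y2 : y ^+ 2 <= d ^+ 2 by case: yd => ?; nra.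
  have [x2|x2] : x ^+ 2 <= a ^+ 2 \/ x ^+ 2 <= b ^+ 2.
    have [x0|x0] := leP 0 x; case: xab => ?; (by left; nra) || (by right; nra).
  - rewrite (le_trans _ ad)// -ler_sqr ?nnegrE ?cnorm_ge0// !cnorm_sqr /=.
    exact: lerD.
  - rewrite (le_trans _ bd)// -ler_sqr ?nnegrE ?cnorm_ge0// !cnorm_sqr /=.
    exact: lerD.
have PhiNx c1 d1 : Phi a b c1 d1 = - Phi b a c1 d1 by rewrite /Phi; ring.
have PhiNy a1 b1 : Phi a1 b1 0 d = - Phi a1 b1 d 0 by rewrite /Phi; ring.
have [ab|/ltW ab] := leP a b; have [d0|/ltW d0] := leP 0 d.
- by apply: goursat_rect => // x y xab yd; apply: key; left.
- by rewrite PhiNy goursat_rect ?oppr0// => x y xab yd; apply: key; [left|right].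
- by rewrite PhiNx goursat_rect ?oppr0// => x y xab yd; apply: key; [right|left].
- by rewrite PhiNy PhiNx goursat_rect ?oppr0// => x y xab yd; apply: key; right.
Qed.

End rectangle.
End Goursat.

(** * Primitives on discs and difference quotients *)

Section DiscPrimitive.
Variable R : realType.
Local Notation C := (complex R).
Implicit Types (z w : C) (f G : C -> C) (r : R).

Definition hol r f := forall z, cnorm z < r -> exists d, has_cderiv f z d.

(** Parametrizing the interval between [x] and [x + h] by [[0, 1]] covers increments of either
    sign. *)
Lemma mean_value_shift (g g' : R -> C) (x h : R) (c : C) (M : R) :
  (forall s : R, 0 <= s <= 1 -> has_rderiv g (x + s * h) (g' (x + s * h))) ->
  (forall s : R, 0 <= s <= 1 -> cnorm (g' (x + s * h) - c) <= M) ->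
  cnorm (g (x + h) - g x - c * h%:C) <= M * `|h|.
Proof.
move=> dg le; pose k s := g (x + s * h) + s%:C * (- (c * h%:C)).
have := @mean_value_bound R k (fun s => (g' (x + s * h) - c) * h%:C) (M * `|h|) 0 1 ler01.
have C0 : (0 : R)%:C = 0 :> C by [].
have C1 : (1 : R)%:C = 1 :> C by [].
rewrite subr0 mulr1 /k C0 C1 !mul1r !mul0r !addr0.
rewrite (_ : g (x + h) + - _ - g x = g (x + h) - g x - c * h%:C); last by ring.
apply => s s01; last by rewrite cnormM cnorm_real ler_wpM2r// le.
rewrite mulrBl; apply: has_rderivD; last first.
  have := has_rderiv_affine 0 (- (c * h%:C)) s.
  by apply: has_rderiv_ext => y; rewrite add0r.
have [q nq qE] := dg _ s01.
exists (fun y => h%:C * q (h%:C * y)).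
  by apply: nullZ; apply: null_comp nq _; apply: nullZ; exact: null_id.
by move=> y; rewrite mulrDl addrA qE real_complexM (mulrC y%:C); ring.
Qed.

Lemma hol_slice_primitives f r : (forall z, cnorm z <= r -> exists d, has_cderiv f z d) ->
  exists H V : R -> R -> C, forall x y, cnorm (x +i* y) <= r ->
    has_rderiv (H y) x (f (x +i* y)) /\ has_rderiv (V x) y (f (x +i* y)).
Proof.
move=> df.
have horE x y : (0 +i* y) + x%:C * 1 = x +i* y :> C by simpc.
have verE x y : x%:C + y%:C * 'i%C = x +i* y :> C by simpc.
have /choice[H HP] : forall y, exists G : R -> C, forall x, cnorm (x +i* y) <= r ->
    has_rderiv G x (f (x +i* y)).
  move=> y; have [||G HG] := @slice_primitive R f (0 +i* y) 1 r.
  - by move=> t; rewrite !cnorm_sqr horE /=; ring.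
  - by move=> t /df.
  - by exists G => x; have := HG x; rewrite horE.
have /choice[V VP] : forall x, exists G : R -> C, forall y, cnorm (x +i* y) <= r ->
    has_rderiv G y (f (x +i* y)).
  move=> x; have [||G HG] := @slice_primitive R f x%:C 'i%C r.
  - by move=> t; rewrite !cnorm_sqr verE /=; ring.
  - by move=> t /df.
  - by exists G => y; have := HG y; rewrite verE.
by exists H, V => x y xy; split; [exact: HP|exact: VP].
Qed.

(** [F] integrates from 0 along the real axis and then vertically. By the corner case of Goursat's
    theorem the horizontal part of an increment may be moved up to the height of [z]; both parts of
    the increment then stay near [z], where [f] is nearly constant. *)
Lemma disc_primitive f r r' : hol r f -> r' < r ->
  exists F, forall z, cnorm z < r' -> has_cderiv F z (f z).
Proof.
move=> hf r'r.
have df z : cnorm z <= r' -> exists d, has_cderiv f z d.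
  by move=> zr; apply: hf; exact: le_lt_trans zr r'r.
have [H [V HV]] := hol_slice_primitives df.
have dH x y : cnorm (x +i* y) <= r' -> has_rderiv (H y) x (f (x +i* y)) by move=> /HV[].
have dV x y : cnorm (x +i* y) <= r' -> has_rderiv (V x) y (f (x +i* y)) by move=> /HV[].
exists (fun z => (H 0 (complex.Re z) - H 0 0) +
  'i%C * (V (complex.Re z) (complex.Im z) - V (complex.Re z) 0)) => -[x y] zr e e0.
have [D] := df _ (ltW zr) => /null_cont/(_ _ (divr_gt0 e0 (ltr0Sn _ 1)))[del del0 Hdel].
exists (Num.min del (r' - cnorm (x +i* y))) => [|[h1 h2]].
  by rewrite lt_min del0 subr_gt0.
rewrite lt_min => /and3P[_ hd hr] /=.
have h1n : `|h1| <= cnorm (h1 +i* h2) by apply: (cnorm_Re (h1 +i* h2)).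
have h2n : `|h2| <= cnorm (h1 +i* h2) by apply: (cnorm_Im (h1 +i* h2)).
have inr (k : C) : cnorm k <= cnorm (h1 +i* h2) -> cnorm ((x +i* y) + k) <= r'.
  move=> kh; apply: (le_trans (cnormD _ _)); move: hr; rewrite ltrBrDl => /ltW.
  by apply: le_trans; rewrite lerD2l.
have s1 (s : R) (k : C) : 0 <= s <= 1 -> cnorm (s%:C * k) <= cnorm k.
  by move=> /andP[s0 s1']; rewrite cnormM cnorm_real ger0_norm// ler_piMl ?cnorm_ge0.
have h1c : cnorm (h1 +i* 0) <= cnorm (h1 +i* h2) by rewrite complexr0 cnorm_real.
have k1 (s : R) : 0 <= s <= 1 -> cnorm (s%:C * (h1 +i* 0)) <= cnorm (h1 +i* h2).
  by move=> /s1 le; exact: le_trans (le _) h1c.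
have k2 (s : R) : 0 <= s <= 1 -> cnorm (h1 +i* (s * h2)) <= cnorm (h1 +i* h2).
  move=> /andP[s0 s1']; rewrite -ler_sqr ?nnegrE ?cnorm_ge0// !cnorm_sqr /= lerD2l.
  by rewrite exprMn ler_piMl ?sqr_ge0// expr_le1.
have e1 (s : R) : (x + s * h1) +i* y = (x +i* y) + s%:C * (h1 +i* 0) by simpc.
have e2 (s : R) : (x + h1) +i* (y + s * h2) = (x +i* y) + (h1 +i* (s * h2)) by simpc.
have A1 : cnorm (H y (x + h1) - H y x - f (x +i* y) * h1%:C) <= e / 2 * `|h1|.
  apply: (mean_value_shift (g' := fun t => f (t +i* y))) => s s01.
    by apply: dH; rewrite e1; apply/inr/k1.
  by rewrite e1; apply: Hdel; apply: le_lt_trans hd; exact: k1.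
have A2 : cnorm (V (x + h1) (y + h2) - V (x + h1) y - f (x +i* y) * h2%:C) <= e / 2 * `|h2|.
  apply: (mean_value_shift (g' := fun t => f ((x + h1) +i* t))) => s s01.
    by apply: dV; rewrite e2; apply/inr/k2.
  by rewrite e2; apply: Hdel; apply: le_lt_trans hd; exact: k2.
have := @goursat_corner R f r' H V df dH dV x (x + h1) y (ltW zr).
have -> : (x + h1) +i* y = (x +i* y) + (h1 +i* 0) :> C by simpc.
move=> /(_ (inr _ h1c)) P0.
set A := H y (x + h1) - _ - _ in A1; set B := V _ _ - _ - _ in A2.
rewrite (_ : _ - _ = A + 'i%C * B); last first.
  apply/eqP; rewrite -subr_eq0; apply/eqP; rewrite -[RHS]P0 /A /B.
  rewrite (_ : h1 +i* h2 = h1%:C + 'i%C * h2%:C :> C); last by simpc.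
  by ring.
rewrite (le_trans (cnormD _ _))// cnormM.
have -> : cnorm ('i%C : C) = 1 by rewrite /cnorm /= expr0n /= add0r expr1n sqrtr1.
rewrite mul1r (le_trans (lerD A1 A2))//.
have := ler_wpM2l (ltW e0) h1n; have := ler_wpM2l (ltW e0) h2n; lra.
Qed.

Definition dquot f w a z := if z == w then a else (f z - f w) / (z - w).

(** A removable singularity by Taylor expansion: [K], which is [G] minus its quadratic expansion at
    [w], has derivative o(|z - w|), so [K (w + h) - K w = o(|h|^2)], and dividing twice by [h]
    leaves o(1). *)
Lemma dquot_deriv G f w d r : 0 < r ->
  (forall h, cnorm h < r -> has_cderiv G (w + h) (f (w + h))) -> has_cderiv f w d ->
  has_cderiv (dquot G w (f w)) w (d / 2).
Proof.
move=> r0 dG df e e0; have [del del0 Hdel] := df _ e0.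
exists (Num.min del r) => [|h]; first by rewrite lt_min del0.
rewrite lt_min => /and3P[]; rewrite cnorm_gt0 => h0 hd hr.
pose K z := G z - (f w * z + (d / 2) * ((z - w) * (z - w))).
have zh (t : R) : 0 <= t <= 1 -> cnorm (t%:C * h) <= cnorm h.
  by move=> /andP[t0 t1]; rewrite cnormM cnorm_real ger0_norm// ler_piMl ?cnorm_ge0.
have dK z : cnorm (z - w) < r -> has_cderiv K z (f z - (f w + d * (z - w))).
  move=> zr; apply: has_cderivB; first by rewrite -(subrKC w z); exact: dG.
  have h1 : has_cderiv (fun z => z - w) z 1.
    rewrite -[X in has_cderiv _ _ X]subr0.
    by apply: has_cderivB; [exact: has_cderiv_id|exact: has_cderiv_cst].
  have := has_cderivD (has_cderivZ (f w) (has_cderiv_id z))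
     (has_cderivZ (d / 2) (has_cderivM h1 h1)).
  by rewrite (_ : _ + _ = f w + d * (z - w)); last by field.
have M1 : cnorm (K (w + h) - K w - 0 * h) <= e * cnorm h * cnorm h.
  apply: (@mean_value_segment R K (fun z => f z - (f w + d * (z - w)))) => t /zh th.
    by apply: dK; rewrite addrC addKr (le_lt_trans th).
  rewrite subr0 (addrC w) addrK; have [->|th0] := eqVneq (t%:C * h) 0.
    by rewrite add0r mulr0 addr0 subrr cnorm0 mulr_ge0 ?cnorm_ge0// ltW.
  rewrite (addrC _ w) opprD addrA (le_trans (Hdel _ _))//.
    by rewrite cnorm_gt0 th0 (le_lt_trans th).
  by rewrite ler_wpM2l// ltW.
rewrite /dquot eqxx -subr_eq0 (_ : w + h - w = h); last by ring.
rewrite (negbTE h0) -(ler_pM2r (_ : 0 < cnorm h)) ?cnorm_gt0// -cnormM.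
move: h0; rewrite -subr_eq0 subr0 => h0.
rewrite (_ : _ * h = K (w + h) - K w - 0 * h)//.
by rewrite /K; field.
Qed.

Lemma hol_dquot G f w r : (forall z, cnorm z < r -> has_cderiv G z (f z)) ->
  cnorm w < r -> (exists d, has_cderiv f w d) -> hol r (dquot G w (f w)).
Proof.
move=> dG wr [d dw] z zr; have [->|zw] := eqVneq z w.
  exists (d / 2); apply: (dquot_deriv _ _ dw (r := r - cnorm w)); first by rewrite subr_gt0.
  move=> h hr; apply: dG; apply: (le_lt_trans (cnormD _ _)).
  by rewrite -ltrBrDl.
have h1 : has_cderiv (fun z => z - w) z 1.
  rewrite -[X in has_cderiv _ _ X]subr0.
  by apply: has_cderivB; [exact: has_cderiv_id|exact: has_cderiv_cst].
have zw0 : z - w != 0 by rewrite subr_eq0.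
have h2 := has_cderivB (dG _ zr) (has_cderiv_cst (G w) z).
have h3 := has_cderivM h2 (has_cderiv_comp h1 (has_cderivV zw0)).
eexists; apply: (has_cderiv_near _ _ h3 (r := cnorm (z - w))); first by rewrite cnorm_gt0.
move=> h hr; rewrite /dquot; case: eqP => // zhw.
by move: hr; rewrite -zhw opprD addNKr cnormN ltxx.
Qed.

End DiscPrimitive.

(** * Circle means and Cauchy's formula *)

Section CircleMeans.
Variable R : realType.
Local Notation C := (complex R).
Implicit Types (z w : C) (f F G : C -> C) (r : R).

Definition cvgC (u : nat -> C) (l : C) := forall e : R, 0 < e ->
  exists N0, forall N, (N0 <= N)%N -> cnorm (u N - l) <= e.

Lemma cvgC_ext (u v : nat -> C) l : (forall N, (0 < N)%N -> u N = v N) ->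
  cvgC u l -> cvgC v l.
Proof.
move=> uv H e /H[N0 {}H]; exists (maxn 1 N0) => N; rewrite geq_max => /andP[N1 NN0].
by rewrite -uv//; exact: H.
Qed.

Lemma cvgC_cst l : cvgC (fun=> l) l.
Proof. by move=> e e0; exists 0 => N _; rewrite subrr cnorm0 ltW. Qed.

Lemma cvgCD (u v : nat -> C) l m : cvgC u l -> cvgC v m ->
  cvgC (fun N => u N + v N) (l + m).
Proof.
move=> Hu Hv e e0; have e20 : 0 < e / 2 by rewrite divr_gt0.
have [N1 H1] := Hu _ e20; have [N2 H2] := Hv _ e20.
exists (maxn N1 N2) => N; rewrite geq_max => /andP[/H1 h1 /H2 h2].
rewrite (_ : _ - _ = (u N - l) + (v N - m)); last by ring.
by rewrite (le_trans (cnormD _ _))// (splitr e) lerD.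
Qed.

Lemma cvgCM (u v : nat -> C) l m : cvgC u l -> cvgC v m ->
  cvgC (fun N => u N * v N) (l * m).
Proof.
move=> Hu Hv e e0.
have c0 : 0 < cnorm l + cnorm m + 1 by rewrite ltr_wpDl// addr_ge0// cnorm_ge0.
pose e' := Num.min 1 (e / (cnorm l + cnorm m + 1)).
have e'0 : 0 < e' by rewrite lt_min ltr01 divr_gt0.
have [N1 H1] := Hu _ e'0; have [N2 H2] := Hv _ e'0.
exists (maxn N1 N2) => N; rewrite geq_max => /andP[/H1 h1 /H2 h2].
rewrite (_ : _ - _ = (u N - l) * (v N - m) + ((u N - l) * m + l * (v N - m))); last by ring.
have h3 : e' <= 1 by rewrite ge_min lexx.
have h4 : e' + (e' * cnorm m + cnorm l * e') <= e.
  have : e' * (cnorm l + cnorm m + 1) <= e by rewrite -ler_pdivlMr// ge_min lexx orbT.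
  lra.
apply: le_trans h4; rewrite (le_trans (cnormD _ _))// lerD//.
  by rewrite cnormM -[X in _ <= X]mulr1 ler_pM ?cnorm_ge0// (le_trans h2).
rewrite (le_trans (cnormD _ _))// !cnormM lerD//.
  by rewrite ler_wpM2r// cnorm_ge0.
by rewrite ler_wpM2l// cnorm_ge0.
Qed.

Lemma cvgCZ c (u : nat -> C) l : cvgC u l -> cvgC (fun N => c * u N) (c * l).
Proof. exact/cvgCM/cvgC_cst. Qed.

Lemma cvgC_norm_le (u : nat -> C) l (M : R) :
  (exists N0, forall N, (N0 <= N)%N -> cnorm (u N) <= M) -> cvgC u l -> cnorm l <= M.
Proof.
move=> [N0 H] Hu; apply/ler_addgt0Pr => e /Hu[N1 H1].
have := H1 _ (leq_maxr N0 N1); have := H _ (leq_maxl N0 N1) => h1 h2.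
rewrite (_ : l = u (maxn N0 N1) - (u (maxn N0 N1) - l)); last by ring.
by rewrite (le_trans (cnormB _ _))// lerD.
Qed.

Lemma cvgC_unique (u : nat -> C) l m : cvgC u l -> cvgC u m -> l = m.
Proof.
move=> ul um; apply/eqP; rewrite -subr_eq0 -cnorm_eq0 eq_le cnorm_ge0 andbT.
apply: (@cvgC_norm_le (fun N => u N + (-1) * u N)).
  by exists 0 => N _; rewrite mulN1r subrr cnorm0.
by have := cvgCD ul (cvgCZ (-1) um); rewrite mulN1r.
Qed.

Lemma cvgC0_geom w : cnorm w < 1 -> cvgC (fun N => w ^+ N) 0.
Proof.
move=> w1 e e0; have [w0|w0] := eqVneq (cnorm w) 0.
  by exists 1%N => -[//|N _]; rewrite subr0 exprS cnormM w0 mul0r ltW.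
have : (cnorm w) ^+ n @[n --> \oo] --> (0 : R) by apply: cvg_expr; rewrite ger0_norm ?cnorm_ge0.
move=> /cvgrPdist_le/(_ e e0)[N0 _ H]; exists N0 => N /H /=.
by rewrite sub0r normrN subr0 cnormX ger0_norm// exprn_ge0// cnorm_ge0.
Qed.

Definition cis (t : R) : C := cos t +i* sin t.

Lemma cisD s t : cis (s + t) = cis s * cis t.
Proof. by rewrite /cis cosD sinD; simpc; congr (_ +i* _); ring. Qed.

Lemma cis0 : cis 0 = 1.
Proof. by rewrite /cis cos0 sin0. Qed.

Lemma cisX t n : cis t ^+ n = cis (n%:R * t).
Proof.
elim: n => [|n ih]; first by rewrite mul0r cis0.
by rewrite exprS ih -cisD -natr1 mulrDl mul1r addrC.
Qed.

Lemma cnorm_cis t : cnorm (cis t) = 1.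
Proof. by rewrite /cnorm /= cos2Dsin2 sqrtr1. Qed.

Lemma cis_2pi : cis (2 * pi) = 1.
Proof. by rewrite mulr_natl /cis cos2pi sin2pi. Qed.

Lemma cis_neq1 t : 0 < t < 2 * pi -> cis t != 1.
Proof.
move=> /andP[t0 t2]; apply/eqP => -[ct st].
have [tp|tp|tp] := ltgtP t pi.
- by have := sin_gt0_pi (x := t); rewrite st ltxx t0 tp => /(_ isT).
- have := sin_gt0_pi (x := t - pi); rewrite subr_gt0 tp /=.
  rewrite (_ : sin (t - pi) = - sin t); last first.
    by rewrite -[in RHS](subrK pi t) sinDpi opprK.
  have tpi : t - pi < pi by lra.
  by rewrite tpi st oppr0 ltxx => /(_ isT).
- by move: ct; rewrite tp cospi; lra.
Qed.

Lemma has_rderiv_cis t : has_rderiv cis t ('i%C * cis t).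
Proof.
have := has_rderiv_pair (is_derive_cos t) (is_derive_sin t).
by rewrite (_ : - sin t +i* cos t = 'i%C * cis t)// /cis; simpc.
Qed.

Lemma cnorm_nat n : cnorm (n%:R : C) = n%:R.
Proof.
rewrite -(rmorph_nat (real_complex R)) [X in cnorm X](_ : _ = n%:R%:C) //.
by rewrite cnorm_real ger0_norm ?ler0n.
Qed.

Definition rt N k := cis (2 * pi * k%:R / N%:R).

(** For [N = 0] the value is 0; hence the condition [0 < N] in the lemmas below and in
    [cvgC_ext]. *)
Definition meanC N F : C := N%:R^-1 * \sum_(k < N) F (rt N k).

Lemma cnorm_rt N k : cnorm (rt N k) = 1. Proof. exact: cnorm_cis. Qed.

Lemma rtE N k : rt N k = rt N 1 ^+ k.
Proof. by rewrite /rt cisX; congr cis; ring. Qed.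

Lemma rtX N k : (0 < N)%N -> rt N k ^+ N = 1.
Proof.
move=> N0; rewrite rtE -exprM mulnC exprM /rt cisX mulr1 (_ : N%:R * _ = 2 * pi).
  by rewrite cis_2pi expr1n.
by field; rewrite pnatr_eq0 -lt0n.
Qed.

Lemma eq_meanC N F G : (forall u, cnorm u = 1 -> F u = G u) -> meanC N F = meanC N G.
Proof. by move=> FG; congr (_ * _); apply: eq_bigr => k _; rewrite FG ?cnorm_rt. Qed.

Lemma meanCD N F G : meanC N (fun u => F u + G u) = meanC N F + meanC N G.
Proof. by rewrite /meanC big_split mulrDr. Qed.

Lemma meanCZ N c F : meanC N (fun u => c * F u) = c * meanC N F.
Proof. by rewrite /meanC -mulr_sumr mulrCA. Qed.

Lemma meanC_cst N c : (0 < N)%N -> meanC N (fun=> c) = c.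
Proof.
move=> N0; rewrite /meanC sumr_const card_ord -[c *+ _]mulr_natl mulKf//.
by rewrite pnatr_eq0 -lt0n.
Qed.

Lemma meanC_norm N F (M : R) : (0 < N)%N ->
  (forall k, (k < N)%N -> cnorm (F (rt N k)) <= M) -> cnorm (meanC N F) <= M.
Proof.
move=> N0 le; rewrite /meanC cnormM cnormV cnorm_nat ler_pdivrMl ?ltr0n//.
rewrite (le_trans (cnorm_sum _ _ _))//.
rewrite (le_trans (ler_sum _ (fun (k : 'I_N) _ => le _ (ltn_ord k))))//.
by rewrite sumr_const card_ord mulr_natl.
Qed.

Lemma meanCX N j : (0 < j < N)%N -> meanC N (fun u => u ^+ j) = 0.
Proof.
move=> /andP[j0 jN]; have N0 : (0 < N)%N by apply: leq_ltn_trans jN.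
pose x := rt N 1 ^+ j.
have x1 : x - 1 != 0.
  rewrite subr_eq0 /x -rtE; apply: cis_neq1.
  have pi0 := pi_gt0 R; have n0 : 0 < N%:R :> R by rewrite ltr0n.
  by rewrite divr_gt0 ?mulr_gt0 ?ltr0n//= ltr_pdivrMr// ltr_pM2l ?mulr_gt0// ltr_nat.
rewrite /meanC; suff -> : \sum_(k < N) rt N k ^+ j = 0 :> C by rewrite mulr0.
apply: (mulfI x1); rewrite mulr0.
under eq_bigr do rewrite rtE -exprM mulnC exprM -/x.
by rewrite -subrX1 /x -exprM mulnC exprM rtX// expr1n subrr.
Qed.

(** On [u^N = 1] the quotient [(1 - w^N) / (1 - w u)] is the finite sum of the [w^j u^j] with
    [j < N], and only [j = 0] survives averaging. *)
Lemma mean_geometric N w : (0 < N)%N -> cnorm w < 1 ->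
  meanC N (fun u => (1 - w * u)^-1) = (1 - w ^+ N)^-1.
Proof.
move=> N0 w1.
have ne0 z : cnorm z < 1 -> 1 - z != 0.
  by move=> z1; rewrite subr_eq0; apply/eqP => zE; move: z1; rewrite -zE cnorm1 ltxx.
have wN : 1 - w ^+ N != 0 by apply: ne0; rewrite cnormX exprn_ilt1 ?cnorm_ge0// -lt0n.
apply: (mulfI wN); rewrite mulfV// -meanCZ.
rewrite /meanC (eq_bigr (fun k : 'I_N => \sum_(j < N) w ^+ j * rt N k ^+ j)); last first.
  move=> k _; have wk : 1 - w * rt N k != 0 by apply: ne0; rewrite cnormM cnorm_rt mulr1.
  apply: (mulIf wk); rewrite divfK//.
  under [in RHS]eq_bigr do rewrite -exprMn.
  have := subrX1 (w * rt N k) N; rewrite exprMn rtX// mulr1 => E.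
  by rewrite -[LHS]opprB E; ring.
rewrite exchange_big mulr_sumr; case: N N0 {wN} => // N _.
rewrite big_ord_recl [X in _ + X]big1 ?addr0 => [|j _].
  under eq_bigr do rewrite /= !expr0 mulr1.
  by rewrite sumr_const card_ord mulVf// pnatr_eq0.
rewrite -mulr_sumr mulrCA.
by rewrite -/(meanC N.+1 (fun u => u ^+ lift ord0 j)) meanCX ?mulr0// lift0 /= ltnS ltn_ord.
Qed.

(** In the bisection only [s] is confined to the subinterval while [t] ranges over all of [[a, b]];
    this is what lets two halves be glued by taking the smaller [del]. *)
Lemma uniform_continuity_curve (g : R -> C) (a b : R) : a <= b ->
  (forall t, a <= t <= b -> null (fun h => g (t + complex.Re h) - g t)) ->
  forall e, 0 < e -> exists2 del, 0 < del & forall s t, a <= s <= b -> a <= t <= b ->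
    `|s - t| < del -> cnorm (g s - g t) <= e.
Proof.
move=> ab cg e e0.
suff [del del0 H] : exists2 del, 0 < del & forall s t, a <= s <= b -> a <= t <= b ->
    `|s - t| < del -> cnorm (g s - g t) <= e by exists del.
apply: (@quarter_bisection R (fun a1 b1 _ _ => exists2 del, 0 < del &
  forall s t, a1 <= s <= b1 -> a <= t <= b -> `|s - t| < del -> cnorm (g s - g t) <= e)
  a b 0 0) => //.
  move=> a1 b1 _ _ _ _ _ _ _ _ m _ [d1 d10 H1] [d2 d20 H2] _ _.
  exists (Num.min d1 d2) => [|s t /andP[s1 s2] tab]; first by rewrite lt_min d10.
  rewrite lt_min => /andP[st1 st2]; have [sm|/ltW sm] := leP s m.
    by apply: H1 => //; rewrite s1.
  by apply: H2 => //; rewrite sm.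
move=> x y xab _; have [del del0 H] := cg _ xab _ (divr_gt0 e0 (ltr0Sn _ 1)).
exists (del / 2) => [|a1 b1 c d _ _ _ _ /andP[ax xb] /andP[c0 d0] small]; first by rewrite divr_gt0.
exists (del / 2) => [|s t /andP[s1 s2] tab st]; first by rewrite divr_gt0.
have near y1 : `|y1 - x| < del -> cnorm (g y1 - g x) <= e / 2.
  by move=> yx; have := H (y1 - x)%:C; rewrite cnorm_real /= subrKC; exact.
have sx : `|s - x| < del / 2 by rewrite ltr_norml; apply/andP; split; lra.
rewrite (_ : g s - g t = (g s - g x) - (g t - g x)); last by ring.
rewrite (le_trans (cnormB _ _))// (splitr e) lerD// near//.
  by apply: (lt_trans sx); lra.
rewrite (_ : t - x = (s - x) - (s - t)); last by ring.
by rewrite (le_lt_trans (ler_normB _ _))// (splitr del) ltrD.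
Qed.

Definition circle_cont F :=
  forall t : R, null (fun h => F (cis (t + complex.Re h)) - F (cis t)).

Lemma circle_cont_deriv F : (forall u, cnorm u = 1 -> exists d, has_cderiv F u d) ->
  circle_cont F.
Proof.
move=> dF t; have [d dFt] := dF _ (cnorm_cis t).
exact: has_rderiv_cont (has_rderiv_comp (has_rderiv_cis t) dFt).
Qed.

Lemma riemann_mean F (Phi : R -> C) : circle_cont F ->
  (forall t, 0 <= t <= 2 * pi -> has_rderiv Phi t (F (cis t))) ->
  cvgC (fun N => meanC N F) ((2 * pi)%:C^-1 * (Phi (2 * pi) - Phi 0)).
Proof.
move=> cF dPhi e e0; have pi0 := pi_gt0 R; set T := 2 * pi in dPhi *.
have T0 : 0 < T by rewrite mulr_gt0.
have [del del0 Hdel] := uniform_continuity_curve (ltW T0) (fun t _ => cF t) e0.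
have [N0 HN0] : exists N0 : nat, T / del < N0%:R.
  by exists (Num.bound (T / del)); apply: archi_boundP; rewrite divr_ge0// ltW.
exists N0.+1 => N NN0.
have N1 : 0 < N%:R :> R by rewrite ltr0n (leq_trans _ NN0).
pose h := T / N%:R; pose t k := T * k%:R / N%:R.
have h0 : 0 < h by rewrite divr_gt0.
have hdel : h < del.
  rewrite /h ltr_pdivrMr// mulrC -ltr_pdivrMr// (lt_le_trans HN0)// ler_nat.
  exact: ltnW.
have tS k : t k.+1 = t k + h by rewrite /t /h -natr1; field; exact: lt0r_neq0.
have tab k : (k < N)%N -> 0 <= t k /\ t k + h <= T.
  move=> kN; split; first by rewrite divr_ge0// ?mulr_ge0// ltW.
  by rewrite -tS /t ler_pdivrMr// ler_pM2l// ler_nat.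
have step k : (k < N)%N -> cnorm (Phi (t k.+1) - Phi (t k) - F (rt N k) * h%:C) <= e * h.
  move=> /tab[tk0 tk1]; rewrite tS -[in leRHS](gtr0_norm h0).
  have sh (s : R) : 0 <= s <= 1 -> 0 <= s * h <= h.
    by move=> /andP[s0 s1]; rewrite mulr_ge0 ?(ltW h0)//= ler_piMl// ltW.
  apply: (mean_value_shift (g' := fun t => F (cis t))) => s /sh/andP[s0 s1].
    by apply: dPhi; lra.
  have q1 : 0 <= t k + s * h <= T by lra.
  have q2 : 0 <= t k <= T by lra.
  by apply: Hdel => //; rewrite addrC addKr ger0_norm//; exact: le_lt_trans hdel.
have tel : Phi T - Phi 0 = \sum_(k < N) (Phi (t k.+1) - Phi (t k)).
  rewrite -(big_mkord xpredT (fun k => Phi (t k.+1) - Phi (t k))).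
  rewrite (telescope_sumr (fun k => Phi (t k)))// /t mulr0 mul0r mulfK//.
  exact: lt0r_neq0.
have NC : (N%:R : C) = N%:R%:C by rewrite rmorph_nat.
have TC0 : T%:C != 0 :> C by rewrite -cnorm_gt0 cnorm_real gtr0_norm.
have NC0 : (N%:R : C) != 0 by rewrite pnatr_eq0 -lt0n -(ltr0n R).
rewrite (_ : _ - _ = - T%:C^-1 * \sum_(k < N) (Phi (t k.+1) - Phi (t k) - F (rt N k) * h%:C)).
  rewrite cnormM cnormN cnormV cnorm_real gtr0_norm// ler_pdivrMl//.
  rewrite (le_trans (cnorm_sum _ _ _))// (le_trans (ler_sum _ (fun (k : 'I_N) _ => step k (ltn_ord k))))//.
  by rewrite sumr_const card_ord -mulr_natl /h le_eqVlt; apply/orP; left; apply/eqP; field; exact: lt0r_neq0.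
rewrite sumrB -tel -mulr_suml /meanC /h real_complexM.
have -> : (N%:R^-1 : R)%:C = N%:R^-1 :> C by rewrite fmorphV rmorph_nat.
by field; rewrite NC0.
Qed.

Lemma circle_cont_mean_cvg F : circle_cont F -> exists l, cvgC (fun N => meanC N F) l.
Proof.
move=> cF; have [|Phi HPhi] := @curve_primitive R (fun t => F (cis t)) 0 (2 * pi).
  by move=> t _; exact: cF.
by eexists; exact: riemann_mean cF HPhi.
Qed.

Lemma circle_cont_bounded F : circle_cont F ->
  exists M, forall N k, (k < N)%N -> cnorm (F (rt N k)) <= M.
Proof.
move=> cF; have T0 : (0 : R) <= 2 * pi by rewrite mulr_ge0 ?pi_ge0.
suff [M H] : exists M, forall t, 0 <= t <= 2 * pi -> cnorm (F (cis t)) <= M.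
  exists M => N k kN; apply: H; have n0 : 0 < N%:R :> R by rewrite ltr0n (leq_ltn_trans _ kN).
  rewrite divr_ge0 ?mulr_ge0 ?pi_ge0 ?(ltW n0)//= ler_pdivrMr// ler_wpM2l// ler_nat.
  exact: ltnW.
apply: (@quarter_bisection R (fun a1 b1 _ _ => exists M,
  forall t, a1 <= t <= b1 -> cnorm (F (cis t)) <= M) 0 (2 * pi) 0 0) => //.
  move=> a1 b1 _ _ _ _ _ _ _ _ m _ [M1 H1] [M2 H2] _ _; exists (Num.max M1 M2) => t /andP[t1 t2].
  rewrite le_max; have [tm|/ltW tm] := leP t m; first by rewrite H1// t1.
  by rewrite orbC H2// tm.
move=> x y _ _; have [del del0 H] := cF x _ ltr01.
exists del => // a1 b1 c d _ _ _ _ /andP[ax xb] /andP[c0 d0] small.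
exists (cnorm (F (cis x)) + 1) => t /andP[t1 t2].
have tx : `|t - x| < del by rewrite ltr_norml; apply/andP; split; lra.
have := H (t - x)%:C; rewrite cnorm_real /= subrKC => /(_ tx) h1.
rewrite -[F (cis t)](subrK (F (cis x))) addrC (le_trans (cnormD _ _))//.
by rewrite lerD.
Qed.

End CircleMeans.

(** * Cauchy's formula and holomorphy of the derivative *)

Section CauchyFormula.
Variable R : realType.
Local Notation C := (complex R).
Implicit Types (z w : C) (f F G K : C -> C) (r rho : R).

Lemma hol_deriv_fun r f : hol r f ->
  exists f' : C -> C, forall z, cnorm z < r -> has_cderiv f z (f' z).
Proof.
move=> hf; have /choice[f' f'P] : forall z, exists d, cnorm z < r -> has_cderiv f z d.
  move=> z; have [zr|zr] := pselect (cnorm z < r); last by exists 0.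
  by have [d] := hf _ zr; exists d.
by exists f'.
Qed.

Lemma has_cderiv_scale f (b : C) z d : has_cderiv f (b * z) d ->
  has_cderiv (fun z => f (b * z)) z (d * b).
Proof.
move=> H; have := @has_cderiv_affine R f 0 b z d; rewrite add0r => /(_ H).
by apply: has_cderiv_ext => x; rewrite add0r.
Qed.

Lemma geometric_neq0 w : cnorm w < 1 -> 1 - w != 0.
Proof.
by move=> w1; rewrite subr_eq0; apply/eqP => wE; move: w1; rewrite -wE cnorm1 ltxx.
Qed.

Lemma cvgC_geometricV w : cnorm w < 1 -> cvgC (fun N => (1 - w ^+ N)^-1) 1.
Proof.
move=> w1 e e0; have e20 : 0 < Num.min (1 / 2) (e / 2) by rewrite lt_min !divr_gt0.
have [N0 H] := cvgC0_geom w1 e20; exists N0 => N /H; rewrite subr0 le_min => /andP[h1 h2].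
have w2 : cnorm (w ^+ N) < 1 by lra.
have x0 := geometric_neq0 w2.
rewrite (_ : _ - 1 = w ^+ N / (1 - w ^+ N)); last by field.
have := cnormB_ge 1 (w ^+ N); rewrite cnorm1 => h3.
rewrite cnormM cnormV ler_pdivrMr ?cnorm_gt0//; nra.
Qed.

Lemma unit_circle_inv (u : C) : cnorm u = 1 -> u^-1 = u^*.
Proof.
move=> u1; have u0 : u != 0 by rewrite -cnorm_gt0 u1.
by apply: (mulfI u0); rewrite mulfV// mulcJ u1 expr1n.
Qed.

Lemma mean_geometricV N w : (0 < N)%N -> cnorm w < 1 ->
  meanC N (fun u => (1 - w * u^-1)^-1) = (1 - w ^+ N)^-1.
Proof.
move=> N0 w1; have := mean_geometric (w := w^*) N0; rewrite cnormJ => /(_ w1).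
move=> /(congr1 (fun z : C => z^*)); rewrite fmorphV rmorphB rmorph1 rmorphXn /= conjCK => <-.
rewrite /meanC rmorphM fmorphV rmorph_nat rmorph_sum; congr (_ * _).
apply: eq_bigr => k _; rewrite (unit_circle_inv (cnorm_rt R N k)).
by rewrite [RHS]fmorphV [in RHS]rmorphB rmorph1 [in RHS]rmorphM /= conjCK.
Qed.

(** This plays the part of the winding number. The integrand is [1 / (1 - (w / rho) u^-1)], whose
    mean is exactly [1 / (1 - (w / rho)^N)]. *)
Lemma cvgC_mean_pole rho w : 0 < rho -> cnorm w < rho ->
  cvgC (fun N => meanC N (fun u => rho%:C * u / (rho%:C * u - w))) 1.
Proof.
move=> r0 wr; have rC0 : rho%:C != 0 :> C by rewrite -cnorm_gt0 cnorm_real gtr0_norm.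
have wr1 : cnorm (w / rho%:C) < 1.
  by rewrite cnormM cnormV cnorm_real gtr0_norm// ltr_pdivrMr// mul1r.
apply: cvgC_ext (cvgC_geometricV wr1) => N N0; rewrite -mean_geometricV//.
apply: eq_meanC => u u1; have u0 : u != 0 by rewrite -cnorm_gt0 u1.
have h : rho%:C * u - w != 0.
  rewrite subr_eq0; apply/eqP => E; move: wr.
  by rewrite -E cnormM u1 mulr1 cnorm_real gtr0_norm// ltxx.
have h' : 1 - w / rho%:C / u != 0.
  by apply: geometric_neq0; rewrite cnormM cnormV u1 invr1 mulr1.
by field; rewrite h u0 rC0.
Qed.

(** The difference quotient [q] of [G] at [w] is holomorphic, so it has a primitive [Q]; the mean of
    [i z q(z)] tends to the increment of [Q] around the circle, which is 0. Since
    [z q(z) = (G z - G w) z / (z - w)], what remains is [G w] times the mean of the pole. *)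
Lemma cauchy_mean2 G f r rho w : 0 < rho -> rho < r -> cnorm w < rho ->
  (forall z, cnorm z < r -> has_cderiv G z (f z)) -> hol r f ->
  cvgC (fun N => meanC N (fun u => G (rho%:C * u) * (rho%:C * u / (rho%:C * u - w)))) (G w).
Proof.
move=> rho0 rhor wrho dG hf; have wr := lt_trans wrho rhor.
have hq := hol_dquot dG wr (hf _ wr); set q := dquot G w (f w) in hq.
have [Q HQ] := disc_primitive hq (midf_lt rhor).2.
have rhou u : cnorm u = 1 -> cnorm (rho%:C * u) = rho.
  by move=> u1; rewrite cnormM u1 mulr1 cnorm_real gtr0_norm.
pose F u := 'i%C * (rho%:C * u * q (rho%:C * u)).
have cF : circle_cont F.
  apply: circle_cont_deriv => u u1; have [|d Hd] := hq (rho%:C * u); first by rewrite rhou.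
  eexists; apply: has_cderivZ; apply: has_cderivM; last exact: has_cderiv_scale Hd.
  exact: has_cderivZ (has_cderiv_id _).
have := riemann_mean cF (Phi := fun t => Q (rho%:C * cis t)).
have -> : cis (2 * pi) = 1 :> C by exact: cis_2pi.
rewrite cis0 subrr mulr0 => lim0.
have {}lim0 : cvgC (fun N => meanC N F) 0.
  apply: lim0 => t _; have := HQ (rho%:C * cis t).
  rewrite rhou ?cnorm_cis// => /(_ (midf_lt rhor).1)/has_cderiv_scale.
  move=> /(has_rderiv_comp (has_rderiv_cis t)).
  by rewrite [X in has_rderiv _ _ X -> _](_ : _ = F (cis t))// /F; ring.
have := cvgCD (cvgCZ (- 'i%C) lim0) (cvgCZ (G w) (cvgC_mean_pole rho0 wrho)).
rewrite mulr0 add0r mulr1; apply: cvgC_ext => N N0.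
rewrite -!meanCZ -meanCD; apply: eq_meanC => u u1.
have h : rho%:C * u != w.
  by apply/eqP => E; move: wrho; rewrite -E rhou// ltxx.
rewrite /F /q /dquot (negbTE h).
have h' : rho%:C * u - w != 0 by rewrite subr_eq0.
rewrite mulrA mulNr -expr2 sqr_i opprK mul1r; by field.
Qed.

Lemma circle_contM F G : circle_cont F -> circle_cont G ->
  circle_cont (fun u => F u * G u).
Proof.
move=> cF cG t; have nF := cF t; have nG := cG t.
have bG : locbnd (fun h => G (cis t) + (G (cis (t + complex.Re h)) - G (cis t))).
  by apply: locbndD; [exact: locbnd_cst|exact: null_locbnd].
apply: null_eq (nullD (nullM bG nF) (nullZ (F (cis t)) nG)) => h; ring.
Qed.

(** Meant for [a = 1/(z - w - h)] and [b = 1/(z - w)], which satisfy [a - b = h a b]. The bound is a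
    second-order remainder for the [j]-th power, uniform in [z] as long as both poles are at
    distance at least [1/M]. *)
Lemma pole_expansion_bound j (M : R) : 0 <= M -> exists B, 0 <= B /\
  forall a b h : C, cnorm a <= M -> cnorm b <= M -> a - b = h * a * b ->
   cnorm (a ^+ j - b ^+ j - j%:R * h * b ^+ j.+1) <= B * cnorm h ^+ 2.
Proof.
move=> M0; elim: j => [|j [B [B0 ih]]].
  exists 0; split=> // a b h _ _ _.
  by rewrite !expr0 subrr mulr0n !mul0r subr0 cnorm0.
exists (M * B + j.+1%:R * M * M ^+ j.+2); split=> [|a b h aM bM ab].
  apply: addr_ge0; first exact: mulr_ge0.
  by apply: mulr_ge0; [exact: mulr_ge0|exact: exprn_ge0].
rewrite (_ : _ - _ = a * (a ^+ j - b ^+ j - j%:R * h * b ^+ j.+1) +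
   j.+1%:R * a * b ^+ j.+2 * h ^+ 2); last first.
  have ab' : a = b + h * a * b by rewrite -ab; ring.
  rewrite -natr1 !exprS; set X := a ^+ j; set Y := b ^+ j.
  apply/eqP; rewrite -subr_eq0; apply/eqP.
  rewrite [LHS](_ : _ = Y * (1 + (j%:R + 1) * h * b) * (a - b - h * a * b)); last by ring.
  by rewrite ab subrr mulr0.
rewrite (le_trans (cnormD _ _))// mulrDl lerD//.
  by rewrite cnormM -[leRHS]mulrA ler_pM ?cnorm_ge0// ih.
rewrite 3!cnormM 2!cnormX cnorm_nat ler_wpM2r ?exprn_ge0 ?cnorm_ge0//.
apply: ler_pM; [exact/mulr_ge0/cnorm_ge0|exact/exprn_ge0/cnorm_ge0| |].
  by rewrite ler_wpM2l.
by apply: lerXn2r; rewrite ?nnegrE ?cnorm_ge0.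
Qed.

(** Differentiation under the limit: the quadratic remainder of the kernel is uniform in [u] and in
    [N], so it survives the passage to the limit. *)
Lemma cauchy_kernel_deriv K rho : 0 < rho -> circle_cont K ->
  exists L : nat -> C -> C, forall j w, cnorm w < rho ->
   cvgC (fun N => meanC N (fun u => K u * (rho%:C * u - w) ^- j)) (L j w) /\
   has_cderiv (L j) w (j%:R * L j.+1 w).
Proof.
move=> rho0 cK.
have rhou u : cnorm u = 1 -> cnorm (rho%:C * u) = rho.
  by move=> u1; rewrite cnormM u1 mulr1 cnorm_real gtr0_norm.
have ne0 u w : cnorm u = 1 -> cnorm w < rho -> rho%:C * u - w != 0.
  by move=> u1 wr; rewrite subr_eq0; apply/eqP => E; move: wr; rewrite -E rhou// ltxx.
have /choice[L0 HL0] : forall p : nat * C, exists l, cnorm p.2 < rho ->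
    cvgC (fun N => meanC N (fun u => K u * (rho%:C * u - p.2) ^- p.1)) l.
  move=> [j w] /=; have [wr|wr] := pselect (cnorm w < rho); last by exists 0.
  have [|l Hl] := @circle_cont_mean_cvg R (fun u => K u * (rho%:C * u - w) ^- j).
    apply: circle_contM => //; apply: circle_cont_deriv => u u1.
    have h0 : has_cderiv (fun u => rho%:C * u - w) u (rho%:C * 1 - 0).
      by apply: has_cderivB (has_cderiv_cst _ _); exact: has_cderivZ (has_cderiv_id _).
    have := has_cderiv_comp h0 (has_cderivXn _ j);
    by move=> h1; eexists; apply: (has_cderiv_comp h1 (has_cderivV _)); rewrite expf_neq0// ne0.
  by exists l.
pose L j w := L0 (j, w); have HL j w : cnorm w < rho ->
    cvgC (fun N => meanC N (fun u => K u * (rho%:C * u - w) ^- j)) (L j w) by exact: HL0 (j, w).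
exists L => j w wr; split; first exact: HL.
have [MK HMK] := circle_cont_bounded cK.
(* For [|h| < d] both [w] and [w + h] stay at distance at least [d] from the circle. *)
pose d := (rho - cnorm w) / 2; have d0 : 0 < d by rewrite divr_gt0// subr_gt0.
have dV0 : 0 <= d^-1 by rewrite invr_ge0 ltW.
have [B [B0 HB]] := pole_expansion_bound j dV0.
pose M := (`|MK| + 1) * (B + 1).
have M0 : 0 < M by rewrite mulr_gt0// ltr_wpDl.
have bnd h : cnorm h < d -> cnorm (L j (w + h) - L j w - j%:R * L j.+1 w * h) <= M * cnorm h ^+ 2.
  move=> hd; have whr : cnorm (w + h) < rho.
    by apply: (le_lt_trans (cnormD _ _)); rewrite /d in hd; lra.
  have lim := cvgCD (cvgCD (HL j _ whr) (cvgCZ (-1) (HL j _ wr))) (cvgCZ (- j%:R * h) (HL j.+1 _ wr)).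
  have {lim} : cvgC (fun N => meanC N (fun u => K u * ((rho%:C * u - (w + h))^-1 ^+ j - (rho%:C * u - w)^-1 ^+ j
       - j%:R * h * (rho%:C * u - w)^-1 ^+ j.+1))) (L j (w + h) - L j w - j%:R * L j.+1 w * h).
    rewrite (_ : L j (w + h) - _ - _ = (L j (w + h) + -1 * L j w) + - j%:R * h * L j.+1 w); last by ring.
    apply: cvgC_ext lim => N _; rewrite -!meanCZ -!meanCD; apply: eq_meanC => u u1.
    by rewrite !exprVn; ring.
  apply: cvgC_norm_le; exists 1%N => N N1; apply: meanC_norm => // k kN.
  have u1 := cnorm_rt R N k; set u := rt R N k in u1 *.
  have u_w z : cnorm z <= rho - d -> cnorm (rho%:C * u - z)^-1 <= d^-1.
    move=> zr; have := cnormB_ge (rho%:C * u) z; rewrite rhou// => h1.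
    have h2 : d <= cnorm (rho%:C * u - z) by lra.
    by rewrite cnormV lef_pV2 ?posrE// (lt_le_trans d0).
  rewrite cnormM /M -[leRHS]mulrA ler_pM ?cnorm_ge0//.
    by rewrite (le_trans (HMK _ _ kN))// (le_trans (ler_norm _))// lerDl.
  apply: (le_trans (HB _ _ _ _ _ _)).
  - by apply: u_w; apply: (le_trans (cnormD _ _)); rewrite /d in hd *; lra.
  - by apply: u_w; rewrite /d; lra.
  - have n1 := ne0 _ _ u1 whr; have n2 := ne0 _ _ u1 wr.
    by field; rewrite n1 n2.
  - by rewrite ler_wpM2r ?exprn_ge0 ?cnorm_ge0// lerDl.
move=> e e0; exists (Num.min d (e / M)) => [|h]; first by rewrite lt_min d0 divr_gt0.
rewrite lt_min => /and3P[h0 hd he]; apply: (le_trans (bnd _ hd)).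
by rewrite expr2 mulrA ler_wpM2r ?(ltW h0)// mulrC -ler_pdivlMr// ltW.
Qed.

(** Cauchy's formula holds for a primitive [G] of [f], that is, [L 1 = G]. Differentiating the
    kernel gives [L 2 = f] and [2 * L 3 = f'], and [L 3] is again differentiable. *)
Lemma hol_deriv f f' r : (forall z, cnorm z < r -> has_cderiv f z (f' z)) -> hol r f'.
Proof.
move=> df w wr.
have hf : hol r f by move=> z zr; exists (f' z); exact: df.
pose rho := (cnorm w + r) / 2; have [wrho rhor] := midf_lt wr; rewrite -/rho in wrho rhor.
have rho0 : 0 < rho := le_lt_trans (cnorm_ge0 w) wrho.
pose r' := (rho + r) / 2; have [rhor' r'r] := midf_lt rhor; rewrite -/r' in rhor' r'r.
have [G HG] := disc_primitive hf r'r.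
have hfr' : hol r' f by move=> z /lt_trans/(_ r'r)/hf.
have cauchy z zr := cauchy_mean2 rho0 rhor' zr HG hfr' (w := z).
have [|L HL] := @cauchy_kernel_deriv (fun u => G (rho%:C * u) * (rho%:C * u)) rho rho0.
  apply: circle_cont_deriv => u u1; have h := HG (rho%:C * u).
  have {}h := has_cderiv_scale (h _); eexists; apply: has_cderivM; last first.
    exact: has_cderivZ (has_cderiv_id _).
  by apply: h; rewrite cnormM u1 mulr1 cnorm_real gtr0_norm.
have near (A B : C -> C) : (forall z, cnorm z < rho -> A z = B z) ->
    forall z, cnorm z < rho -> forall d, has_cderiv A z d -> has_cderiv B z d.
  move=> AB z zr d; apply: (has_cderiv_near (r := rho - cnorm z)); first by rewrite subr_gt0.
  by move=> h hr; apply: AB; apply: (le_lt_trans (cnormD _ _)); rewrite -ltrBrDl.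
have L1 z : cnorm z < rho -> L 1%N z = G z.
  move=> zr; apply: cvgC_unique (HL 1%N z zr).1 _.
  by apply: cvgC_ext (cauchy z zr) => N _; apply: eq_meanC => u _; rewrite expr1 mulrA.
have L2 z : cnorm z < rho -> L 2%N z = f z.
  move=> zr; apply: has_cderiv_unique (near _ _ L1 _ zr _ _) (HG z (lt_trans zr rhor')).
  by have := (HL 1%N z zr).2; rewrite mul1r.
have L3 z : cnorm z < rho -> 2 * L 3%N z = f' z.
  move=> zr; apply: has_cderiv_unique (df z (lt_trans zr rhor)).
  by apply: near L2 _ zr _ (HL 2%N z zr).2.
exists (2 * (3%:R * L 4%N w)); apply: (near _ _ L3 _ wrho).
exact/has_cderivZ/(HL 3%N w wrho).2.
Qed.

Lemma cauchy_mean f r rho w : 0 < rho -> rho < r -> cnorm w < rho -> hol r f ->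
  cvgC (fun N => meanC N (fun u => f (rho%:C * u) * (rho%:C * u / (rho%:C * u - w)))) (f w).
Proof.
move=> rho0 rhor wrho hf; have [f' df] := hol_deriv_fun hf.
exact: cauchy_mean2 rho0 rhor wrho df (hol_deriv df).
Qed.

Lemma mean_value f r rho : 0 < rho -> rho < r -> hol r f ->
  cvgC (fun N => meanC N (fun u => f (rho%:C * u))) (f 0).
Proof.
move=> rho0 rhor hf; have := cauchy_mean rho0 rhor (_ : cnorm 0 < rho) hf.
rewrite cnorm0 => /(_ rho0); apply: cvgC_ext => N _; apply: eq_meanC => u u1.
rewrite subr0 divff ?mulr1// mulf_neq0// -cnorm_gt0 ?u1//.
by rewrite cnorm_real normr_gt0 lt0r_neq0.
Qed.

End CauchyFormula.

(** * Poisson kernel and Cauchy estimates *)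

Section Poisson.
Variable R : realType.
Local Notation C := (complex R).
Implicit Types (z w x : C) (f F G : C -> C) (r rho s : R).

Definition poisson x : R := (1 - cnorm x ^+ 2) / cnorm (1 - x) ^+ 2.

Lemma poisson_ge0 x : cnorm x < 1 -> 0 <= poisson x.
Proof.
by move=> x1; rewrite divr_ge0 ?sqr_ge0// subr_ge0 expr_le1 ?cnorm_ge0// ltW.
Qed.

Lemma poissonE x : cnorm x < 1 ->
  (poisson x)%:C = (1 - x)^-1 + ((1 - x)^-1)^* - 1 :> C.
Proof.
move=> x1; have n0 := geometric_neq0 x1.
have n0' : (1 - x)^* != 0 by rewrite conjC_eq0.
have -> : (poisson x)%:C = (1 - x * x^*) / ((1 - x) * (1 - x)^*) :> C.
  by rewrite /poisson !mulcJ real_complexM fmorphV rmorphB.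
rewrite fmorphV; apply: (mulIf (mulf_neq0 n0 n0')).
rewrite divfK ?mulf_neq0// mulrBl mulrDl mul1r mulrA mulVf// mul1r mulrCA mulVf// mulr1.
by rewrite rmorphB rmorph1; ring.
Qed.

Lemma mean_poisson N w : (0 < N)%N -> cnorm w < 1 ->
  N%:R^-1 * \sum_(k < N) poisson (w * rt R N k) = poisson (w ^+ N).
Proof.
move=> N0 w1; apply: (@complexI R).
have wN : cnorm (w ^+ N) < 1 by rewrite cnormX exprn_ilt1 ?cnorm_ge0// -lt0n.
rewrite real_complexM fmorphV rmorph_nat rmorph_sum.
transitivity (meanC N (fun u => (1 - w * u)^-1) + (meanC N (fun u => (1 - w * u)^-1))^* +
  meanC N (fun=> -1)).
  rewrite {2}/meanC rmorphM fmorphV rmorph_nat rmorph_sum -!mulrDr -!big_split; congr (_ * _).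
  by apply: eq_bigr => k _; rewrite /= poissonE// cnormM cnorm_rt mulr1.
by rewrite mean_geometric// meanC_cst// poissonE.
Qed.

Lemma hol_shift r r' f a (b : C) : hol r f -> cnorm a + cnorm b * r' <= r -> b != 0 ->
  hol r' (fun z => f (a + b * z)).
Proof.
move=> hf ab b0 z zr; have [|d Hd] := hf (a + b * z).
  apply: (le_lt_trans (cnormD _ _)); apply: lt_le_trans ab.
  by rewrite ltrD2l cnormM ltr_pM2l// cnorm_gt0.
by exists (d * b); exact: has_cderiv_affine.
Qed.

(** On the unit circle [P(s u) = u / (u - s) + (1 / (1 - s u) - 1)]. The first part is the Cauchy
    kernel; the second, times [f], is holomorphic beyond the circle and vanishes at 0, so its means
    tend to 0. *)
Lemma poisson_mean1 r f s : hol r f -> 1 < r -> 0 <= s < 1 ->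
  cvgC (fun N => meanC N (fun u => f u * (poisson (s%:C * u))%:C)) (f s%:C).
Proof.
move=> hf r1 /andP[s0 s1].
have sn : cnorm (s%:C : C) = s by rewrite cnorm_real ger0_norm.
(* Since [s < 1], the radius [2 / (1 + s)] exceeds 1 and, for [s > 0], stays below the pole
   [1 / s]. *)
pose r0 := Num.min r (2 / (1 + s)).
have s10 : 0 < 1 + s by rewrite ltr_pwDl.
have r01 : 1 < r0 by rewrite lt_min r1 ltr_pdivlMr//; lra.
have r0r : r0 <= r by rewrite ge_min lexx.
have hg : hol r0 (fun z => f z * ((1 - s%:C * z)^-1 - 1)).
  move=> z zr; have [d Hd] := hf _ (lt_le_trans zr r0r).
  have n0 : 1 - s%:C * z != 0.
    apply: geometric_neq0; rewrite cnormM sn.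
    have zr2 : cnorm z * (1 + s) < 2.
      by rewrite -ltr_pdivlMr// (lt_le_trans zr)// ge_min lexx orbT.
    have := cnorm_ge0 z; nra.
  have h1 : has_cderiv (fun z => 1 - s%:C * z) z (0 - s%:C * 1).
    by apply: has_cderivB (has_cderiv_cst _ _) _; exact: has_cderivZ (has_cderiv_id _).
  eexists; apply: has_cderivM Hd _; apply: has_cderivB (has_cderiv_cst _ _).
  exact: has_cderiv_comp h1 (has_cderivV n0).
have C1 z : (1 : R)%:C * z = z by rewrite [(1 : R)%:C](_ : _ = 1)// mul1r.
have l1 := mean_value ltr01 r01 hg.
have l2 := cauchy_mean ltr01 r1 (_ : cnorm s%:C < 1) hf.
rewrite sn in l2; have {l2} l2 := l2 s1.
have := cvgCD l2 l1; rewrite mulr0 subr0 invr1 subrr mulr0 addr0.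
apply: cvgC_ext => N N0; rewrite -meanCD; apply: eq_meanC => u u1; rewrite !C1.
have u0 : u != 0 by rewrite -cnorm_gt0 u1.
rewrite poissonE; last by rewrite cnormM sn u1 mulr1.
rewrite -mulrDr; congr (_ * _); rewrite fmorphV rmorphB rmorph1 rmorphM /=.
rewrite -[in RHS](unit_circle_inv u1).
have -> : (s%:C : C)^* = s%:C by apply/CrealP; rewrite complex_real.
have n1 : u - s%:C != 0.
  by rewrite subr_eq0; apply/eqP => E; move: s1; rewrite -sn -E u1 ltxx.
have n2 : 1 - s%:C * u != 0 by apply: geometric_neq0; rewrite cnormM sn u1 mulr1.
by field; rewrite n1 n2 u0.
Qed.

Lemma poisson_mean r f z s : hol r f -> cnorm z < r -> 0 <= s < 1 ->
  cvgC (fun N => meanC N (fun u => f (z * u) * (poisson (s%:C * u))%:C)) (f (z * s%:C)).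
Proof.
move=> hf zr s01; have [r' r'1 zr'] : exists2 r' : R, 1 < r' & cnorm z * r' <= r.
  have [->|z0] := eqVneq z 0.
    by exists 2; [exact: ltr1n|rewrite cnorm0 mul0r; have := le_lt_trans (cnorm_ge0 z) zr; exact: ltW].
  exists (r / cnorm z); first by rewrite ltr_pdivlMr ?cnorm_gt0// mul1r.
  by rewrite mulrC divfK// gt_eqF// cnorm_gt0.
apply: (poisson_mean1 (f := fun u => f (z * u)) _ r'1 s01) => u ur.
have [z0|z0] := eqVneq z 0.
  exists 0; have := has_cderiv_cst (f 0) u; apply: has_cderiv_ext => v.
  by rewrite z0 mul0r.
have [|d Hd] := hf (z * u).
  by apply: lt_le_trans zr'; rewrite cnormM ltr_pM2l// cnorm_gt0.
by exists (d * z); exact: has_cderiv_scale.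
Qed.

(** The kernel is nonnegative, so taking norms under the mean keeps it as weight. This is the
    subharmonicity behind the monotonicity of circular means. *)
Lemma poisson_mean_norm r f z s e : hol r f -> cnorm z < r -> 0 <= s < 1 -> 0 < e ->
  exists N0, forall N, (N0 <= N)%N ->
    cnorm (f (z * s%:C)) <=
      N%:R^-1 * \sum_(k < N) poisson (s%:C * rt R N k) * cnorm (f (z * rt R N k)) + e.
Proof.
move=> hf zr s01 e0; have [N0 H] := poisson_mean hf zr s01 e0.
exists N0 => N /H; set m := meanC _ _ => h.
rewrite (_ : f (z * s%:C) = m - (m - f (z * s%:C))); last by ring.
rewrite (le_trans (cnormB _ _))// lerD// /m /meanC cnormM cnormV cnorm_nat.
rewrite ler_wpM2l ?invr_ge0// (le_trans (cnorm_sum _ _ _))// ler_sum// => k _.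
rewrite cnormM cnorm_real mulrC ger0_norm// poisson_ge0// cnormM cnorm_rt mulr1 cnorm_real.
by have /andP[s0 s1] := s01; rewrite ger0_norm.
Qed.

(** The difference quotient of [f] at [a] takes the value [f' a] at [a], so [f' a] is the limit of
    its means over circles around [a]. There it is at most [2 M] over the radius, because
    [|f z - f a| <= 2 M]. *)
Lemma cauchy_estimate f f' (M : R) a : (forall z, disc z -> has_cderiv f z (f' z)) ->
  (forall z, disc z -> cnorm (f z) <= M) -> disc a ->
  cnorm (f' a) * (1 - cnorm a) <= 2 * M.
Proof.
move=> df fM da; have a1 : 0 < 1 - cnorm a by rewrite subr_gt0.
have M0 : 0 <= M := le_trans (cnorm_ge0 _) (fM _ da).
apply/ler_addgt0Pr => e e0.
(* The radius must stay below [1 - |a|]; the shortfall is small enough to cost at most [e]. *)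
have [d [d0 da1 dle]] : exists d : R, [/\ 0 < d, d < 1 - cnorm a &
    cnorm (f' a) * (1 - cnorm a) <= cnorm (f' a) * d + e].
  pose t := Num.min ((1 - cnorm a) / 2) (e / (cnorm (f' a) + 1)).
  have c0 : 0 < cnorm (f' a) + 1 by rewrite ltr_wpDl// cnorm_ge0.
  have t0 : 0 < t by rewrite lt_min !divr_gt0.
  have t1 : t <= (1 - cnorm a) / 2 by rewrite ge_min lexx.
  have t2 : t * (cnorm (f' a) + 1) <= e by rewrite -ler_pdivlMr// ge_min lexx orbT.
  exists (1 - cnorm a - t); split; [lra|lra|].
  by nra.
rewrite (le_trans dle)// lerD2r.
have hf : hol 1 f by move=> z zr; exists (f' z); exact: df.
have hq := hol_dquot df da (hol_deriv df da).
have dn : cnorm (d%:C : C) = d by rewrite cnorm_real gtr0_norm.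
have dC0 : d%:C != 0 :> C by rewrite -cnorm_gt0 dn.
have hq1 := hol_shift (r' := (1 - cnorm a) / d) hq _ dC0.
have {hq1} hq1 := hq1 a; rewrite dn mulrC divfK ?gt_eqF// subrKC lexx in hq1.
have := hq1 isT => {}hq1.
have r1 : 1 < (1 - cnorm a) / d by rewrite ltr_pdivlMr// mul1r.
have := mean_value ltr01 r1 hq1; rewrite mulr0 addr0 {2}/dquot eqxx => lim.
rewrite -ler_pdivlMr//; apply: cvgC_norm_le lim; exists 1%N => N N0.
apply: meanC_norm => // k kN; have u1 := cnorm_rt R N k; set u := rt R N k in u1 *.
rewrite [(1 : R)%:C](_ : _ = 1)// mul1r /dquot.
have u0 : u != 0 by rewrite -cnorm_gt0 u1.
have -> : a + d%:C * u == a = false.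
  by apply/negbTE; rewrite -subr_eq0 addrC addKr mulf_neq0.
rewrite (_ : a + d%:C * u - a = d%:C * u); last by ring.
rewrite cnormM cnormV cnormM dn u1 mulr1 ler_wpM2r ?invr_ge0 ?(ltW d0)//.
rewrite (le_trans (cnormB _ _))// mulr_natl mulr2n lerD// fM//.
by rewrite /disc /= (le_lt_trans (cnormD _ _))// cnormM dn u1 mulr1 -ltrBrDl.
Qed.

(** A bound on one circle passes inside at the price of the maximum [rho / (rho - |w|)] of the
    Cauchy kernel. *)
Lemma circle_bound_inside f rho (M : R) w : hol 1 f -> rho < 1 -> cnorm w < rho ->
  (forall z, cnorm z = rho -> cnorm (f z) <= M) ->
  cnorm (f w) <= M * (rho / (rho - cnorm w)).
Proof.
move=> hf rho1 wrho fM; have rho0 : 0 < rho := le_lt_trans (cnorm_ge0 _) wrho.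
apply: cvgC_norm_le (cauchy_mean rho0 rho1 wrho hf); exists 1%N => N N0.
apply: meanC_norm => // k kN; have u1 := cnorm_rt R N k; set u := rt R N k in u1 *.
have zrho : cnorm (rho%:C * u) = rho by rewrite cnormM u1 mulr1 cnorm_real gtr0_norm.
rewrite cnormM [X in _ * X <= _]cnormM zrho; apply: ler_pM; rewrite ?mulr_ge0 ?cnorm_ge0 ?(ltW rho0)//; first exact: fM.
rewrite cnormV ler_wpM2l ?(ltW rho0)// lef_pV2 ?posrE ?subr_gt0//.
  by rewrite -{1}zrho cnormB_ge.
by rewrite (lt_le_trans _ (cnormB_ge _ _))// zrho subr_gt0.
Qed.

(** * The operator [Tg] as a primitive *)

Lemma integral_FTC (phi phi' : R -> R) (a b : R) : a <= b ->
  (forall t, a <= t <= b -> is_derive t 1 phi (phi' t)) ->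
  {within `[a, b], continuous phi'} ->
  (\int[lebesgue_measure]_(x in `[a, b]) (phi' x)%:E = (phi b - phi a)%:E)%E.
Proof.
rewrite le_eqVlt => /predU1P[->|ab] dphi cphi'.
  by rewrite set_itv1 integral_set1 subrr.
have cphi t : a <= t <= b -> {for t, continuous phi}.
  move=> /dphi[dt _]; apply: differentiable_continuous; exact/derivable1_diffP.
have ca : {for a, continuous phi} by apply: cphi; rewrite lexx (ltW ab).
have cb : {for b, continuous phi} by apply: cphi; rewrite lexx (ltW ab).
rewrite (@continuous_FTC2 R phi' phi a b ab cphi') ?EFinB//.
  split => [t||]; first by rewrite in_itv/= => /andP[/ltW at' /ltW tb]; have [] := dphi t; rewrite ?at' ?tb.
    by apply: cvg_at_right_filter; exact: ca.
  by apply: cvg_at_left_filter; exact: cb.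
by move=> t; rewrite in_itv/= => /andP[/ltW at' /ltW tb]; rewrite derive1E; have [] := dphi t; rewrite ?at' ?tb.
Qed.

Lemma curve_continuous (p : C -> R) (g : R -> C) a b :
  (forall z w, `|p z - p w| <= cnorm (z - w)) ->
  (forall t, a <= t <= b -> null (fun h => g (t + complex.Re h) - g t)) ->
  {in `[a, b], continuous (fun t => p (g t))}.
Proof.
move=> pn cg t; rewrite in_itv/= => /cg H; apply/cvgrPdist_le => e /H[del del0 {}H].
apply/nbhs_ballP; exists del => //= y; rewrite /ball /= => yd.
rewrite distrC (le_trans (pn _ _))// -(subrKC t y).
by have := H (y - t)%:C; rewrite cnorm_real distrC; exact.
Qed.

Lemma curve_within_continuous (p : C -> R) (g : R -> C) a b :
  (forall z w, `|p z - p w| <= cnorm (z - w)) ->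
  (forall t, a <= t <= b -> null (fun h => g (t + complex.Re h) - g t)) ->
  {within `[a, b], continuous (fun t => p (g t))}.
Proof.
move=> pn cg; apply: continuous_in_subspaceT => x xi.
by apply: (curve_continuous pn cg); exact: set_mem xi.
Qed.

(** The fundamental theorem of calculus along the segment from 0 to [v], applied to real and
    imaginary parts, identifies [Tg g f v] with [F v - F 0] for a primitive [F] of [f * g] on a disc
    containing [z]. *)
Lemma Tg_deriv (f g : C -> C) z : hol 1 f -> hol 1 g -> disc z ->
  has_cderiv (Tg g f) z (f z * g z).
Proof.
move=> hf hg dz.
have [zr' r'1] := midf_lt (dz : cnorm z < 1); set r' := (_ + _) / 2 in zr' r'1.
have hfg : hol 1 (fun z => f z * g z).
  move=> v v1; have [d Hd] := hf _ v1; have [d' Hd'] := hg _ v1.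
  by eexists; exact: has_cderivM Hd Hd'.
have [F HF] := disc_primitive hfg r'1.
have TE v : cnorm v < r' -> Tg g f v = F v - F 0.
  move=> vr; pose k (t : R) := f (t%:C * v) * g (t%:C * v) * v.
  have tv (t : R) : 0 <= t <= 1 -> cnorm (t%:C * v) < r'.
    move=> /andP[t0 t1]; rewrite cnormM cnorm_real ger0_norm//.
    by apply: le_lt_trans vr; rewrite ler_piMl ?cnorm_ge0.
  have dk t : 0 <= t <= 1 -> has_rderiv (fun t : R => F (t%:C * v)) t (k t).
    move=> /tv/HF; rewrite -[t%:C * v]add0r => /has_rderiv_line; rewrite add0r.
    by apply: has_rderiv_ext => y; rewrite add0r.
  have ck t : 0 <= t <= 1 -> null (fun h => k (t + complex.Re h) - k t).
    move=> /tv/lt_trans/(_ r'1)/hfg[d]; rewrite -[t%:C * v]add0r => /has_rderiv_line Hd.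
    have := has_rderiv_cont (has_rderivZ v Hd); apply: null_eq => h.
    by rewrite /k !add0r !(mulrC v).
  have ReB (x y : C) : `|complex.Re x - complex.Re y| <= cnorm (x - y).
    by rewrite -ReN -ReD cnorm_Re.
  have ImB (x y : C) : `|complex.Im x - complex.Im y| <= cnorm (x - y).
    by rewrite -ImN -ImD cnorm_Im.
  rewrite /Tg /Rintegral /= -/(k _).
  have e1 := integral_FTC ler01 (fun t h => has_rderiv_Re (dk t h))
    (curve_within_continuous ReB ck).
  have e2 := integral_FTC ler01 (fun t h => has_rderiv_Im (dk t h))
    (curve_within_continuous ImB ck).
  rewrite /k in e1 e2; rewrite e1 e2 /=.
  have -> : (1 : R)%:C * v = v by rewrite [(1 : R)%:C](_ : _ = 1)// mul1r.
  have -> : (0 : R)%:C * v = 0 by rewrite [(0 : R)%:C](_ : _ = 0)// mul0r.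
  by case: (F v) => ? ?; case: (F 0).
apply: (has_cderiv_near (r := r' - cnorm z) (f := fun v => F v - F 0)).
- by rewrite subr_gt0.
- by move=> h hr; rewrite TE// (le_lt_trans (cnormD _ _))// -ltrBrDl.
- rewrite -[X in has_cderiv _ _ X]subr0.
  by apply: has_cderivB (HF _ zr') _; exact: has_cderiv_cst.
Qed.

Lemma Tg0 (f g : C -> C) : Tg g f 0 = 0.
Proof.
have Z (p : C -> R) : p 0 = 0 -> (\int[lebesgue_measure]_(t in `[0%R, 1%R])
    (p (f (t%:C * 0) * g (t%:C * 0) * 0)%R)%:E = 0)%E.
  by move=> p0; apply: integral0_eq => t _; rewrite mulr0 p0.
by rewrite /Tg /Rintegral (Z (@complex.Re R))// (Z (@complex.Im R)).
Qed.

Lemma Tg_identity_bound (f f' : C -> C) z : analytic_disc f f' -> disc z ->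
  ((cnorm (Tg (fun=> 1) f z))%:E <= (cnorm (f 0))%:E +
    \int[lebesgue_measure]_(s in `[0%R, cnorm z])
      ((1 - s) * cnorm (f' (s%:C * (z / (cnorm z)%:C))))%:E)%E.
Proof.
move=> df dz; have hf : hol 1 f by move=> v v1; exists (f' v); exact: df.
have h1 : hol (1 : R) (fun=> 1) by move=> v v1; exists 0; exact: has_cderiv_cst.
have [z0|z0] := eqVneq z 0.
  rewrite z0 Tg0 cnorm0 adde_ge0 ?lee_fin ?cnorm_ge0// integral_ge0// => s.
  rewrite /= in_itv/= => /andP[s0 s1]; rewrite lee_fin mulr_ge0 ?cnorm_ge0// subr_ge0.
  by rewrite (le_trans s1).
set a := cnorm z; set e := z / _.
have a0 : 0 < a by rewrite cnorm_gt0.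
have a1 : a < 1 by exact: dz.
have aC0 : a%:C != 0 :> C by rewrite -cnorm_gt0 cnorm_real gtr0_norm.
have zE : z = a%:C * e by rewrite /e mulrC divfK.
have e1 : cnorm e = 1 by rewrite /e cnormM cnormV cnorm_real gtr0_norm// mulfV// gt_eqF.
clearbody e.
have se (s : R) : 0 <= s <= a -> disc (s%:C * e).
  by move=> /andP[s0 sa]; rewrite /disc /= cnormM e1 mulr1 cnorm_real ger0_norm// (le_lt_trans sa).
have line (k k' : C -> C) (s : R) : has_cderiv k (s%:C * e) (k' (s%:C * e)) ->
    has_rderiv (fun s : R => k (s%:C * e)) s (k' (s%:C * e) * e).
  rewrite -[s%:C * e]add0r => /has_rderiv_line.
  by apply: has_rderiv_ext => y; rewrite add0r.
pose k (s : R) := (1 - s) * cnorm (f' (s%:C * e)).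
have cf' s : 0 <= s <= a -> null (fun h => f' ((s + complex.Re h)%:C * e) - f' (s%:C * e)).
  move=> /se/(hol_deriv df)[d Hd]; exact: has_rderiv_cont (line f' (fun=> d) _ Hd).
have nB (x y : C) : `|cnorm x - cnorm y| <= cnorm (x - y).
  by rewrite ler_norml cnormB_ge lerNl opprB cnorm_distC cnormB_ge.
have ck : {in `[0, a], continuous k}.
  move=> s sa; have c1 := curve_continuous nB cf' sa.
  have c2 : {for s, continuous (fun s : R => 1 - s)}.
    by apply: cvgB; [exact: cvg_cst|exact: cvg_id].
  exact: (continuousM c2 c1).
have [B HB] := continuous_primitive ck.
rewrite (@integral_FTC B k 0 a (ltW a0) HB); last first.
  by apply: continuous_in_subspaceT => x xi; apply: ck; exact: set_mem.
rewrite -EFinD lee_fin.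
(* The boundary term of the integration by parts is built in: the derivative of [psi] is
   [(a - s) e^2 f'(s e)], [psi a] is the value sought, and [psi 0 = a e f(0)] has norm at most
   [|f(0)|]. *)
pose psi (s : R) := Tg (fun=> 1) f (s%:C * e) + (a%:C + s%:C * (-1)) * e * f (s%:C * e).
have dpsi s : 0 <= s <= a -> has_rderiv psi s ((a - s)%:C * e * f' (s%:C * e) * e).
  move=> /se sd; have H1 := line _ (fun v => f v * 1) _ (Tg_deriv hf h1 sd).
  have H2 := line _ f' _ (df _ sd).
  have [p np pE] := H1; have [q nq qE] := H2.
  exists (fun h => p h + (a - s)%:C * e * q h - e * ((f' (s%:C * e) * e + q h) * h)); last first.
    by move=> x; rewrite /psi pE qE rmorphB !real_complexD; ring.
  rewrite /=; apply: nullD; first by apply: nullD => //; exact: nullZ.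
  apply: (@null_eq R (fun h => (- e) * ((f' (s%:C * e) * e + q h) * h))); first by move=> h; ring.
  apply: nullZ; apply: nullM (@null_id R); apply: locbndD; [exact: locbnd_cst|exact: null_locbnd].
have := @mean_value_ineq R psi _ B k 0 a (ltW a0) dpsi HB.
have -> : psi a = Tg (fun=> 1) f z by rewrite /psi -zE; ring.
have -> : psi 0 = a%:C * e * f 0.
  by rewrite /psi [(0 : R)%:C](_ : _ = 0)// !mul0r Tg0; ring.
move=> le; rewrite -[Tg _ _ _](subrK (a%:C * e * f 0)) addrC.
rewrite (le_trans (cnormD _ _))// lerD//.
  by rewrite cnormM -zE ler_piMl ?cnorm_ge0// ltW.
apply: le => s /andP[s0 sa]; rewrite !cnormM e1 !mulr1 cnorm_real ger0_norm ?subr_ge0//.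
by rewrite ler_wpM2r ?cnorm_ge0// lerD2r ltW.
Qed.

End Poisson.

(** * Polar coordinates and circular means *)

Section LinearChange.
Variable R : realType.
Local Open Scope ereal_scope.
Local Notation mu := (@lebesgue_measure R).
Local Notation mu2 := (mu \x mu).
Implicit Types (a b c d s t x y : R) (F : R -> \bar R) (H : R * R -> \bar R).

Lemma measurable_affine a b : measurable_fun setT (fun x : R => (a * x + b)%R).
Proof. by apply: measurable_funD => //; exact: measurable_funM. Qed.

Let pullback a b (k : {nonneg R}) : {measure set (measurableTypeR R) -> \bar R} :=
  measure_function_mscale__canonical__measure_function_Measure k
    (@measure_function_pushforward__canonical__measure_function_Measure _ _ _ (measurableTypeR R) R
       mu _ (measurable_affine a b)).

(** Uniqueness of Lebesgue measure: the rescaled image measure agrees with it on half-open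
    intervals. For [a < 0] the preimage of such an interval is half-open on the other side. *)
Lemma lebesgue_measure_affine a b (A : set R) : a != 0%R -> measurable A ->
  mu A = `|a|%:E * mu ((fun x => a * x + b)%R @^-1` A).
Proof.
move=> a0 mA; have na0 : (0 <= `|a|)%R by [].
rewrite -[RHS]/(pullback a b (NngNum na0) A).
apply: lebesgue_measure_unique mA => _ [[u v] _ <-] /=.
rewrite /mscale /= /pushforward lebesgue_measure_itv /= lte_fin.
have [a1|a1|a1] := ltgtP a 0%R; last by rewrite a1 eqxx in a0.
  rewrite [X in mu X](_ : _ = `[(v - b) / a, (u - b) / a[%classic)%R; last first.
    apply/seteqP; split=> x /=; rewrite !in_itv/= ler_ndivrMr// ltr_ndivlMr//;
      rewrite lerBrDr ltrBlDr (mulrC x); by move=> /andP[-> ->].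
  rewrite lebesgue_measure_itv/= lte_fin ltr_ndivrMr// -mulrA mulVf// mulr1 ltrD2r.
  case: ltP => uv; last by rewrite mule0.
  by rewrite -!EFinB -EFinM ltr0_norm//; congr EFin; field.
rewrite [X in mu X](_ : _ = `](u - b) / a, (v - b) / a]%classic)%R; last first.
  apply/seteqP; split=> x /=; rewrite !in_itv/= ler_pdivlMr// ltr_pdivrMr//;
      rewrite lerBrDr ltrBlDr (mulrC x); by move=> /andP[-> ->].
rewrite lebesgue_measure_itv/= lte_fin ltr_pM2r ?invr_gt0// ltrD2r.
case: ltP => uv; last by rewrite mule0.
by rewrite -!EFinB -EFinM gtr0_norm//; congr EFin; field.
Qed.

Lemma integral_affine F a b : a != 0%R -> measurable_fun setT F -> (forall x, 0 <= F x) ->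
  \int[mu]_x F (a * x + b)%R = (`|a|^-1)%:E * \int[mu]_x F x.
Proof.
move=> a0 mF F0; have na0 : (0 <= `|a|)%R by [].
have aN0 : (`|a| != 0)%R by rewrite normr_eq0.
rewrite [X in _ = _ * X](eq_measure_integral (pullback a b (NngNum na0))).
  rewrite ge0_integral_mscale//= ge0_integral_pushforward//; last exact: measurable_affine.
  by rewrite muleA -EFinM mulVf// mul1e preimage_setT.
by move=> A mA _; exact: lebesgue_measure_affine.
Qed.

Lemma integral_tonelli1 H : measurable_fun setT H -> (forall p, 0 <= H p) ->
  \int[mu2]_p H p = \int[mu]_x \int[mu]_y H (x, y).
Proof. by move=> mH H0; exact: (@fubini_tonelli1 _ _ _ _ R mu mu H mH H0). Qed.

Lemma integral_tonelli2 H : measurable_fun setT H -> (forall p, 0 <= H p) ->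
  \int[mu2]_p H p = \int[mu]_y \int[mu]_x H (x, y).
Proof. by move=> mH H0; rewrite integral_tonelli1// fubini_tonelli. Qed.

Lemma measurable_integral_fst H : measurable_fun setT H -> (forall p, 0 <= H p) ->
  measurable_fun setT (fun x => \int[mu]_y H (x, y)).
Proof. by move=> mH H0; exact: measurable_fun_fubini_tonelli_F. Qed.

Lemma measurable_integral_snd H : measurable_fun setT H -> (forall p, 0 <= H p) ->
  measurable_fun setT (fun y => \int[mu]_x H (x, y)).
Proof. by move=> mH H0; exact: measurable_fun_fubini_tonelli_G. Qed.

Lemma measurable_linear2 a b c d :
  measurable_fun setT (fun p : R * R => (a * p.1 + b * p.2, c * p.1 + d * p.2))%R.
Proof.
by apply: measurable_fun_pair; apply: measurable_funD; apply: measurable_funM.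
Qed.

(** With [a] as pivot and [D] the determinant, the map is [(x, y) -> (a x + b y, y)] followed by
    [(X, y) -> (X, (c/a) X + (D/a) y)]. Each factor moves one coordinate affinely, so Tonelli and
    the one-dimensional formula apply. *)
Lemma integral_linear2 H a b c d : a != 0%R -> (a * d - b * c != 0)%R ->
  measurable_fun setT H -> (forall p, 0 <= H p) ->
  \int[mu2]_p H (a * p.1 + b * p.2, c * p.1 + d * p.2)%R =
  (`|a * d - b * c|^-1)%:E * \int[mu2]_p H p.
Proof.
move=> a0 D0 mH H0; set D := (_ - _)%R in D0 *.
have mH2 := measurableT_comp mH (measurable_linear2 a b c d).
have Da0 : (D / a != 0)%R by rewrite mulf_neq0// invr_eq0.
pose K (p : R * R) := H (p.1, (c / a) * p.1 + (D / a) * p.2)%R.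
have mK : measurable_fun setT K.
  have := measurableT_comp mH (measurable_linear2 1 0 (c / a) (D / a)).
  by apply: eq_measurable_fun => p _ /=; rewrite mul1r mul0r addr0.
have K0 p : 0 <= K p by exact: H0.
rewrite (integral_tonelli2 mH2) => [|p]; last exact: H0.
transitivity (\int[mu]_y ((`|a|^-1)%:E * \int[mu]_x K (x, y))).
  apply: eq_integral => y _; rewrite -(@integral_affine _ a (b * y)%R a0)//; last first.
    exact: measurable_fun_pair1 mK.
  apply: eq_integral => x _; rewrite /K /=; congr (H (_, _)).
  by rewrite /D; field.
rewrite ge0_integralZl_EFin//; last 2 first.
  - by move=> y _; exact: integral_ge0.
  - exact: measurable_integral_snd.
rewrite -integral_tonelli2// integral_tonelli1// [X in _ = _ * X]integral_tonelli1//.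
transitivity ((`|a|^-1)%:E * \int[mu]_x ((`|D / a|^-1)%:E * \int[mu]_y H (x, y))).
  congr (_ * _); apply: eq_integral => x _.
  rewrite -(@integral_affine _ (D / a) ((c / a) * x)%R Da0)//; last first.
    exact: measurable_fun_pair2 mH.
  by apply: eq_integral => y _; rewrite /K /= addrC.
rewrite ge0_integralZl_EFin//; last 2 first.
  - by move=> x _; exact: integral_ge0.
  - exact: measurable_integral_fst.
rewrite muleA -EFinM; congr (_%:E * _).
by rewrite normrM normfV -invfM mulrC divfK// normr_eq0.
Qed.

(** If [c] is nonzero it is a pivot for the previous formula. Otherwise the rotation is a quarter
    turn, handled by exchanging the order of integration and reflecting. *)
Lemma integral_rotation H (c s : R) : (c ^+ 2 + s ^+ 2 = 1)%R ->
  measurable_fun setT H -> (forall p, 0 <= H p) ->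
  \int[mu2]_p H (c * p.1 - s * p.2, s * p.1 + c * p.2)%R = \int[mu2]_p H p.
Proof.
move=> cs mH H0.
have [c0|c0] := eqVneq c 0%R; last first.
  have := @integral_linear2 H c (- s)%R s c c0.
  rewrite mulNr opprK -!expr2 cs normr1 invr1 mul1e oner_eq0 => /(_ isT mH H0) <-.
  by apply: eq_integral => p _; rewrite mulNr.
have s0 : s != 0%R by apply/eqP => s0; move: cs; rewrite c0 s0 !expr0n /= addr0 => /esym/eqP; rewrite oner_eq0.
have ns : (`|s| = 1)%R.
  apply/eqP; rewrite -(@eqrXn2 _ 2)// real_normK ?num_real// expr1n.
  by move: cs; rewrite c0 expr0n /= add0r => ->.
have mK := measurableT_comp mH (measurable_linear2 0 (-s)%R s 0).
transitivity (\int[mu2]_p (H \o (fun p : R * R => (0 * p.1 + (- s) * p.2, s * p.1 + 0 * p.2)%R)) p).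
  by apply: eq_integral => p _ /=; rewrite c0 !mul0r mulNr.
rewrite (integral_tonelli2 mK) => [|p]; last exact: H0.
rewrite (integral_tonelli1 mH H0).
transitivity (\int[mu]_y (\int[mu]_x H (- s * y, x)%R)).
  apply: eq_integral => y _; rewrite /=.
  rewrite -[RHS]mul1e -[1%E]/(1%:E) -invr1 -ns -(@integral_affine _ s 0%R s0)//; last first.
    exact: measurable_fun_pair2 mH.
  by apply: eq_integral => x _; rewrite !mul0r add0r.
have s0' : (- s != 0)%R by rewrite oppr_eq0.
rewrite -[RHS]mul1e -[1%E]/(1%:E) -invr1 -ns -normrN -(@integral_affine _ (- s)%R 0%R s0')//.
- by apply: eq_integral => y _; rewrite addr0.
- exact: measurable_integral_fst.
- by move=> x; exact: integral_ge0.
Qed.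

Lemma integral_fold F : measurable_fun setT F -> (forall x, 0 <= F x) ->
  \int[mu]_x F x = \int[mu]_(x in `[0%R, +oo[) (F x + F (- x)%R).
Proof.
move=> mF F0.
have mFN : measurable_fun setT (fun x => F (- x)%R) by apply: measurableT_comp => //; exact: oppr_measurable.
have mI : measurable (`[0%R, +oo[%classic : set R) by [].
have mIC := measurableC mI.
rewrite -(setUv `[0%R, +oo[%classic) (ge0_integral_setU mu mI mIC)//; first last.
- by apply/disj_setPS => x [].
- by rewrite setUv.
rewrite ge0_integralD//; last 2 first.
- exact: measurable_funTS.
- exact: measurable_funTS.
congr (_ + _); rewrite integral_mkcond.
have := @integral_affine (F \_ (~` `[0%R, +oo[)) (-1)%R 0%R.
rewrite oppr_eq0 oner_eq0 normrN1 invr1 mul1e => <-//; last 2 first.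
- by apply: (iffLR (measurable_restrictT _ mIC)); exact: measurable_funTS.
- by move=> x; rewrite patchE; case: ifP.
rewrite -integral_itv_obnd_cbnd; last exact: measurable_funTS.
rewrite [RHS]integral_mkcond; apply: eq_integral => x _.
rewrite !patchE mulN1r addr0.
rewrite (_ : ((- x)%R \in ~` `[0%R, +oo[%classic) = (x \in `]0%R, +oo[%classic))//.
apply/idP/idP; rewrite !inE /= !in_itv/= !andbT oppr_ge0.
  by move=> /negP; rewrite -ltNge.
by rewrite ltNge => /negP.
Qed.

End LinearChange.

Section Polar.
Variable R : realType.
Local Open Scope ereal_scope.
Local Notation mu := (@lebesgue_measure R).
Local Notation mu2 := (mu \x mu).
Local Notation C := (complex R).
Implicit Types (F phi : R -> \bar R) (G H : R * R -> \bar R).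

Definition toC (p : R * R) : C := p.1 +i* p.2.

Definition cxnorm (p : R * R) : R := cnorm (toC p).

Lemma cxnormE p : cxnorm p = Num.sqrt (p.1 ^+ 2 + p.2 ^+ 2)%R. Proof. by []. Qed.

Lemma measurable_sqrt : measurable_fun setT (@Num.sqrt R).
Proof. by apply: continuous_measurable_fun; exact: sqrt_continuous. Qed.

Lemma measurable_cxnorm : measurable_fun setT cxnorm.
Proof.
have -> : cxnorm = @Num.sqrt R \o (fun p : R * R => p.1 ^+ 2 + p.2 ^+ 2)%R.
  by apply/funext => p; rewrite cxnormE.
apply: measurableT_comp measurable_sqrt _.
by apply: measurable_funD; apply: measurable_funX.
Qed.

Lemma measurable_funV d (T : measurableType d) (f : T -> R) :
  measurable_fun setT f -> (forall x, 0 <= f x)%R -> measurable_fun setT (fun x => (f x)^-1)%R.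
Proof.
move=> mf f0; have := measurableT_comp (measurable_powR (-1)%R) mf.
by apply: eq_measurable_fun => x _ /=; rewrite powR_inv1.
Qed.

(* A half circle is parametrized by the slope [t = tan theta], with [cos theta = tan_cos t] and
   [d theta = tan_cos t ^+ 2 dt]: polar coordinates then need only linear changes of variables. *)
Definition tan_cos (t : R) : R := (Num.sqrt (1 + t ^+ 2))^-1%R.

Lemma tan_cos_gt0 t : (0 < tan_cos t)%R.
Proof. by rewrite invr_gt0 sqrtr_gt0 ltr_pwDl// sqr_ge0. Qed.

Lemma tan_cos_sqr t : (tan_cos t ^+ 2 * (1 + t ^+ 2) = 1)%R.
Proof.
have h : (0 < 1 + t ^+ 2)%R by rewrite ltr_pwDl// sqr_ge0.
by rewrite /tan_cos exprVn sqr_sqrtr ?ltW// mulVf// gt_eqF.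
Qed.

Lemma measurable_tan_cos : measurable_fun setT tan_cos.
Proof.
apply: measurable_funV => [|t]; last exact: sqrtr_ge0.
apply: measurableT_comp measurable_sqrt _.
by apply: measurable_funD => //; exact: measurable_funX.
Qed.

Lemma measurable_fun_prod2 (f g : R * R -> R) H : measurable_fun setT H ->
  measurable_fun setT f -> measurable_fun setT g ->
  measurable_fun setT (fun p => H (f p, g p)).
Proof. by move=> mH mf mg; apply: (measurableT_comp mH); exact: measurable_fun_pair. Qed.

Lemma measurable_tan_cos_snd : measurable_fun setT (fun p : R * R => tan_cos p.2).
Proof. exact: measurableT_comp measurable_tan_cos measurable_snd. Qed.

Lemma measurable_polar H : measurable_fun setT H ->
  measurable_fun setT (fun p : R * R => H (p.1 * tan_cos p.2, p.1 * tan_cos p.2 * p.2)%R).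
Proof.
have mt := measurable_tan_cos_snd.
by move=> mH; apply: measurable_fun_prod2 => //; do ?apply: measurable_funM.
Qed.

(** For [r > 0] this is the right half of the circle and for [r < 0] the left half. *)
Definition half_circle_int H (r : R) : \bar R :=
  \int[mu]_t ((tan_cos t ^+ 2)%:E * H (r * tan_cos t, r * tan_cos t * t)%R).

Let mpolar_kernel H : measurable_fun setT H -> measurable_fun setT (fun p : R * R =>
   (tan_cos p.2 ^+ 2)%:E * H (p.1 * tan_cos p.2, p.1 * tan_cos p.2 * p.2)%R).
Proof.
move=> mH; apply: emeasurable_funM; last exact: measurable_polar.
by apply/measurable_EFinP; apply: measurable_funX; exact: measurable_tan_cos_snd.
Qed.

Lemma half_circle_int_ge0 H r : (forall p, 0 <= H p) -> 0 <= half_circle_int H r.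
Proof. by move=> H0; apply: integral_ge0 => t _; rewrite mule_ge0// lee_fin sqr_ge0. Qed.

Lemma measurable_half_circle_int H : measurable_fun setT H -> (forall p, 0 <= H p) ->
  measurable_fun setT (half_circle_int H).
Proof.
move=> mH H0; apply: (measurable_integral_fst (mpolar_kernel mH)) => p.
by rewrite mule_ge0// lee_fin sqr_ge0.
Qed.

(** Two one-dimensional substitutions: [y = x t] for fixed [x], with Jacobian [|x|], and then
    [x = r tan_cos t] for fixed slope [t], which turns [|x| dx] into [|r| tan_cos t ^+ 2 dr]. The
    line [x = 0] is a null set. *)
Lemma integral_polar_line H : measurable_fun setT H -> (forall p, 0 <= H p) ->
  \int[mu2]_p H p = \int[mu]_r (`|r|%:E * half_circle_int H r).
Proof.
move=> mH H0; rewrite (integral_tonelli1 mH H0).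
pose K (p : R * R) := `|p.1|%:E * H (p.1, p.1 * p.2)%R.
have mabs : measurable_fun setT (fun p : R * R => `|p.1|%:E).
  by apply/measurable_EFinP; apply: measurableT_comp.
have mK : measurable_fun setT K.
  apply: emeasurable_funM => //; apply: measurable_fun_prod2 => //.
  exact: measurable_funM.
have K0 p : 0 <= K p by rewrite mule_ge0.
transitivity (\int[mu]_x \int[mu]_t K (x, t)).
  apply: ge0_ae_eq_integral => //.
  - exact: measurable_integral_fst.
  - exact: measurable_integral_fst.
  - by move=> x _; apply: integral_ge0.
  - by move=> x _; apply: integral_ge0.
  exists [set 0%R]; split; [exact: measurable_set1|exact: lebesgue_measure_set1|].
  move=> x /=; apply: contra_notP => /eqP x0 _.
  have mHx := measurable_fun_pair2 x mH.
  have := @integral_affine R (fun y => H (x, y)) x 0%R x0 mHx (fun y => H0 _).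
  move=> /(congr1 (fun z => `|x|%:E * z)); rewrite muleA -EFinM mulfV ?normr_eq0// mul1e => <-.
  rewrite -ge0_integralZl_EFin//; first by apply: eq_integral => t _; rewrite /K /= addr0.
  by apply: (measurableT_comp mHx); exact: measurable_affine.
rewrite -(integral_tonelli1 mK K0) (integral_tonelli2 mK K0).
pose L (p : R * R) := `|p.1|%:E * ((tan_cos p.2 ^+ 2)%:E * H (p.1 * tan_cos p.2, p.1 * tan_cos p.2 * p.2)%R).
have mL : measurable_fun setT L by apply: emeasurable_funM => //; exact: mpolar_kernel.
have L0 p : 0 <= L p by rewrite !mule_ge0// lee_fin sqr_ge0.
transitivity (\int[mu]_t \int[mu]_r L (r, t)).
  apply: eq_integral => t _.
  have c0 := tan_cos_gt0 t; have cn0 : tan_cos t != 0%R by rewrite gt_eqF.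
  have mKt := measurable_fun_pair1 t mK.
  have := @integral_affine R (fun x => K (x, t)) (tan_cos t) 0%R cn0 mKt (fun y => K0 _).
  move=> /(congr1 (fun z => (tan_cos t)%:E * z)).
  rewrite muleA -EFinM gtr0_norm// mulfV// mul1e => <-.
  rewrite -ge0_integralZl_EFin//; last 2 first.
  - by apply: (measurableT_comp mKt); exact: measurable_affine.
  - exact: ltW.
  apply: eq_integral => r _; rewrite /K /L /= addr0 normrM gtr0_norm// (mulrC (tan_cos t) r).
  by rewrite !muleA -!EFinM; congr (_%:E * _); ring.
rewrite -(integral_tonelli2 mL L0) (integral_tonelli1 mL L0).
apply: eq_integral => r _; rewrite /half_circle_int -ge0_integralZl_EFin//.
- by move=> t _; rewrite mule_ge0// lee_fin sqr_ge0.
- exact: (measurable_fun_pair2 r (mpolar_kernel mH)).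
Qed.

Lemma cxnorm_polar r t : cxnorm (r * tan_cos t, r * tan_cos t * t)%R = `|r|%R.
Proof.
rewrite cxnormE /= (_ : _ + _ = r ^+ 2 * (tan_cos t ^+ 2 * (1 + t ^+ 2)))%R; last by ring.
by rewrite tan_cos_sqr mulr1 sqrtr_sqr.
Qed.

Lemma integral_polar_fold phi G : measurable_fun setT phi -> (forall x, 0 <= phi x) ->
  measurable_fun setT G -> (forall p, 0 <= G p) ->
  \int[mu2]_p (phi (cxnorm p) * G p) =
  \int[mu]_(r in `[0%R, +oo[) (r%:E * phi r * (half_circle_int G r + half_circle_int G (- r)%R)).
Proof.
move=> mphi phi0 mG G0.
have mH : measurable_fun setT (fun p => phi (cxnorm p) * G p).
  by apply: emeasurable_funM => //; exact: measurableT_comp mphi measurable_cxnorm.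
rewrite (integral_polar_line mH) => [|p]; last by rewrite mule_ge0.
have hE r : half_circle_int (fun p => phi (cxnorm p) * G p) r = phi `|r|%R * half_circle_int G r.
  rewrite /half_circle_int -ge0_integralZl//.
  - by apply: eq_integral => t _; rewrite cxnorm_polar muleCA.
  - exact: (measurable_fun_pair2 r (mpolar_kernel mG)).
  - by move=> t _; rewrite mule_ge0// lee_fin sqr_ge0.
under eq_integral do rewrite hE.
rewrite integral_fold; last 2 first.
- have mh := measurable_half_circle_int mG G0.
  apply: emeasurable_funM; first exact/measurable_EFinP.
  by apply: emeasurable_funM => //; exact: measurableT_comp.
- by move=> r; rewrite !mule_ge0// half_circle_int_ge0.
apply: eq_integral => r; rewrite inE/= in_itv/= andbT => r0.
have h1 := half_circle_int_ge0 r G0; have h2 := half_circle_int_ge0 (- r)%R G0.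
by rewrite normrN ger0_norm// !muleA [RHS]ge0_muleDr.
Qed.

(* [pi] times the mean of [G] over the circle of radius [r], as an area integral so that rotation
   invariance comes from that of the plane measure. *)
Definition circ_int G (r : R) : \bar R :=
  \int[mu2]_(p in [set p | (cxnorm p < 1)%R]) G (r * (p.1 / cxnorm p), r * (p.2 / cxnorm p))%R.

Lemma cxnorm_ge0 p : (0 <= cxnorm p)%R. Proof. exact: cnorm_ge0. Qed.

Lemma measurable_radial G r : measurable_fun setT G ->
  measurable_fun setT (fun p : R * R => G (r * (p.1 / cxnorm p), r * (p.2 / cxnorm p))%R).
Proof.
move=> mG; have mV := measurable_funV measurable_cxnorm cxnorm_ge0.
apply: measurable_fun_prod2 => //; apply: measurable_funM => //; exact: measurable_funM.
Qed.

Lemma measurable_cxdisc : measurable [set p : R * R | (cxnorm p < 1)%R].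
Proof.
rewrite (_ : mkset _ = setT `&` cxnorm @^-1` [set` `]-oo, 1%R[]).
  by apply: measurable_cxnorm.
by apply/seteqP; split=> p /=; rewrite in_itv//= => -[].
Qed.

Lemma integral_cxdisc G : measurable_fun setT G ->
  \int[mu2]_(p in [set p | (cxnorm p < 1)%R]) G p =
  \int[mu2]_p ((\1_(`]-oo, 1%R[%classic) (cxnorm p))%:E * G p).
Proof.
move=> mG; rewrite integral_mkcond; apply: eq_integral => p _.
rewrite patchE indicE (_ : (p \in _) = (cxnorm p \in `]-oo, 1%R[%classic)).
  by case: ifP; rewrite ?mul1e ?mul0e.
by apply/idP/idP; rewrite !inE/= ?in_itv.
Qed.

(** In polar coordinates the integrand of [circ_int] does not depend on the radius [s], so
    [circ_int] is the left side times the integral of [s] over [[0, 1]], which is 1/2. *)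
Lemma half_circle_intD G r : measurable_fun setT G -> (forall p, 0 <= G p) ->
  half_circle_int G r + half_circle_int G (- r)%R = 2%:E * circ_int G r.
Proof.
move=> mG G0; have mG1 := measurable_radial r mG.
have m1 : measurable_fun setT (fun x : R => (\1_(`]-oo, 1%R[%classic) x : R)%:E).
  by apply/measurable_EFinP; exact: measurable_indic.
rewrite /circ_int integral_cxdisc// (integral_polar_fold m1 _ mG1) => [|x|p]; last 2 first.
- by rewrite lee_fin.
- exact: G0.
set S := half_circle_int G r + _.
have S0 : 0 <= S by rewrite adde_ge0// half_circle_int_ge0.
have hE s : (0 < s)%R -> half_circle_int (fun p => G (r * (p.1 / cxnorm p), r * (p.2 / cxnorm p))%R) s
    = half_circle_int G r.
  move=> s0; apply: eq_integral => t _; rewrite cxnorm_polar gtr0_norm//=.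
  by congr (_ * G (_, _)); field; exact: lt0r_neq0.
have hEN s : (0 < s)%R -> half_circle_int (fun p => G (r * (p.1 / cxnorm p), r * (p.2 / cxnorm p))%R) (- s)%R
    = half_circle_int G (- r)%R.
  move=> s0; apply: eq_integral => t _; rewrite cxnorm_polar normrN gtr0_norm//=.
  by congr (_ * G (_, _)); field; exact: lt0r_neq0.
transitivity (2%:E * (S * (\int[mu]_(s in `[0%R, 1%R]) s%:E))).
  have -> : \int[mu]_(s in `[0%R, 1%R]) s%:E = (2^-1)%:E.
    have dphi (t : R) : (0 <= t <= 1)%R -> is_derive t 1%R (fun x : R => x ^+ 2 / 2)%R t.
      by move=> _; apply: is_derive_eq; rewrite /GRing.scale /= !mulr1; field.
    have cid : {within `[0%R, 1%R], continuous (@id R)}.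
      by apply: continuous_subspaceT => x; exact: cvg_id.
    rewrite (integral_FTC ler01 dphi cid); congr EFin.
    by rewrite expr0n /= expr1n; field.
  by rewrite muleCA -EFinM mulfV// mule1.
congr (_ * _); rewrite -ge0_integralZl//; last first.
  by move=> s; rewrite /= in_itv/= => /andP[].
rewrite -integral_itv_bndo_bndc; last first.
  apply: measurable_funTS; apply: measurable_funeM; exact/measurable_EFinP.
rewrite [LHS]integral_mkcond [RHS]integral_mkcond; apply: eq_integral => s _.
rewrite !patchE indicE !mem_setE !in_itv/= andbT.
have [s0/=|//] := leP 0%R s; have [s1|_] := ltP s 1%R; last by rewrite mule0 mul0e.
rewrite mule1.
have [->|sn0] := eqVneq s 0%R; first by rewrite mul0e mule0.
have {sn0}s0 : (0 < s)%R by rewrite lt0r sn0.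
by rewrite hE// hEN// muleC.
Qed.

Lemma circ_int_ge0 G r : (forall p, 0 <= G p) -> 0 <= circ_int G r.
Proof. by move=> G0; exact: integral_ge0. Qed.

Lemma circ_int_half G r : measurable_fun setT G -> (forall p, 0 <= G p) ->
  circ_int G r = (2^-1)%:E * (half_circle_int G r + half_circle_int G (- r)%R).
Proof. by move=> mG G0; rewrite half_circle_intD// muleA -EFinM mulVf// mul1e. Qed.

Lemma measurable_circ_int G : measurable_fun setT G -> (forall p, 0 <= G p) ->
  measurable_fun setT (circ_int G).
Proof.
move=> mG G0; have mh := measurable_half_circle_int mG G0.
apply: (eq_measurable_fun (fun r => (2^-1)%:E * (half_circle_int G r + half_circle_int G (- r)%R))).
  by move=> r _; rewrite circ_int_half.
apply: measurable_funeM; apply: emeasurable_funD => //.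
by apply: (measurableT_comp mh); exact: oppr_measurable.
Qed.

Theorem integral_polar phi G : measurable_fun setT phi -> (forall x, 0 <= phi x) ->
  measurable_fun setT G -> (forall p, 0 <= G p) ->
  \int[mu2]_p (phi (cxnorm p) * G p) =
  \int[mu]_(r in `[0%R, +oo[) ((2 * r)%:E * phi r * circ_int G r).
Proof.
move=> mphi phi0 mG G0; rewrite integral_polar_fold//; apply: eq_integral => r _.
by rewrite half_circle_intD// EFinM [LHS]muleCA !muleA.
Qed.

Definition cxmul (e : C) (p : R * R) : R * R :=
  (complex.Re e * p.1 - complex.Im e * p.2, complex.Im e * p.1 + complex.Re e * p.2)%R.

Lemma toC_cxmul e p : toC (cxmul e p) = (e * toC p)%R.
Proof. by case: e => a b; rewrite /toC /cxmul /=; simpc; congr (_ +i* _)%C; ring. Qed.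

Lemma measurable_cxmul e : measurable_fun setT (cxmul e).
Proof. by apply: measurable_fun_pair; [apply: measurable_funB|apply: measurable_funD]; apply: measurable_funM. Qed.

Lemma integral_cxmul (e : C) G : cnorm e = 1%R -> measurable_fun setT G -> (forall p, 0 <= G p) ->
  \int[mu2]_p G (cxmul e p) = \int[mu2]_p G p.
Proof.
by move=> e1 mG G0; apply: integral_rotation => //; rewrite -cnorm_sqr e1 expr1n.
Qed.

Lemma circ_int_rotation (e : C) G r : cnorm e = 1%R -> measurable_fun setT G ->
  (forall p, 0 <= G p) -> circ_int (G \o cxmul e) r = circ_int G r.
Proof.
move=> e1 mG G0; have mGe : measurable_fun setT (G \o cxmul e) := measurableT_comp mG (measurable_cxmul e).
have nE p : cxnorm (cxmul e p) = cxnorm p by rewrite /cxnorm toC_cxmul cnormM e1 mul1r.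
rewrite /circ_int !integral_cxdisc; [|exact: measurable_radial..].
pose K (p : R * R) := (\1_(`]-oo, 1%R[%classic) (cxnorm p))%:E *
  G (r * (p.1 / cxnorm p), r * (p.2 / cxnorm p))%R.
rewrite -/(K _) -[RHS](integral_cxmul (G := K) e1).
- apply: eq_integral => p _; rewrite /K nE /=; congr (_ * G _).
  by rewrite /cxmul /=; congr (_, _); ring.
- apply: emeasurable_funM; last exact: measurable_radial.
  apply/measurable_EFinP; apply: measurableT_comp => //; exact: measurable_cxnorm.
- by move=> p; rewrite mule_ge0// lee_fin.
Qed.

End Polar.

(** * Monotonicity of circular means *)

Section CircleMonotone.
Variable R : realType.
Local Open Scope ereal_scope.
Local Notation mu := (@lebesgue_measure R).
Local Notation mu2 := (mu \x mu).
Local Notation C := (complex R).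
Implicit Types (h f : C -> C) (p q : R * R).

(** The condition says that [U] is open, and an open set is the union of the countably many rational
    boxes it contains. *)
Lemma open_box_measurable (U : set (R * R)) :
  (forall p, U p -> exists2 del : R, (0 < del)%R & forall q,
     (`|q.1 - p.1| < del)%R -> (`|q.2 - p.2| < del)%R -> U q) -> measurable U.
Proof.
move=> oU.
pose B (a b c d : rat) : set (R * R) :=
  (`]ratr a, ratr b[ `*` `]ratr c, ratr d[)%classic.
pose F a b c d := if pselect (B a b c d `<=` U) then B a b c d else set0.
rewrite (_ : U = \bigcup_a \bigcup_b \bigcup_c \bigcup_d F a b c d).
  do 4![apply: bigcupT_measurable_rat => ?]; rewrite /F.
  by case: pselect => [?|?]; [exact: measurableX|exact: measurable0].
apply/seteqP; split=> [p Up|p [a _ [b _ [c _ [d _]]]]]; last first.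
  by rewrite /F; case: pselect => // BU; exact: BU.
have [del del0 Hdel] := oU _ Up.
have lt1 (x : R) : (x - del < x)%R by rewrite ltrBlDr ltrDl.
have lt2 (x : R) : (x < x + del)%R by rewrite ltrDl.
have [a Ha] := rat_in_itvoo (lt1 p.1); have [b Hb] := rat_in_itvoo (lt2 p.1).
have [c Hc] := rat_in_itvoo (lt1 p.2); have [d Hd] := rat_in_itvoo (lt2 p.2).
move: Ha Hb Hc Hd; rewrite !in_itv/= => /andP[a1 a2] /andP[b1 b2] /andP[c1 c2] /andP[d1 d2].
exists a => //; exists b => //; exists c => //; exists d => //; rewrite /F.
case: pselect => [BU|nB].
  by rewrite /B; split=> /=; rewrite in_itv/= ?a2 ?b1 ?c2 ?d1.
exfalso; apply: nB => q [/= +]; rewrite !in_itv/= => /andP[q1 q2] /andP[q3 q4].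
by apply: Hdel; rewrite ltr_norml; apply/andP; split; lra.
Qed.

(** Off the disc nothing is known about [h]; the cut-off makes a function that is measurable on the
    whole plane. *)
Definition absdisc h p : \bar R := if (cxnorm p < 1)%R then (cnorm (h (toC p)))%:E else 0.

Lemma absdisc_ge0 h p : 0 <= absdisc h p.
Proof. by rewrite /absdisc; case: ifP => // _; rewrite lee_fin cnorm_ge0. Qed.

Lemma absdiscE h p : (cxnorm p < 1)%R -> absdisc h p = (cnorm (h (toC p)))%:E.
Proof. by rewrite /absdisc => ->. Qed.

Lemma toC_dist p q : (cnorm (toC q - toC p) <= `|q.1 - p.1| + `|q.2 - p.2|)%R.
Proof. by have := cnorm_le_ReIm (toC q - toC p)%R; rewrite ReD ImD ReN ImN. Qed.

(** Superlevel sets above a level [a >= 0] lie inside the disc and are open; below 0 they are the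
    whole plane. *)
Lemma measurable_absdisc h : hol 1 h -> measurable_fun setT (absdisc h).
Proof.
move=> hh; pose f p := if (cxnorm p < 1)%R then cnorm (h (toC p)) else 0%R.
suff mf : measurable_fun setT f.
  have -> : absdisc h = EFin \o f by apply/funext => p; rewrite /absdisc /f /=; case: ifP.
  exact/measurable_EFinP.
move=> mD; apply: (measurability _ (RGenOInfty.measurableE R)) => //.
move=> /= _ [_ [a ->] <-]; rewrite setTI.
have [a0|a0] := ltP a 0%R.
  rewrite (_ : _ @^-1` _ = setT)//; apply/seteqP; split=> // p _ /=.
  rewrite in_itv/= andbT (lt_le_trans a0)// /f; case: ifP => // _; exact: cnorm_ge0.
apply: open_box_measurable => p /=; rewrite in_itv/= andbT {1}/f.
case: ifPn => [p1 ap|_ /lt_le_trans/(_ a0)]; last by rewrite ltxx.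
have [d Hd] := hh _ p1.
have e0 : (0 < (cnorm (h (toC p)) - a) / 2)%R by rewrite divr_gt0// subr_gt0.
have [del del0 Hdel] := null_cont Hd e0.
exists (Num.min (del / 2) ((1 - cxnorm p) / 2))%R.
  by rewrite lt_min !divr_gt0// subr_gt0.
move=> q; rewrite !lt_min => /andP[q1 q2] /andP[q3 q4].
have qp : (cnorm (toC q - toC p) < del)%R.
  by apply: (le_lt_trans (toC_dist p q)); rewrite (splitr del) ltrD.
have qp1 : (cnorm (toC q - toC p) < 1 - cxnorm p)%R.
  by apply: (le_lt_trans (toC_dist p q)); rewrite (splitr (1 - cxnorm p)%R) ltrD.
have qn : (cxnorm q < 1)%R.
  have := le_lt_trans (cnormB_ge (toC q) (toC p)) qp1.
  by rewrite /cxnorm; lra.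
rewrite in_itv/= andbT /f qn.
have := Hdel _ qp; rewrite subrKC => h1.
have := cnormB_ge (h (toC p)) (h (toC q)); rewrite cnorm_distC => h2.
by have := le_trans h2 h1; lra.
Qed.

Lemma limn_einf_le (u : nat -> \bar R) (a : \bar R) :
  (exists N0, forall n, (N0 <= n)%N -> u n <= a) -> limn_einf u <= a.
Proof.
move=> [N0 H]; rewrite limn_einf_lim; apply: lime_le; first exact: is_cvg_einfs.
exists N0 => // n /= /H; apply: le_trans.
by apply: ereal_inf_lbound; exists n => /=.
Qed.

Lemma limn_einf_ge (u : nat -> \bar R) (a : \bar R) :
  (exists N0, forall n, (N0 <= n)%N -> a <= u n) -> a <= limn_einf u.
Proof.
move=> [N0 H]; rewrite limn_einf_lim; apply: lime_ge; first exact: is_cvg_einfs.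
exists N0 => // n /= nN; apply: le_ereal_inf_tmp => _ [m /= nm <-].
by apply: H; exact: leq_trans nm.
Qed.

Lemma poisson_real_bound (s : R) e : (0 <= s < 1)%R -> (0 < e)%R ->
  exists N0, forall N, (N0 <= N)%N -> (poisson ((s%:C)%C ^+ N) <= 1 + e)%R.
Proof.
move=> /andP[s0 s1] e0.
have sn : cnorm (s%:C%C : C) = s by rewrite cnorm_real ger0_norm.
have d0 : (0 < Num.min (1 / 2) (e / 4))%R by rewrite lt_min !divr_gt0.
have [|N0 H] := @cvgC0_geom R (s%:C)%C _ _ d0; first by rewrite sn.
exists N0 => N /H; rewrite subr0 cnormX sn le_min => /andP[h1 h2].
set x := (s ^+ N)%R in h1 h2 *.
have x0 : (0 <= x)%R by rewrite exprn_ge0.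
rewrite /poisson cnormX sn -/x.
have -> : (1 - (s%:C)%C ^+ N = (1 - x)%:C%C :> C)%R by rewrite rmorphB rmorphXn.
rewrite cnorm_real ger0_norm; last by lra.
rewrite ler_pdivrMr; last by rewrite exprn_gt0//; lra.
have x1 : (0 <= 1 - x)%R by lra.
have ex : (e * x <= e / 2)%R by rewrite ler_pM2l//; lra.
have h3 : (1 + x <= (1 + e) * (1 - x))%R by lra.
have := ler_wpM2r x1 h3; rewrite -mulrA -expr2 => /(le_trans _); apply.
by rewrite le_eqVlt; apply/orP; left; apply/eqP; ring.
Qed.

Lemma cxnorm_radial p (r : R) : (0 <= r)%R ->
  (cxnorm (r * (p.1 / cxnorm p), r * (p.2 / cxnorm p)) <= r)%R.
Proof.
move=> r0; have [p0|p0] := eqVneq (cxnorm p) 0%R.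
  by rewrite p0 invr0 !mulr0 cxnormE /= expr0n addr0 sqrtr0.
rewrite (_ : cxnorm _ = r)// /cxnorm.
have -> : toC (r * (p.1 / cxnorm p), r * (p.2 / cxnorm p))%R = ((r / cxnorm p)%:C%C * toC p)%R.
  by rewrite /toC /=; simpc; congr (_ +i* _)%C; ring.
rewrite cnormM cnorm_real ger0_norm ?divr_ge0// ?cnorm_ge0// -/(cxnorm p).
by rewrite divfK.
Qed.

(** Pointwise, the value at radius [s r] is at most the lower limit of the Poisson-weighted averages
    [g N] of rotated values at radius [r]. By rotation invariance the integral of [g N] is exactly
    [P(s^N)] times [circ_int] at [r]; Fatou's lemma and [P(s^N) -> 1] conclude. *)
Lemma circ_int_shrink h (r s : R) : hol 1 h -> (0 <= r < 1)%R -> (0 <= s < 1)%R ->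
  circ_int (absdisc h) (s * r) <= circ_int (absdisc h) r.
Proof.
move=> hh /andP[r0 r1] s01; have /andP[s0 s1] := s01.
set H := absdisc h.
have mH : measurable_fun setT H := measurable_absdisc hh.
have H0 p : 0 <= H p := absdisc_ge0 h p.
have sn : cnorm (s%:C%C : C) = s by rewrite cnorm_real ger0_norm.
pose A p := (r * (p.1 / cxnorm p), r * (p.2 / cxnorm p))%R.
have An p : (cxnorm (A p) < 1)%R by apply: le_lt_trans r1; exact: cxnorm_radial.
pose k N i := poisson (s%:C%C * rt R N i)%R.
have k0 N i : (0 <= k N i)%R by rewrite poisson_ge0// cnormM sn cnorm_rt mulr1.
pose g N p := (N%:R^-1)%:E * \sum_(i < N) (k N i)%:E * H (cxmul (rt R N i) (A p)).
have mg1 N i : measurable_fun setT (fun p => H (cxmul (rt R N i) (A p))).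
  exact: (measurable_radial r (measurableT_comp mH (measurable_cxmul (rt R N i)))).
have mg N : measurable_fun setT (g N).
  apply: measurable_funeM; apply: emeasurable_sum => i; apply: measurable_funeM; exact: mg1.
have g0 N p : 0 <= g N p.
  by rewrite mule_ge0// ?lee_fin ?invr_ge0// sume_ge0// => i _; rewrite mule_ge0// lee_fin.
have mD := @measurable_cxdisc R.
have limg p : H (s * r * (p.1 / cxnorm p), s * r * (p.2 / cxnorm p))%R <= limn_einf (g ^~ p).
  set a := (_, _); have aE : toC a = (toC (A p) * s%:C%C)%R.
    by rewrite /a /A /toC /=; simpc; congr (_ +i* _)%C; ring.
  have an : (cxnorm a < 1)%R.
    by rewrite /cxnorm aE cnormM sn; have := An p; have := cnorm_ge0 (toC (A p)); rewrite /cxnorm; nra.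
  rewrite /H absdiscE// aE; apply/lee_addgt0Pr => e e0.
  rewrite -leeBlDr//; apply: limn_einf_ge.
  have [N0 HN0] := poisson_mean_norm hh (An p) s01 e0.
  exists N0 => N /HN0 le; rewrite leeBlDr// /g.
  rewrite (eq_bigr (fun i : 'I_N => (k N i * cnorm (h (toC (A p) * rt R N i)))%:E)); last first.
    move=> i _; rewrite /H absdiscE; last by rewrite /cxnorm toC_cxmul cnormM cnorm_rt mul1r; exact: An.
    by rewrite toC_cxmul mulrC -EFinM.
  by rewrite sumEFin -EFinM -EFinD lee_fin.
have circE : circ_int H (s * r) = \int[mu2]_(p in [set p | (cxnorm p < 1)%R])
   H (s * r * (p.1 / cxnorm p), s * r * (p.2 / cxnorm p))%R by [].
rewrite circE; apply: (@le_trans _ _ (\int[mu2]_(p in [set p | (cxnorm p < 1)%R]) limn_einf (g ^~ p))).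
  apply: ge0_le_integral => //.
  - exact: measurable_funTS (measurable_radial (s * r) mH).
  - apply: measurable_funTS.
    apply: (@emeasurable_fun_cvg _ _ _ setT (fun n p => einfs (g ^~ p) n)).
      by apply: measurable_fun_einfs => N; exact: mg.
    by move=> p _; rewrite limn_einf_lim; exact: is_cvg_einfs.
have mgD N : measurable_fun [set p | (cxnorm p < 1)%R] (g N) by exact: measurable_funTS.
apply: (le_trans (fatou mu2 mD mgD (fun N p _ => g0 N p))).
have intg N : (0 < N)%N -> \int[mu2]_(p in [set p | (cxnorm p < 1)%R]) g N p =
    (poisson ((s%:C)%C ^+ N))%:E * circ_int H r.
  move=> N0; rewrite -mean_poisson// ?sn// EFinM /g.
  rewrite ge0_integralZl_EFin ?invr_ge0//; last first.
    apply: measurable_funTS; apply: emeasurable_sum => i; apply: measurable_funeM; exact: mg1.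
    by move=> p _; rewrite sume_ge0// => i _; rewrite mule_ge0// lee_fin.
  rewrite -muleA; congr (_ * _); rewrite ge0_integral_sum//; last 2 first.
  - move=> i; apply: measurable_funTS; apply: measurable_funeM; exact: mg1.
  - by move=> i p _; rewrite mule_ge0// lee_fin.
  rewrite -sumEFin ge0_sume_distrl; last by move=> i _; rewrite lee_fin; exact: k0.
  apply: eq_bigr => i _.
  rewrite ge0_integralZl_EFin ?k0//; last exact: (measurable_funTS (mg1 N i)).
  by rewrite -(circ_int_rotation r (cnorm_rt R N i) mH H0).
have c0 : 0 <= circ_int H r by exact: circ_int_ge0.
have : circ_int H r \is a fin_num \/ circ_int H r = +oo.
  by move: c0; case: (circ_int H r) => [x| |] // _; [left|right].
case=> [cf|->]; last exact: leey.
rewrite -(fineK cf); set c := fine _; have c0' : (0 <= c)%R by rewrite fine_ge0.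
apply/lee_addgt0Pr => e e0; apply: limn_einf_le.
have d0 : (0 < e / (c + 1))%R by rewrite divr_gt0// ltr_wpDl.
have [N0 HN0] := poisson_real_bound s01 d0.
exists (maxn 1 N0) => N; rewrite geq_max => /andP[N1 /HN0 le].
rewrite intg// -(fineK cf) -/c -EFinM -EFinD lee_fin.
apply: (le_trans (ler_wpM2r c0' le)); rewrite mulrDl mul1r lerD2l.
by rewrite mulrAC ler_pdivrMr ?ltr_wpDl// ler_pM2l// lerDl.
Qed.

Lemma circ_int_mono h (r1 r2 : R) : hol 1 h -> (0 <= r1)%R -> (r1 <= r2)%R -> (r2 < 1)%R ->
  circ_int (absdisc h) r1 <= circ_int (absdisc h) r2.
Proof.
move=> hh r10; rewrite le_eqVlt => /predU1P[->//|r12] r21.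
have r20 := le_lt_trans r10 r12.
rewrite -{1}(divfK (lt0r_neq0 r20) r1); apply: circ_int_shrink => //.
  by rewrite r21 ltW.
by rewrite divr_ge0 ?(ltW r20)//= ltr_pdivrMr// mul1r.
Qed.

Lemma integral_absdisc h : hol 1 h ->
  \int[mu2]_p absdisc h p = \int[mu]_(r in `[0%R, 1%R[) ((2 * r)%:E * circ_int (absdisc h) r).
Proof.
move=> hh; have mH := measurable_absdisc hh; have H0 := absdisc_ge0 h.
have m1 : measurable_fun setT (fun x : R => (\1_(`]-oo, 1%R[%classic) x : R)%:E).
  by apply/measurable_EFinP; exact: measurable_indic.
have -> : \int[mu2]_p absdisc h p =
    \int[mu2]_p ((\1_(`]-oo, 1%R[%classic) (cxnorm p) : R)%:E * absdisc h p).
  apply: eq_integral => p _; rewrite indicE mem_setE in_itv/= /absdisc.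
  by case: ifP; rewrite ?mul1e// mule0.
rewrite (integral_polar m1 _ mH H0) => [|x]; last by rewrite lee_fin.
rewrite [LHS]integral_mkcond [RHS]integral_mkcond; apply: eq_integral => r _.
rewrite !patchE indicE !mem_setE !in_itv/= andbT.
have [r0/=|//] := leP 0%R r; have [r1|_] := ltP r 1%R; last by rewrite mule0 mul0e.
by rewrite mule1.
Qed.

Lemma integral_2r : \int[mu]_(r in `[0%R, 1%R[) (2 * r)%:E = 1.
Proof.
have dphi (t : R) : (0 <= t <= 1)%R -> is_derive t 1%R (fun x : R => x ^+ 2)%R (2 * t)%R.
  by move=> _; apply: is_derive_eq; rewrite /GRing.scale /=; ring.
have c2 : {within `[0%R, 1%R], continuous (fun r : R => 2 * r)%R}.
  by apply: continuous_subspaceT => x; apply: cvgM; [exact: cvg_cst|exact: cvg_id].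
rewrite integral_itv_bndo_bndc; last first.
  by apply/measurable_EFinP; apply: measurable_funM.
by rewrite (integral_FTC ler01 dphi c2) expr0n expr1n subr0.
Qed.

(** The sub-mean value inequality for [|h|] at the centre: the circular means are minimal at radius
    0, and [2 r dr] has mass 1 on [[0, 1[]. *)
Lemma circ_int0_le h : hol 1 h -> circ_int (absdisc h) 0%R <= \int[mu2]_p absdisc h p.
Proof.
move=> hh; rewrite integral_absdisc// -[leLHS]mul1e -integral_2r.
have mH := measurable_absdisc hh; have H0 := absdisc_ge0 h.
have m2 : measurable_fun setT (fun r : R => (2 * r)%:E).
  by apply/measurable_EFinP; apply: measurable_funM.
have mono (r : R) : (0 <= r < 1)%R -> circ_int (absdisc h) 0%R <= circ_int (absdisc h) r.
  by move=> /andP[r0 r1]; exact: circ_int_mono.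
have c0 := circ_int_ge0 0%R H0; have cr0 r := circ_int_ge0 r H0.
have mc := measurable_circ_int mH H0.
move: (circ_int (absdisc h)) (circ_int (absdisc h) 0%R) mono c0 cr0 mc => K c mono c0 cr0 mc.
have r20 (r : R) : (0 <= r < 1)%R -> 0 <= (2 * r)%:E.
  by move=> /andP[r0 _]; rewrite lee_fin mulr_ge0.
rewrite -ge0_integralZr//; last exact: measurable_funTS.
apply: ge0_le_integral => //.
- by move=> r; rewrite /= in_itv/= => /r20 h0; rewrite mule_ge0.
- apply: measurable_funTS; exact: emeasurable_funM.
- apply: measurable_funTS; exact: emeasurable_funM.
- by move=> r; rewrite /= in_itv/= => r01; rewrite lee_wpmul2l ?r20 ?mono.
Qed.

(** This is [pi]; it enters the estimates as a positive real [v], as granted by [disc_area_gt0] and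
    [disc_area_lty]. *)
Definition disc_area : \bar R := mu2 [set p | (cxnorm p < 1)%R].

Lemma circ_int_at0 G : circ_int G 0%R = G (0, 0)%R * disc_area.
Proof.
rewrite /circ_int /disc_area -integral_cst; last exact: measurable_cxdisc.
by apply: eq_integral => p _; rewrite !mul0r.
Qed.

Lemma disc_area_gt0 : 0 < disc_area.
Proof.
apply: (@lt_le_trans _ _ (mu2 (`[0%R, (1/2)%R[ `*` `[0%R, (1/2)%R[)%classic)).
  rewrite product_measure1E// [X in X * _]lebesgue_measure_itv [X in _ * X]lebesgue_measure_itv/= lte_fin divr_gt0// -EFinB subr0 -EFinM lte_fin.
  by rewrite mulr_gt0// divr_gt0.
apply: le_measure; rewrite ?inE; [exact: measurableX|exact: measurable_cxdisc|].
move=> p [/=]; rewrite !in_itv/= => /andP[a b] /andP[c d].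
rewrite cxnormE -sqrtr1 ltr_sqrt//; nra.
Qed.

Lemma disc_area_lty : disc_area < +oo.
Proof.
apply: (@le_lt_trans _ _ (mu2 (`[(-1)%R, 1%R] `*` `[(-1)%R, 1%R])%classic)).
  apply: le_measure; rewrite ?inE; [exact: measurable_cxdisc|exact: measurableX|].
  move=> p /= /ltW p1; have h1 := le_trans (cnorm_Re (toC p)) p1.
  have h2 := le_trans (cnorm_Im (toC p)) p1.
  by rewrite /= !in_itv/= -!ler_norml.
rewrite product_measure1E// [X in X * _]lebesgue_measure_itv [X in _ * X]lebesgue_measure_itv/= lte_fin; case: ifP => _.
  by rewrite -EFinB -EFinM ltry.
by rewrite mule0 ltry.
Qed.

End CircleMonotone.

(** * Weights and area norms *)

Section LayerCake.
Variable R : realType.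
Local Open Scope ereal_scope.
Local Notation mu := (@lebesgue_measure R).
Implicit Types (M phi psi : R -> \bar R) (S : set R).

Lemma measurable_bool_set d (T : measurableType d) (b : T -> bool) :
  measurable_fun setT b -> measurable [set x | b x].
Proof.
move=> mb; rewrite (_ : mkset _ = setT `&` b @^-1` [set true]); first exact: mb.
by apply/seteqP; split=> x //= [].
Qed.

Lemma mem_setb T (b : T -> bool) x : (x \in [set x | b x]) = b x.
Proof. by apply/idP/idP; rewrite inE. Qed.

(** A nonempty such [S] is [[a, 1[] or []a, 1[] with [a = inf S], and a single endpoint carries no
    mass. *)
Lemma upset_integral S : measurable S -> S `<=` `[0%R, 1%R[%classic ->
  (forall r1 r2, S r1 -> (r1 <= r2)%R -> (r2 < 1)%R -> S r2) ->
  S = set0 \/ exists2 a : R, (0 <= a < 1)%R & forall phi, measurable_fun setT phi ->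
    (forall x, 0 <= phi x) -> \int[mu]_(r in S) phi r = \int[mu]_(r in `[a, 1%R[) phi r.
Proof.
move=> mS S01 upS; have [->|/set0P[s Ss]] := eqVneq S set0; first by left.
right; have lbS : has_lbound S.
  by exists 0%R => x /S01; rewrite /= in_itv/= => /andP[].
have infS : has_inf S by split=> //; exists s.
have := S01 _ Ss; rewrite /= in_itv/= => /andP[s0 s1].
exists (inf S) => [|phi mphi phi0].
  rewrite lb_le_inf/=; [|by exists s|by move=> x /S01; rewrite /= in_itv/= => /andP[]].
  by apply: le_lt_trans s1; exact: ge_inf.
apply/eqP; rewrite eq_le; apply/andP; split.
  apply: ge0_subset_integral => //; first exact: measurable_funTS.
  move=> x Sx; rewrite /= in_itv/= ge_inf//=.
  by have := S01 _ Sx; rewrite /= in_itv/= => /andP[].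
rewrite -integral_itv_obnd_cbnd; last exact: measurable_funTS.
apply: ge0_subset_integral => //; first exact: measurable_funTS.
move=> x; rewrite /= in_itv/= => /andP[infx x1].
have e0 : (0 < x - inf S)%R by rewrite subr_gt0.
have [y Sy] := inf_adherent e0 infS; rewrite subrKC => yx.
by apply: upS Sy _ x1; exact: ltW.
Qed.

Let lev (m : \bar R) : set R := [set y | (0 <= y)%R && (y%:E < m)].

Lemma integral_levels (m : \bar R) : 0 <= m ->
  \int[mu]_y ((\1_(lev m) y : R)%:E) = m.
Proof.
move=> m0; have step (A : set R) : measurable A -> lev m = A ->
    \int[mu]_y ((\1_(lev m) y : R)%:E) = mu A.
  by move=> mA ->; rewrite integral_indic// setIT.
case: m m0 step => [r| |//] r0 step.
  have levE : lev r%:E = `[0%R, r[%classic.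
    by apply/seteqP; split=> y; rewrite /lev /= in_itv/= lte_fin.
  rewrite (step _ (measurable_itv _) levE).
  rewrite lebesgue_measure_itv/= lte_fin; case: ltP => [_|r0']; first by rewrite oppr0 adde0.
  by congr EFin; apply/eqP; rewrite eq_le -lee_fin r0 r0'.
have levE : lev +oo = `[0%R, +oo[%classic.
  by apply/seteqP; split=> y; rewrite /lev /= in_itv/= ltry.
rewrite (step _ (measurable_itv _) levE).
by rewrite lebesgue_measure_itv/= ltry oppr0 addye.
Qed.

Let slice M phi (p : R * R) : \bar R :=
  (phi \_ `[0%R, 1%R[) p.1 * ((\1_(lev (M p.1)) p.2 : R)%:E).

Let mslice M phi : measurable_fun setT M -> measurable_fun setT phi ->
  measurable_fun setT (slice M phi).
Proof.
move=> mM mphi; apply: emeasurable_funM.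
  apply: measurableT_comp => //; apply/(measurable_restrictT _ _).1 => //.
  exact: measurable_funTS.
apply/measurable_EFinP.
have -> : (fun p : R * R => \1_(lev (M p.1)) p.2 : R) =
    (\1_[set p : R * R | lev (M p.1) p.2]).
  by apply/funext => p; rewrite !indicE; congr (nat_of_bool _)%:R; apply/idP/idP; rewrite !inE.
apply: measurable_indic.
have m1 : measurable_fun setT (fun p : R * R => p.2%:E < M p.1).
  apply: measurable_fun_lte; first exact/measurable_EFinP.
  exact: measurableT_comp mM measurable_fst.
have m2 : measurable_fun setT (fun p : R * R => (0 <= p.2)%R) by exact: measurable_fun_ler.
exact: measurable_bool_set (measurable_and m2 m1).
Qed.

(** Tonelli on the region below the graph of [M]: the vertical section over [r] has length [M r],
    possibly infinite, and the horizontal section at height [y] is a superlevel set. *)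
Lemma layer_cake M phi : measurable_fun setT M -> (forall x, 0 <= M x) ->
  measurable_fun setT phi -> (forall x, 0 <= phi x) ->
  \int[mu]_(r in `[0%R, 1%R[) (phi r * M r) =
  \int[mu]_(y in `[0%R, +oo[) \int[mu]_(r in [set r | (0 <= r < 1)%R && (y%:E < M r)]) phi r.
Proof.
move=> mM M0 mphi phi0.
have s0 p : 0 <= slice M phi p.
  by rewrite /slice mule_ge0 ?lee_fin// patchE; case: ifP.
transitivity (\int[mu]_r \int[mu]_y slice M phi (r, y)).
  rewrite integral_mkcond; apply: eq_integral => r _; rewrite /slice /=.
  have mlev : measurable_fun setT (fun y : R => (\1_(lev (M r)) y : R)%:E).
    apply/measurable_EFinP; apply: measurable_indic.
    have m1 : measurable_fun setT (fun y : R => y%:E < M r).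
      by apply: measurable_fun_lte => //; exact/measurable_EFinP.
    have m2 : measurable_fun setT (fun y : R => (0 <= y)%R) by exact: measurable_fun_ler.
    exact: measurable_bool_set (measurable_and m2 m1).
  have phir0 : 0 <= (phi \_ `[0%R, 1%R[) r by rewrite patchE; case: ifP.
  rewrite ge0_integralZl//.
  by rewrite integral_levels// !patchE; case: ifP => // _; rewrite mul0e.
rewrite -(integral_tonelli1 (mslice mM mphi) s0) (integral_tonelli2 (mslice mM mphi) s0).
rewrite [RHS]integral_mkcond; apply: eq_integral => y _.
rewrite patchE mem_setE in_itv/= andbT; have [y0|y0] := leP 0%R y; last first.
  apply: integral0_eq => r _; rewrite /slice indicE memNset ?mule0//.
  by move=> /andP[]; rewrite leNgt y0.
rewrite [RHS]integral_mkcond; apply: eq_integral => r _; rewrite /slice/= !patchE indicE.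
rewrite /lev !mem_setb in_itv/= y0 /=; case: (_ <= _ < _)%R => /=; last by rewrite mul0e.
by case: (_ < _) => /=; rewrite ?mule1 ?mule0.
Qed.

(** The superlevel sets of a nondecreasing [M] are, up to an endpoint, the intervals [[a, 1[] of the
    tail hypothesis, so the two integrals are compared level by level. *)
Lemma monotone_weight_comparison M phi psi (K : R) :
  measurable_fun setT M -> (forall x, 0 <= M x) ->
  measurable_fun setT phi -> (forall x, 0 <= phi x) ->
  measurable_fun setT psi -> (forall x, 0 <= psi x) -> (0 <= K)%R ->
  (forall r1 r2 : R, (0 <= r1)%R -> (r1 <= r2)%R -> (r2 < 1)%R -> M r1 <= M r2) ->
  (forall r : R, (0 <= r < 1)%R ->
    \int[mu]_(s in `[r, 1%R[) phi s <= K%:E * \int[mu]_(s in `[r, 1%R[) psi s) ->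
  \int[mu]_(r in `[0%R, 1%R[) (phi r * M r) <=
  K%:E * \int[mu]_(r in `[0%R, 1%R[) (psi r * M r).
Proof.
move=> mM M0 mphi phi0 mpsi psi0 K0 Mmono tail.
rewrite !layer_cake//.
pose J (g : R -> \bar R) y := \int[mu]_(r in [set r | (0 <= r < 1)%R && (y%:E < M r)]) g r.
have mS y : measurable [set r | (0 <= r < 1)%R && (y%:E < M r)].
  have m1 : measurable_fun setT (fun r : R => y%:E < M r) by exact: measurable_fun_lte.
  have m2 : measurable_fun setT (fun r : R => (0 <= r < 1)%R).
    by apply: measurable_and; [exact: measurable_fun_ler|exact: measurable_fun_ltr].
  exact: measurable_bool_set (measurable_and m2 m1).
have mJ (g : R -> \bar R) : measurable_fun setT g -> (forall x, 0 <= g x) ->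
      measurable_fun (`[0%R, +oo[%classic : set R) (J g).
  move=> mg g0; have s0 p : 0 <= slice M g p.
    by rewrite /slice mule_ge0 ?lee_fin// patchE; case: ifP.
  have := measurable_funTS (D := (`[0%R, +oo[%classic : set R)) (measurable_integral_snd (mslice mM mg) s0).
  apply: eq_measurable_fun => y; rewrite inE/= in_itv/= andbT => y0.
  rewrite /J [RHS]integral_mkcond; apply: eq_integral => r _; rewrite /slice/= !patchE indicE.
  rewrite /lev !mem_setb in_itv/= y0 /=; case: (_ <= _ < _)%R => /=; last by rewrite mul0e.
  by case: (_ < _) => /=; rewrite ?mule1 ?mule0.
rewrite -ge0_integralZl_EFin//; last 2 first.
- by move=> y _; exact: integral_ge0.
- exact: mJ.
apply: ge0_le_integral => //.
- by move=> y _; exact: integral_ge0.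
- exact: mJ.
- by apply: measurable_funeM; exact: mJ.
move=> y _; have [|||->|[a a01 aE]] := @upset_integral [set r | (0 <= r < 1)%R && (y%:E < M r)].
- exact: mS.
- by move=> r /= /andP[r01 _]; rewrite in_itv.
- move=> r1 r2 /= /andP[/andP[r10 r11] yM] r12 r21.
  by rewrite (le_trans r10 r12) r21 (lt_le_trans yM)// Mmono.
- by rewrite !integral_set0 mule0.
- by rewrite !aE//; exact: tail.
Qed.

End LayerCake.

(** * The norm in polar coordinates and a radial Carleson estimate *)

Section WeightedNorm.
Variable R : realType.
Local Open Scope ereal_scope.
Local Notation mu := (@lebesgue_measure R).
Local Notation mu2 := (mu \x mu).
Local Notation C := (complex R).
Implicit Types (w : R -> R) (h f : C -> C).

(** The weight is controlled only on [[0, 1[]; cut off there, it is nonnegative and measurable on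
    the whole line. *)
Definition wt w (x : R) : \bar R := if (0 <= x < 1)%R then (w x)%:E else 0.

Lemma wt_ge0 w x : radial_weight w -> 0 <= wt w x.
Proof. by move=> [w0 _]; rewrite /wt; case: ifP => // /w0; rewrite lee_fin. Qed.

Lemma measurable_wt w : radial_weight w -> measurable_fun setT (wt w).
Proof.
move=> [_ /integrableP[mw _]].
have := (measurable_restrictT (EFin \o w) (measurable_itv `[0%R, 1%R[)).1 mw.
by apply: eq_measurable_fun => x _; rewrite patchE mem_setb in_itv.
Qed.

Lemma radial_weight_one : radial_weight (@one_weight R).
Proof.
split=> [s _|]; first exact: ler01.
apply: (@eq_integrable _ _ _ mu _ _ (cst 1)) => //.
apply/integrableP; split=> //; under eq_integral do rewrite abse1.
by rewrite integral_cst//= lebesgue_measure_itv/= lte_fin ltr01 oppr0 adde0 mule1 ltry.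
Qed.

Lemma eq_integral_wt w (D : set R) (k : R -> \bar R) : D `<=` `[0%R, 1%R[%classic ->
  \int[mu]_(s in D) (k s * (w s)%:E) = \int[mu]_(s in D) (k s * wt w s).
Proof.
move=> D01; apply: eq_integral => s; rewrite inE => /D01; rewrite /= in_itv/= /wt => s01.
by rewrite ifT.
Qed.

Lemma omega_hat_wt w r : radial_weight w -> (0 <= r < 1)%R ->
  (omega_hat w r)%:E = \int[mu]_(s in `[r, 1%R[) wt w s.
Proof.
move=> [_ wi] /andP[r0 r1]; have sub : `[r, 1%R[ `<=` `[0%R, 1%R[%classic.
  by apply: subset_itvr; rewrite bnd_simp.
rewrite /omega_hat /Rintegral fineK.
  have := @eq_integral_wt w _ (cst 1) sub; rewrite /=.
  by under eq_integral do rewrite mul1e; move=> ->; under eq_integral do rewrite mul1e.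
by apply: integrable_fin_num => //; exact: integrableS wi.
Qed.

Lemma moment_wt w n : radial_weight w ->
  (moment w n)%:E = \int[mu]_(s in `[0%R, 1%R[) ((s ^+ n)%:E * wt w s).
Proof.
move=> hw; have [w0 wi] := hw; rewrite /moment /Rintegral fineK.
  by rewrite -(@eq_integral_wt w)//; under eq_integral do rewrite EFinM.
apply: integrable_fin_num => //; apply: le_integrable wi => //.
  apply/measurable_EFinP; apply: measurable_funM; first exact: measurable_funX.
  by case: hw => _ /integrableP[/measurable_EFinP].
move=> s; rewrite /= in_itv/= => /andP[s0 s1]; rewrite lee_fin normrM.
by rewrite ler_piMl// ger0_norm ?exprn_ge0// exprn_ile1// ltW.
Qed.

Definition disc_int w h : \bar R := \int[mu2]_p (wt w (cxnorm p) * absdisc h p).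

Lemma disc_int_ge0 w h : radial_weight w -> 0 <= disc_int w h.
Proof. by move=> hw; apply: integral_ge0 => p _; rewrite mule_ge0 ?wt_ge0 ?absdisc_ge0. Qed.

Lemma D1_normE w f (f' : C -> C) : D1_norm w f f' = (pi^-1)%:E * disc_int w f' + (cnorm (f 0))%:E.
Proof.
rewrite /D1_norm /area_int; congr (_ * _ + _).
rewrite integral_mkcond; apply: eq_integral => p _.
rewrite patchE (_ : (p \in _) = (cxnorm p < 1)%R); last by apply/idP/idP; rewrite inE.
rewrite /absdisc /wt -/(toC p) -/(cxnorm p) cxnorm_ge0/=.
by case: ifP; rewrite ?mule0// -EFinM mulrC.
Qed.

Lemma disc_int_one h : disc_int (@one_weight R) h = \int[mu2]_p absdisc h p.
Proof.
apply: eq_integral => p _; rewrite /wt cxnorm_ge0/= /absdisc.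
by case: ifP => _; rewrite ?mul1e ?mule0.
Qed.

(** The absolute value of [r] keeps the factor next to the weight nonnegative on the whole line, as
    [monotone_weight_comparison] asks of its [M]. *)
Lemma disc_int_polar w h : radial_weight w -> hol 1 h ->
  disc_int w h = \int[mu]_(r in `[0%R, 1%R[) (wt w r * ((2 * `|r|)%:E * circ_int (absdisc h) r)).
Proof.
move=> hw hh; have mH := measurable_absdisc hh; have H0 := absdisc_ge0 h.
rewrite /disc_int (integral_polar (measurable_wt hw) _ mH H0) => [|x]; last exact: wt_ge0.
rewrite [LHS]integral_mkcond [RHS]integral_mkcond; apply: eq_integral => r _.
rewrite !patchE !mem_setb !in_itv/= andbT /wt.
have [r0/=|//] := leP 0%R r; rewrite (ger0_norm r0).
by case: ifP => _; rewrite ?mule0 ?mul0e// muleCA muleA.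
Qed.

Lemma integral_wt_one (r : R) : (0 <= r < 1)%R ->
  \int[mu]_(s in `[r, 1%R[) wt (@one_weight R) s = (1 - r)%:E.
Proof.
move=> r01; have /andP[r0 r1] := r01; rewrite -(omega_hat_wt radial_weight_one r01).
rewrite /omega_hat /Rintegral -[X in fine X]/(\int[mu]_(s in `[r, 1%R[) cst 1 s).
by rewrite integral_cst//= mul1e lebesgue_measure_itv/= lte_fin r1.
Qed.

Lemma tail_bound_id_bounded w (K : R) : radial_weight w ->
  (forall r, 0 <= r < 1 -> 1 - r <= K * omega_hat w r)%R -> id_D1_bounded w.
Proof.
(* [K1] exceeds 1 so that it also absorbs the term [|f(0)|]. *)
move=> hw tail; pose K1 := (`|K| + 1)%R; have K10 : (0 <= K1)%R by rewrite addr_ge0.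
exists K1 => f f' [df _].
have hf' : hol 1 f' := hol_deriv df.
have mH := measurable_absdisc hf'; have H0 := absdisc_ge0 f'.
have h1 := radial_weight_one.
rewrite !D1_normE.
have key : disc_int (@one_weight R) f' <= K1%:E * disc_int w f'.
  rewrite !disc_int_polar//; apply: monotone_weight_comparison => //.
  - apply: emeasurable_funM; last exact: measurable_circ_int.
    by apply/measurable_EFinP; apply: measurable_funM => //; exact: normr_measurable.
  - by move=> x; rewrite mule_ge0 ?circ_int_ge0// lee_fin mulr_ge0.
  - exact: measurable_wt.
  - by move=> x; exact: wt_ge0.
  - exact: measurable_wt.
  - by move=> x; exact: wt_ge0.
  - move=> r1 r2 r10 r12 r21; apply: lee_pmul.
    + by rewrite lee_fin mulr_ge0.
    + exact: circ_int_ge0.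
    + by rewrite lee_fin ler_pM2l// !ger0_norm// (le_trans r10).
    + exact: circ_int_mono.
  - move=> r r01; rewrite integral_wt_one// -omega_hat_wt// -EFinM lee_fin.
    have w0 : (0 <= omega_hat w r)%R.
      by rewrite -lee_fin omega_hat_wt//; apply: integral_ge0 => s _; exact: wt_ge0.
    apply: (le_trans (tail _ r01)); rewrite ler_wpM2r// (le_trans (ler_norm _))//.
    by rewrite lerDl.
have A0 : 0 <= (pi^-1)%:E * disc_int w f'.
  by rewrite mule_ge0 ?disc_int_ge0// lee_fin invr_ge0 pi_ge0.
have B0 : 0 <= (cnorm (f 0%R))%:E by rewrite lee_fin cnorm_ge0.
rewrite (ge0_muleDr _ A0 B0); apply: leeD.
  rewrite muleCA; apply: lee_wpmul2l => //; by rewrite lee_fin invr_ge0 pi_ge0.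
by rewrite -EFinM lee_fin ler_peMl ?cnorm_ge0// lerDr.
Qed.

Lemma integral_absdisc_rotation (e : C) h : cnorm e = 1%R -> hol 1 h ->
  \int[mu2]_p absdisc (fun z => h (e * z)%R) p = \int[mu2]_p absdisc h p.
Proof.
move=> e1 hh; rewrite -(integral_cxmul e1 (measurable_absdisc hh) (absdisc_ge0 h)).
by apply: eq_integral => p _; rewrite /absdisc /cxnorm toC_cxmul cnormM e1 mul1r.
Qed.

(** For each [s] the mean value inequality on the disc of centre [s] and radius [(1 - s)/2] is used,
    the disc being enlarged to a vertical strip. The constant 8 is a product of three factors 2: the
    ratio of [1 - s] to the radius, the inverse slope of [s -> s + (1 - s) x/2], which is at most 2,
    and the length of []-1, 1[] where [x] ranges. *)
Lemma radial_carleson_real h : hol 1 h ->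
  disc_area R * \int[mu]_(s in `[0%R, 1%R[) ((1 - s) * cnorm (h s%:C%C))%:E <=
  8%:E * \int[mu2]_p absdisc h p.
Proof.
move=> hh; set H := absdisc h; have mH : measurable_fun setT H := measurable_absdisc hh.
have H0 p : 0 <= H p := absdisc_ge0 h p.
pose k (a : R) : \bar R := \int[mu]_y H (a, y).
have mk : measurable_fun setT k by exact: measurable_integral_fst.
have k0 a : 0 <= k a by exact: integral_ge0.
pose ind (x : R) : R := \1_(`](-1)%R, 1%R[%classic) x.
have mind : measurable_fun setT (fun x : R => (ind x)%:E).
  by apply/measurable_EFinP; exact: measurable_indic.
have ind0 x : 0 <= (ind x)%:E by rewrite lee_fin.
pose L (q : R * R) : \bar R := (ind q.2)%:E * (2%:E * k (q.1 + (1 - q.1) * (q.2 / 2))%R).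
have L0 q : 0 <= L q by rewrite !mule_ge0.
have mL : measurable_fun setT L.
  apply: emeasurable_funM; first exact: measurableT_comp mind measurable_snd.
  apply: measurable_funeM; apply: (measurableT_comp mk).
  apply: measurable_funD => //; apply: measurable_funM; last exact: measurable_funM.
  exact: measurable_funB.
have stepx (s x : R) : (0 <= s < 1)%R -> \int[mu]_y ((1 - s)%:E *
    H (s + (1 - s) * (x / 2), (1 - s) / 2 * y)%R) = 2%:E * k (s + (1 - s) * (x / 2))%R.
  move=> /andP[s0 s1]; have c0 : ((1 - s) / 2 != 0)%R by rewrite gt_eqF// divr_gt0// subr_gt0.
  have mHa := measurable_fun_pair2 (s + (1 - s) * (x / 2))%R mH.
  have := @integral_affine R (fun y => H (s + (1 - s) * (x / 2), y)%R) _ 0%R c0 mHa (fun y => H0 _).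
  under eq_integral do rewrite addr0.
  rewrite ge0_integralZl_EFin//; last 2 first.
  - have := measurableT_comp mHa (measurable_affine ((1 - s) / 2)%R 0%R).
    by apply: eq_measurable_fun => y _ /=; rewrite addr0.
  - by rewrite subr_ge0 ltW.
  move=> ->; rewrite muleA -EFinM; congr (_%:E * _).
  rewrite gtr0_norm ?divr_gt0 ?subr_gt0//; field.
  by rewrite gt_eqF// subr_gt0.
have pointwise (s : R) : (0 <= s < 1)%R ->
    disc_area R * ((1 - s) * cnorm (h s%:C%C))%:E <= \int[mu]_x L (s, x).
  move=> s01; have /andP[s0 s1] := s01.
  pose g (v : C) := h ((s%:C%C : C) + ((1 - s) / 2)%:C%C * v)%R.
  have c0 : (0 < (1 - s) / 2)%R by rewrite divr_gt0// subr_gt0.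
  have hg : hol 1 g.
    apply: hol_shift hh _ _; last by rewrite -cnorm_gt0 cnorm_real gtr0_norm.
    by rewrite !cnorm_real (ger0_norm s0) gtr0_norm// mulr1; lra.
  have := circ_int0_le hg; rewrite circ_int_at0 absdiscE; last first.
    by rewrite cxnormE /= expr0n addr0 sqrtr0.
  have -> : toC (0, 0)%R = 0%R :> C by [].
  rewrite {1}/g mulr0 addr0 => le.
  have s1' : 0 <= (1 - s)%:E by rewrite lee_fin subr_ge0 ltW.
  have mg := measurable_absdisc hg; have g0 := absdisc_ge0 g.
  rewrite EFinM muleCA (muleC (disc_area R)).
  apply: (le_trans (lee_wpmul2l s1' le)); rewrite -ge0_integralZl//.
  pose Q (p : R * R) : \bar R := (ind p.1)%:E *
    ((1 - s)%:E * H (s + (1 - s) * (p.1 / 2), (1 - s) / 2 * p.2)%R).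
  have mHQ : measurable_fun setT (fun p : R * R =>
      H (s + (1 - s) * (p.1 / 2), (1 - s) / 2 * p.2)%R).
    apply: measurable_fun_prod2 => //; last exact: measurable_funM.
    by apply: measurable_funD => //; apply: measurable_funM => //; exact: measurable_funM.
  have mQ : measurable_fun setT Q.
    apply: emeasurable_funM; first exact: measurableT_comp mind measurable_fst.
    exact: measurable_funeM.
  have Q0 p : 0 <= Q p by rewrite !mule_ge0.
  apply: (@le_trans _ _ (\int[mu2]_p Q p)).
    apply: ge0_le_integral => //.
    - by move=> p _; rewrite mule_ge0.
    - exact: measurable_funeM.
    move=> p _; rewrite {1}/absdisc; case: ifPn => [p1|_]; last by rewrite mule0.
    have px : ind p.1 = 1%R.
      rewrite /ind indicE mem_set//= in_itv/= -ltr_norml.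
      by apply: le_lt_trans p1; exact: (cnorm_Re (toC p)).
    have qE : toC (s + (1 - s) * (p.1 / 2), (1 - s) / 2 * p.2)%R =
        (s%:C%C + ((1 - s) / 2)%:C%C * toC p)%R.
      by rewrite /toC /=; simpc; congr (_ +i* _)%C; ring.
    rewrite /Q px mul1e /H absdiscE; first by rewrite qE.
    rewrite /cxnorm qE (le_lt_trans (cnormD _ _))// cnormM !cnorm_real (ger0_norm s0) gtr0_norm//.
    by have := cnorm_ge0 (toC p); move: p1; rewrite /cxnorm => p1 pp; nra.
  rewrite (integral_tonelli1 mQ Q0) le_eqVlt; apply/orP; left; apply/eqP.
  apply: eq_integral => x _; rewrite /L /= -stepx// /Q /=.
  rewrite ge0_integralZl//; last by move=> y _; rewrite mule_ge0.
  apply: measurable_funeM; exact: (measurable_fun_pair2 x mHQ).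
have mh : measurable_fun (`[0%R, 1%R[%classic : set R) (fun s : R => ((1 - s) * cnorm (h s%:C%C))%:E).
  have m1 : measurable_fun setT (fun s : R => (1 - s)%:E * H (s, 0)%R).
    apply: emeasurable_funM; last exact: measurable_fun_pair1 mH.
    by apply/measurable_EFinP; exact: measurable_funB.
  have := measurable_funTS (D := (`[0%R, 1%R[%classic : set R)) m1.
  apply: eq_measurable_fun => s; rewrite inE/= in_itv/= => /andP[s0 s1].
  rewrite /H absdiscE; first by rewrite EFinM.
  by rewrite cxnormE /= expr0n addr0 sqrtr_sqr ger0_norm.
have mLint := measurable_integral_fst mL L0.
rewrite -ge0_integralZl//; last first.
  move=> s; rewrite /= in_itv/= => /andP[s0 s1].
  by rewrite lee_fin mulr_ge0 ?cnorm_ge0// subr_ge0 ltW.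
apply: (@le_trans _ _ (\int[mu]_(s in `[0%R, 1%R[) \int[mu]_x L (s, x))).
  apply: ge0_le_integral => //.
  - move=> s; rewrite /= in_itv/= => /andP[s0 s1]; rewrite mule_ge0 ?(ltW (disc_area_gt0 R))//.
    by rewrite lee_fin mulr_ge0 ?cnorm_ge0// subr_ge0 ltW.
  - exact: measurable_funeM.
  - exact: measurable_funTS.
apply: (@le_trans _ _ (\int[mu]_s \int[mu]_x L (s, x))).
  apply: ge0_subset_integral => //.
  by move=> s _; exact: integral_ge0.
rewrite -(integral_tonelli1 mL L0) (integral_tonelli2 mL L0).
have IE : \int[mu2]_p H p = \int[mu]_a k a by exact: integral_tonelli1.
rewrite IE; set I := \int[mu]_a k a.
have I0 : 0 <= I by exact: integral_ge0.
apply: (@le_trans _ _ (\int[mu]_x ((ind x)%:E * (4%:E * I)))).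
  apply: ge0_le_integral; [exact: measurableT|by move=> x _; apply: integral_ge0|
    exact: measurable_integral_snd mL L0|exact: emeasurable_funM mind (measurable_cst _)|].
  move=> x _; rewrite /L /= ge0_integralZl//; last 2 first.
  - apply: measurable_funeM; apply: (measurableT_comp mk).
    apply: measurable_funD => //; apply: measurable_funM => //; exact: measurable_funB.
  - by move=> s _; rewrite mule_ge0.
  rewrite /ind indicE; case: (boolP (x \in _)); last by rewrite !mul0e.
  rewrite inE /= in_itv/= !mul1e => /andP[x1 x2].
  have a0 : (0 < 1 - x / 2)%R by lra.
  have aE : (fun s : R => 2%:E * k (s + (1 - s) * (x / 2))%R) =
      (fun s : R => 2%:E * k ((1 - x / 2) * s + x / 2)%R).
    by apply/funext => s; congr (_ * k _); ring.
  have mka : measurable_fun setT (fun s : R => k ((1 - x / 2) * s + x / 2)%R).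
    exact: measurableT_comp mk (measurable_affine (1 - x / 2)%R (x / 2)%R).
  rewrite aE (ge0_integralZl_EFin mu measurableT (fun s _ => k0 _) mka (ler0n R 2)).
  rewrite integral_affine ?gt_eqF// muleA -EFinM; apply: lee_wpmul2r => //.
  rewrite lee_fin gtr0_norm// ler_pdivrMr//; lra.
rewrite ge0_integralZr//; last by rewrite mule_ge0.
rewrite integral_indic//= setIT lebesgue_measure_itv/= lte_fin; case: ifP => _.
  by rewrite -EFinB muleA -EFinM; apply: lee_wpmul2r => //; rewrite lee_fin; lra.
by rewrite mul0e mule_ge0.
Qed.

Lemma radial_carleson (e : C) h : cnorm e = 1%R -> hol 1 h ->
  disc_area R * \int[mu]_(s in `[0%R, 1%R[) ((1 - s) * cnorm (h (s%:C%C * e)%R))%:E <=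
  8%:E * \int[mu2]_p absdisc h p.
Proof.
move=> e1 hh; rewrite -(integral_absdisc_rotation e1 hh).
have he : hol 1 (fun z => h (e * z)%R).
  move=> z z1; have [|d Hd] := hh (e * z)%R; first by rewrite cnormM e1 mul1r.
  by exists (d * e)%R; exact: has_cderiv_scale.
have := radial_carleson_real he; apply: le_trans.
by rewrite le_eqVlt; apply/orP; left; apply/eqP; congr (_ * _); apply: eq_integral => s _; rewrite (mulrC e).
Qed.

Lemma D1_norm_ge0 w f (f' : C -> C) : radial_weight w -> 0 <= D1_norm w f f'.
Proof.
move=> hw; rewrite D1_normE adde_ge0 ?lee_fin ?cnorm_ge0// mule_ge0 ?disc_int_ge0//.
by rewrite lee_fin invr_ge0 pi_ge0.
Qed.

Lemma id_bounded_symbol_id w : radial_weight w -> id_D1_bounded w -> in_T_D1_Hinf w id (fun=> 1%R).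
Proof.
move=> hw [K HK]; split; first by move=> z _; exact: has_cderiv_id.
have [v v0 vE] : exists2 v : R, (0 < v)%R & disc_area R = v%:E.
  have := disc_area_gt0 R; have := disc_area_lty R; case: (disc_area R) => // v _ v0.
  by exists v.
pose c := (8 / v)%R; have c0 : (0 <= c)%R by rewrite divr_ge0// ltW.
(* The norm carries the area integral with the factor [pi^-1], so [b] is [c] multiplied by [pi]. *)
have [b b0 bE] : exists2 b : R, (0 <= b)%R & (b * pi^-1 = c)%R.
  exists (c * pi)%R; first by rewrite mulr_ge0// pi_ge0.
  by rewrite mulfK// gt_eqF// pi_gt0.
exists ((1 + b) * `|K|)%R => f f' fD z dz; have [df fin] := fD.
have hf' : hol 1 f' := hol_deriv df.
apply: (le_trans (Tg_identity_bound df dz)).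
set I := \int[mu2]_p absdisc f' p.
have I0 : 0 <= I by apply: integral_ge0 => p _; exact: absdisc_ge0.
apply: (@le_trans _ _ ((cnorm (f 0))%:E + c%:E * I)).
  rewrite leeD2l//; have [z0|z0] := eqVneq z 0%R.
    rewrite z0 cnorm0 set_itv1 integral_set1 mule_ge0//.
  have e1 : cnorm (z / (cnorm z)%:C%C)%R = 1%R.
    have z1 : (0 < cnorm z)%R by rewrite cnorm_gt0.
    by rewrite cnormM cnormV cnorm_real gtr0_norm// mulfV// gt_eqF.
  have := radial_carleson e1 hf'; rewrite vE -/I => le.
  apply: (@le_trans _ _ (\int[mu]_(s in `[0%R, 1%R[)
      ((1 - s) * cnorm (f' (s%:C%C * (z / (cnorm z)%:C%C))%R))%:E)).
    apply: ge0_subset_integral => //.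
    - have mH := measurable_absdisc hf'.
      set e := (z / _)%R in e1 *.
      have m1 : measurable_fun setT (fun s : R => (1 - s)%:E *
          absdisc f' (complex.Re e * s, complex.Im e * s)%R).
        apply: emeasurable_funM; first by apply/measurable_EFinP; exact: measurable_funB.
        by apply: (measurableT_comp mH); apply: measurable_fun_pair; exact: measurable_funM.
      have := measurable_funTS (D := (`[0%R, 1%R[%classic : set R)) m1.
      apply: eq_measurable_fun => s; rewrite inE/= in_itv/= => /andP[s0 s1].
      have tE : toC (complex.Re e * s, complex.Im e * s)%R = (s%:C%C * e)%R.
        by case: (e) => x y; rewrite /toC /=; simpc; congr (_ +i* _)%C; ring.
      rewrite absdiscE /cxnorm tE ?EFinM//.
      by rewrite cnormM e1 mulr1 cnorm_real ger0_norm.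
    - move=> s; rewrite /= in_itv/= => /andP[s0 s1].
      by rewrite lee_fin mulr_ge0 ?cnorm_ge0// subr_ge0 ltW.
    - move=> s; rewrite /= !in_itv/= => /andP[-> s1] /=; exact: le_lt_trans dz.
  move: le; set J := \int[mu]_(s in _) _ => le.
  have : (v^-1)%:E * (v%:E * J) <= (v^-1)%:E * (8%:E * I).
    by apply: lee_wpmul2l => //; rewrite lee_fin invr_ge0 ltW.
  by rewrite !muleA -!EFinM mulVf ?gt_eqF// mul1e mulrC.
have h1 := radial_weight_one.
apply: (@le_trans _ _ ((1 + b)%:E * D1_norm (@one_weight R) f f')).
  have A0 : 0 <= (pi^-1)%:E * I by rewrite mule_ge0// lee_fin invr_ge0 pi_ge0.
  have B0 : 0 <= (cnorm (f 0%R))%:E by rewrite lee_fin cnorm_ge0.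
  rewrite D1_normE disc_int_one -/I (ge0_muleDr _ A0 B0).
  rewrite addeC; apply: leeD.
    rewrite muleA -EFinM; apply: lee_wpmul2r => //; rewrite lee_fin -bE.
    by rewrite ler_wpM2r ?invr_ge0 ?pi_ge0// lerDr.
  by rewrite -EFinM lee_fin ler_peMl ?cnorm_ge0// lerDl.
rewrite EFinM -muleA; apply: lee_wpmul2l; first by rewrite lee_fin addr_ge0.
apply: (le_trans (HK _ _ fD)).
by apply: lee_wpmul2r; [exact: D1_norm_ge0|rewrite lee_fin ler_norm].
Qed.

End WeightedNorm.

(** * Moments *)

Section Moments.
Variable R : realType.
Local Notation mu := (@lebesgue_measure R).
Implicit Types (w : R -> R) (r t : R).

Lemma bernoulli_ge t n : 0 <= t -> 1 + n%:R * t <= (1 + t) ^+ n.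
Proof.
move=> t0; elim: n => [|n ih]; first by rewrite mul0r addr0 expr0.
rewrite exprS; apply: le_trans (ler_wpM2l _ ih); last by rewrite addr_ge0.
rewrite -natr1; have : 0 <= n%:R * t ^+ 2 :> R by rewrite mulr_ge0// sqr_ge0.
by rewrite expr2; lra.
Qed.

Lemma bernoulli_le t n : 0 <= t <= 1 -> 1 - n%:R * t <= (1 - t) ^+ n.
Proof.
move=> /andP[t0 t1]; elim: n => [|n ih]; first by rewrite mul0r subr0 expr0.
rewrite exprS; apply: le_trans (ler_wpM2l _ ih); last by rewrite subr_ge0.
rewrite -natr1; have : 0 <= n%:R * t ^+ 2 :> R by rewrite mulr_ge0// sqr_ge0.
by rewrite expr2; lra.
Qed.

Lemma exprB_le_inv t n : 0 <= t <= 1 -> (1 - t) ^+ n <= (1 + n%:R * t)^-1.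
Proof.
move=> /andP[t0 t1]; have nt : 0 < 1 + n%:R * t by rewrite ltr_pwDl// mulr_ge0.
rewrite -[leRHS]div1r ler_pdivlMr//.
have P0 : 0 <= (1 - t) ^+ n by rewrite exprn_ge0// subr_ge0.
apply: (le_trans (ler_wpM2l P0 (bernoulli_ge n t0))); rewrite -exprMn exprn_ile1//; nra.
Qed.

Variable w : R -> R.
Hypothesis hw : radial_weight w.
Hypothesis hpos : forall r, 0 <= r < 1 -> 0 < omega_hat w r.

Let mwt := measurable_wt hw.
Let wt0 x := wt_ge0 x hw.

Lemma omega_hat_nincr r t : 0 <= r -> r <= t -> t < 1 -> omega_hat w t <= omega_hat w r.
Proof.
move=> r0 rt t1; rewrite -lee_fin !omega_hat_wt ?r0 ?(le_lt_trans rt)// ?(le_trans r0)//.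
apply: ge0_subset_integral => //; first exact: measurable_funTS.
by apply: subset_itvr; rewrite bnd_simp.
Qed.

Let mpow n : measurable_fun setT (fun s : R => ((s ^+ n)%:E * wt w s)%E).
Proof.
by apply: emeasurable_funM => //; apply/measurable_EFinP; exact: measurable_funX.
Qed.

Let pow0 n s : 0 <= s -> (0 <= (s ^+ n)%:E * wt w s)%E.
Proof. by move=> s0; rewrite mule_ge0// lee_fin exprn_ge0. Qed.

Let pow0i n r b s : 0 <= r -> s \in `[r, b[ -> (0 <= (s ^+ n)%:E * wt w s)%E.
Proof. by move=> r0; rewrite in_itv/= => /andP[rs _]; exact/pow0/(le_trans r0). Qed.

Lemma moment_nincr m n : (m <= n)%N -> moment w n <= moment w m.
Proof.
move=> mn; rewrite -lee_fin !moment_wt//; apply: ge0_le_integral => //.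
- by move=> s /=; exact: pow0i.
- by apply: measurable_funTS; exact: mpow.
- by apply: measurable_funTS; exact: mpow.
- move=> s; rewrite /= in_itv/= => /andP[s0 s1]; rewrite lee_wpmul2r// lee_fin.
  by rewrite ler_wiXn2l// ltW.
Qed.

Lemma moment_ge_tail r n : 0 <= r < 1 -> r ^+ n * omega_hat w r <= moment w n.
Proof.
move=> /andP[r0 r1]; rewrite -lee_fin EFinM omega_hat_wt ?r0// moment_wt//.
have sub : `[r, 1[ `<=` `[0, 1[%classic by apply: subset_itvr; rewrite bnd_simp.
have mD : measurable (`[r, 1[%classic : set R) by [].
rewrite -(ge0_integralZl_EFin mu mD (fun s _ => wt0 s) (measurable_funTS mwt) (exprn_ge0 n r0)).
apply: (@le_trans _ _ (\int[mu]_(s in `[r, 1%R[) ((s ^+ n)%:E * wt w s))%E).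
  apply: ge0_le_integral => //.
  - by move=> s _; rewrite mule_ge0// lee_fin exprn_ge0.
  - by apply: measurable_funeM; apply: measurable_funTS; exact: mwt.
  - by apply: measurable_funTS; exact: mpow.
  - move=> s; rewrite /= in_itv/= => /andP[rs _]; rewrite lee_wpmul2r// lee_fin.
    by rewrite lerXn2r// nnegrE// (le_trans r0).
apply: ge0_subset_integral => //; first by apply: measurable_funTS; exact: mpow.
by move=> s /=; exact: pow0i.
Qed.

Lemma moment_gt0 n : 0 < moment w n.
Proof.
have h : 0 <= (1 / 2 : R) < 1 by lra.
apply: lt_le_trans (moment_ge_tail n h); by rewrite mulr_gt0 ?hpos.
Qed.

(** Split at [r]: [s^(2n) <= r^n s^n] below it and [s^(2n) <= 1] above it. *)
Lemma moment_double r n : 0 <= r < 1 ->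
  moment w (2 * n) <= r ^+ n * moment w n + omega_hat w r.
Proof.
move=> r01; have /andP[r0 r1] := r01.
rewrite -lee_fin EFinD EFinM (omega_hat_wt hw r01) (moment_wt (2 * n) hw) (moment_wt n hw).
have sub1 : `[0, r[ `<=` `[0, 1[%classic.
  by apply: subset_itvl; rewrite bnd_simp ltW.
have sub2 : `[r, 1[ `<=` `[0, 1[%classic by apply: subset_itvr; rewrite bnd_simp.
have E : `[0, 1[%classic = (`[0, r[ `|` `[r, 1[)%classic :> set R.
  by rewrite -itv_bndbnd_setU// bnd_simp// ltW.
rewrite {1}E ge0_integral_setU//=; last 3 first.
- by apply: measurable_funTS; exact: mpow.
- by move=> s /= [] hs; [exact: pow0i (lexx 0) hs|exact: pow0i r0 hs].
- apply/disj_setPS => s [/=]; rewrite !in_itv/= => /andP[_ sr] /andP[rs _].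
  by have := lt_le_trans sr rs; rewrite ltxx.
apply: leeD.
  rewrite -ge0_integralZl_EFin ?exprn_ge0//; last 2 first.
  - by move=> s /=; exact: pow0i.
  - by apply: measurable_funTS; exact: mpow.
  apply: (@le_trans _ _ (\int[mu]_(s in `[0%R, r[) ((r ^+ n)%:E * ((s ^+ n)%:E * wt w s)))%E).
    apply: ge0_le_integral => //.
    - by move=> s /=; exact: pow0i.
    - by apply: measurable_funTS; exact: mpow.
    - by apply: measurable_funeM; apply: measurable_funTS; exact: mpow.
    - move=> s; rewrite /= in_itv/= => /andP[s0 sr]; rewrite muleA -EFinM lee_wpmul2r// lee_fin.
      by rewrite mul2n -addnn exprD ler_wpM2r ?exprn_ge0// lerXn2r ?nnegrE// ltW.
  apply: ge0_subset_integral => //.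
  - by apply: measurable_funeM; apply: measurable_funTS; exact: mpow.
  - by move=> s s01; rewrite mule_ge0 ?lee_fin ?exprn_ge0//; exact: pow0i s01.
apply: ge0_le_integral => //.
- by move=> s /=; exact: pow0i.
- by apply: measurable_funTS; exact: mpow.
- by apply: measurable_funTS; exact: mwt.
- move=> s; rewrite /= in_itv/= => /andP[rs s1]; have s0 := le_trans r0 rs.
  by rewrite -[leRHS]mul1e lee_wpmul2r// lee_fin exprn_ile1// ltW.
Qed.

Lemma moment_bound_of_tail (K : R) : (forall r, 0 <= r < 1 -> 1 - r <= K * omega_hat w r) ->
  0 < K /\ forall n, 1 <= 4 * K * (n.+1%:R * moment w n).
Proof.
move=> tail; have K0 : 0 < K.
  have h : 0 <= (0 : R) < 1 by lra.
  have := tail _ h; have := hpos h => w0; rewrite subr0 => le.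
  by rewrite -(pmulr_lgt0 _ w0) (lt_le_trans ltr01).
(* At [r = 1 - t] Bernoulli's inequality gives [r^n >= 1/2]; together with [(n + 1) t = 1/2] this
   produces the constant 4. *)
split=> // n; pose t : R := (2 * n.+1%:R)^-1.
have n0 : 0 < n.+1%:R :> R by rewrite ltr0n.
have t0 : 0 < t by rewrite invr_gt0 mulr_gt0.
have tE : n.+1%:R * t = 1 / 2 by rewrite /t; field; rewrite lt0r_neq0.
have t12 : t <= 1 / 2 by rewrite -tE ler_peMl ?ler1n// ltW.
have h : 0 <= 1 - t < 1 by apply/andP; split; lra.
have := moment_ge_tail n h; have := tail _ h.
have h' : 0 <= t <= 1 by apply/andP; split; lra.
have := bernoulli_le n h'; have ntE : n%:R * t <= 1 / 2.
  by rewrite -tE ler_pM2r// ler_nat.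
set W := omega_hat w _; set P := (1 - t) ^+ n; set Mo := moment w n.
move=> P2 tW PW; have W0 : 0 < W by exact: hpos.
have : 1 / 2 * W <= Mo by apply: le_trans PW; rewrite ler_pM2r//; lra.
move=> MW; have : 1 / 2 * t <= K * Mo by nra.
move=> /(ler_wpM2l (ltW n0)); rewrite mulrCA tE; nra.
Qed.

(* With [x j = omega_(2^(l+j))] and [y j = omega_hat (1 - 2^-j)], splitting the moment integral at
   [1 - 2^-(j+1)] gives [x j.+1 <= q * x j + y j.+1], where [q * K <= 1/2] for [l] large, while
   [y j <= K * y j.+1]; hence [x j <= B * y j] for all [j]. *)
Lemma tail_bound_of_moment (c : R) : Dhat w -> 0 < c ->
  (forall n, (0 < n)%N -> c <= n%:R * moment w n) ->
  exists K, forall r, 0 <= r < 1 -> 1 - r <= K * omega_hat w r.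
Proof.
move=> [K K1 HK] c0 Hc.
have K0 : 0 < K := lt_le_trans ltr01 K1.
have [l Hl] : exists l, 4 * K <= 2 ^+ l.
  have [l Hl] := geometric_small (4 * K) ltr01; exists l.
  by move: Hl; rewrite ltr_pdivrMr ?exprn_gt0// mul1r => /ltW.
pose rr j : R := 1 - (2 ^+ j)^-1; pose y j := omega_hat w (rr j).
pose x j := moment w (2 ^ (l + j)).
have p0 j : 0 < 2 ^+ j :> R by rewrite exprn_gt0.
have pV j : 0 < (2 ^+ j : R)^-1 <= 1.
  by rewrite invr_gt0 p0/= invf_le1// exprn_ege1// ler1n.
have rr01 j : 0 <= rr j < 1.
  by have := pV j; rewrite /rr => /andP[a b]; apply/andP; split; lra.
have y0 j : 0 < y j by exact: hpos.
have yS j : y j <= K * y j.+1.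
  rewrite /y (_ : rr j.+1 = (1 + rr j) / 2); first exact: HK.
  by rewrite /rr exprS; field; rewrite lt0r_neq0.
(* The power is at most [1 / (1 + 2^l / 2)] by Bernoulli's inequality, and [2^l >= 4 K]. *)
have q1 j : (rr j.+1) ^+ (2 ^ (l + j)) * K <= 1 / 2.
  have := @exprB_le_inv (2 ^+ j.+1)^-1 (2 ^ (l + j)); have /andP[a b] := pV j.+1.
  rewrite (ltW a) b => /(_ isT); rewrite natrX exprD exprS invfM.
  rewrite (_ : 2 ^+ l * 2 ^+ j * (2^-1 / 2 ^+ j) = 2 ^+ l / 2); last first.
    by field; rewrite lt0r_neq0.
  have e0 : 0 < 1 + 2 ^+ l / 2 :> R by have := p0 l; lra.
  rewrite /rr exprS invfM; set P := (X in X <= _ -> _) => h.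
  have P0 : 0 <= P.
    by rewrite exprn_ge0//; have := rr01 j.+1; rewrite /rr exprS invfM => /andP[].
  have {}h : P * (1 + 2 ^+ l / 2) <= 1 by rewrite -ler_pdivlMr// div1r.
  have := ler_wpM2l P0 Hl => hK; suff : P * K <= 1 / 2 by []; lra.
have xS j : x j.+1 <= (rr j.+1) ^+ (2 ^ (l + j)) * x j + y j.+1.
  by rewrite /x addnS expnS; exact: moment_double.
(* The quotient starts the induction; [B >= 2] closes it, since then [B/2 + 1 <= B]. *)
pose B := Num.max 2 (x 0 / y 0).
have B2 : 2 <= B by rewrite le_max lexx.
have xy j : x j <= B * y j.
  elim: j => [|j ih]; first by rewrite -ler_pdivrMr// le_max lexx orbT.
  apply: (le_trans (xS j)).
  have P0 : 0 <= (rr j.+1) ^+ (2 ^ (l + j)) by rewrite exprn_ge0//; have /andP[] := rr01 j.+1.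
  have h1 := ler_wpM2l P0 (le_trans ih (ler_wpM2l (le_trans (ler0n R 2) B2) (yS j))).
  have h2 : (rr j.+1) ^+ (2 ^ (l + j)) * K * (B * y j.+1) <= 1 / 2 * (B * y j.+1).
    by rewrite ler_wpM2r// mulr_ge0 ?(ltW (y0 _))// (le_trans _ B2).
  have h3 : 2 * y j.+1 <= B * y j.+1 by rewrite ler_wpM2r// ltW.
  by lra.
exists (2 * 2 ^+ l * B / c) => r /andP[r0 r1].
(* The least such [j] places [1 - r] between [2^-j] and [2 / 2^j]. *)
have ex : exists j, (2 ^+ j)^-1 <= 1 - r.
  have r10 : 0 < 1 - r by rewrite subr_gt0.
  by have [j] := geometric_small 1 r10; rewrite div1r => h; exists j; exact: ltW.
have [j Hj jmin] := ex_minnP ex.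
have rj : r <= rr j by rewrite /rr; lra.
have up : 1 - r <= 2 / 2 ^+ j.
  case: j Hj jmin {rj} => [_ _|j Hj jmin]; first by rewrite expr0 divr1; lra.
  rewrite leNgt; apply/negP => lt; have := jmin j; rewrite ltnn => H.
  suff : false by []; apply: H; rewrite exprS invfM in lt *; apply: ltW.
  by move: lt; rewrite mulrA mulfV// mul1r.
have yr : y j <= omega_hat w r by apply: omega_hat_nincr => //; have /andP[] := rr01 j.
have cx : c <= 2 ^+ l * 2 ^+ j * x j.
  by have := Hc (2 ^ (l + j))%N; rewrite expn_gt0/= natrX exprD; apply.
have B0 : 0 < B by exact: lt_le_trans B2.
have : 2 ^+ l * 2 ^+ j * x j <= 2 ^+ l * 2 ^+ j * (B * omega_hat w r).
  rewrite ler_wpM2l ?mulr_ge0 ?(ltW (p0 _))// (le_trans (xy j))//.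
  by rewrite ler_wpM2l// ltW.
move=> /(le_trans cx) h.
apply: (le_trans up); rewrite ler_pdivrMr// mulrAC mulrAC -mulrA.
have -> : 2 * 2 ^+ l * B / c * (omega_hat w r * 2 ^+ j) =
   2 / c * (2 ^+ l * 2 ^+ j * (B * omega_hat w r)) by field; exact: lt0r_neq0.
apply: le_trans (ler_wpM2l _ h); last by rewrite divr_ge0// ltW.
by rewrite divfK// gt_eqF.
Qed.

End Moments.

(** * Test functions and symbols *)

Section TestFunctions.
Variable R : realType.
Local Notation mu := (@lebesgue_measure R).
Local Notation mu2 := (mu \x mu)%E.
Local Notation C := (complex R).
Implicit Types (z a b : C) (w : R -> R).

(** Each rotated copy has the same circular integral, so a bound on their sum can be integrated. The
    condition is [cxnorm p <= r] and not an equality because the radial projection sends the origin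
    to itself. *)
Lemma circ_int_mean_le N (H : R * R -> \bar R) (r c : R) : (0 < N)%N ->
  measurable_fun setT H -> (forall p, 0 <= H p)%E -> 0 <= r -> 0 <= c ->
  (forall p, cxnorm p <= r -> (\sum_(i < N) H (cxmul (rt R N i) p) <= (N%:R * c)%:E)%E) ->
  (circ_int H r <= c%:E * disc_area R)%E.
Proof.
move=> N0 mH H0 r0 c0 Hc.
pose A (p : R * R) := (r * (p.1 / cxnorm p), r * (p.2 / cxnorm p)).
have mg i : measurable_fun setT (fun p => H (cxmul (rt R N i) (A p))).
  exact: (measurable_radial r (measurableT_comp mH (measurable_cxmul (rt R N i)))).
have mD := @measurable_cxdisc R.
have : (N%:R%:E * circ_int H r <= N%:R%:E * (c%:E * disc_area R))%E.
  have -> : (N%:R%:E * circ_int H r = \int[mu2]_(p in [set p | (cxnorm p < 1)%R])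
      \sum_(i < N) H (cxmul (rt R N i) (A p)))%E.
    rewrite ge0_integral_sum//; last by move=> i; apply: measurable_funTS; exact: mg.
    rewrite (eq_bigr (fun=> circ_int H r)); last first.
      by move=> i _; rewrite -(circ_int_rotation r (cnorm_rt R N i) mH H0).
    by rewrite sumr_const card_ord mule_natl.
  rewrite muleA -EFinM /disc_area -integral_cst//.
  apply: ge0_le_integral => //.
  - by move=> p _; exact: sume_ge0.
  - by apply: measurable_funTS; apply: emeasurable_sum => i; exact: mg.
  - by move=> p _; apply: Hc; exact: cxnorm_radial.
by rewrite lee_pmul2l// lte_fin ltr0n.
Qed.

Lemma poisson_le3 z : cnorm z <= 1 / 2 -> poisson z <= 3.
Proof.
move=> z2; have := cnormB_ge 1 z; rewrite cnorm1 => h; have z0 := cnorm_ge0 z.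
rewrite /poisson ler_pdivrMr ?exprn_gt0//; last by lra.
have : (1 - cnorm z) ^+ 2 <= cnorm (1 - z) ^+ 2 by rewrite lerXn2r// ?nnegrE; lra.
by rewrite !expr2; nra.
Qed.

(** Here [|1 - z u|^-2 = P(z u) / (1 - |z|^2)], so the mean is exactly [P(z^N) / (1 - |z|^2)]; with
    [|z^N| <= 1/2] the numerator is at most 3. One suitable [N] is enough, without a limit. *)
Lemma mean_geometric_sqr_le N z (r : R) : (0 < N)%N -> cnorm z <= r -> r < 1 -> r ^+ N <= 1 / 2 ->
  \sum_(k < N) cnorm (1 - z * rt R N k)^-1 ^+ 2 <= N%:R * (3 / (1 - r)).
Proof.
move=> N0 zr r1 rN; have z1 := le_lt_trans zr r1; have z0 := cnorm_ge0 z.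
have N0' : 0 < N%:R :> R by rewrite ltr0n.
have d0 : 0 < 1 - cnorm z ^+ 2 by rewrite subr_gt0 expr_lt1// cnorm_ge0.
have := mean_poisson N0 z1; have : poisson (z ^+ N) <= 3.
  by apply: poisson_le3; rewrite cnormX (le_trans _ rN)// lerXn2r ?nnegrE// (le_trans z0).
move=> le3 /(congr1 (fun x => N%:R * x)); rewrite mulrA mulfV ?mul1r; last by rewrite lt0r_neq0.
rewrite (eq_bigr (fun k : 'I_N => (1 - cnorm z ^+ 2) * cnorm (1 - z * rt R N k)^-1 ^+ 2)); last first.
  by move=> k _; rewrite /poisson cnormM cnorm_rt mulr1 cnormV exprVn.
rewrite -mulr_sumr; set S := \sum_(k < _) _ => SE.
have S0 : 0 <= S by apply: sumr_ge0 => k _; exact: sqr_ge0.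
have r10 : 0 < 1 - r by rewrite subr_gt0.
rewrite mulrA ler_pdivlMr//.
have : (1 - r) * S <= (1 - cnorm z ^+ 2) * S by rewrite ler_wpM2r// lerD2l lerN2 expr2; nra.
rewrite SE mulrC => /le_trans; apply; by rewrite ler_pM2l.
Qed.

(* Used with [b = a^*], where [a] is the point at which [Tg g' f] is differentiated. *)
Definition test_fun n b z : C := z ^+ n * (1 - b * z)^-1 ^+ 2.

Definition test_deriv n b z : C :=
  n%:R * z ^+ n.-1 * (1 - b * z)^-1 ^+ 2 + z ^+ n * (2 * b * (1 - b * z)^-1 ^+ 3).

Lemma test_funP n b z : cnorm b < 1 -> disc z -> has_cderiv (test_fun n b) z (test_deriv n b z).
Proof.
move=> b1 z1; have bz : 1 - b * z != 0.
  apply: geometric_neq0; rewrite cnormM mulr_ilt1 ?cnorm_ge0//.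
have dq : has_cderiv (fun z => (1 - b * z)^-1) z (b * (1 - b * z)^-1 ^+ 2).
  have := @has_cderiv_affine R (fun z => z^-1) 1 (- b) z (- (1 - b * z) ^- 2).
  rewrite mulNr => /(_ (has_cderivV bz)); rewrite mulrN mulNr opprK mulrC exprVn.
  by apply: has_cderiv_ext => x; rewrite mulNr.
have -> : test_deriv n b z = (n%:R * z ^+ n.-1) * (1 - b * z)^-1 ^+ 2 +
    z ^+ n * (b * (1 - b * z)^-1 ^+ 2 * (1 - b * z)^-1 + (1 - b * z)^-1 * (b * (1 - b * z)^-1 ^+ 2)).
  by rewrite /test_deriv; ring.
apply: (@has_cderiv_ext R (fun z => z ^+ n * ((1 - b * z)^-1 * (1 - b * z)^-1))).
  by move=> x; rewrite -expr2.
by rewrite [in X in has_cderiv _ _ (X + _)]expr2; apply: has_cderivM (has_cderivXn z n) (has_cderivM dq dq).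
Qed.

(** Since [|1 - b z| >= 1 - |b| = 1/(2n)], the extra pole in the second term costs only a factor
    [2n]; the two terms contribute [n] and [4n]. *)
Lemma test_deriv_le n b z : (0 < n)%N -> cnorm b = 1 - (2 * n%:R)^-1 -> disc z ->
  cnorm (test_deriv n b z) <= 5 * n%:R * cnorm z ^+ n.-1 * cnorm (1 - b * z)^-1 ^+ 2.
Proof.
move=> n0 bE; rewrite /disc /= => z1; have n0' : 0 < n%:R :> R by rewrite ltr0n.
have z0 := cnorm_ge0 z; have b0 := cnorm_ge0 b.
set q := (1 - b * z)^-1.
have t0 : 0 < (2 * n%:R : R)^-1 by rewrite invr_gt0 mulr_gt0.
have q1 : cnorm q <= 2 * n%:R.
  have h : (2 * n%:R)^-1 <= cnorm (1 - b * z).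
    apply: le_trans (cnormB_ge _ _); rewrite cnorm1 cnormM; nra.
  by rewrite /q cnormV -[leRHS]invrK lef_pV2 ?posrE// (lt_le_trans t0).
have q0 := cnorm_ge0 q; have P0 : 0 <= cnorm z ^+ n.-1 by rewrite exprn_ge0.
apply: (le_trans (cnormD _ _)); rewrite !cnormM !cnormX cnorm_nat (cnorm_nat R 2).
have -> : cnorm z ^+ n = cnorm z * cnorm z ^+ n.-1 by rewrite -exprS prednK.
rewrite -/q.
have Q0 : 0 <= cnorm z ^+ n.-1 * cnorm q ^+ 2 by rewrite mulr_ge0// sqr_ge0.
have h : cnorm z * (2 * cnorm b * cnorm q) <= 4 * n%:R.
  have h1 : cnorm z * cnorm b <= 1 by nra.
  have h2 : 0 <= cnorm z * cnorm b by rewrite mulr_ge0.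
  by nra.
have := ler_wpM2r Q0 h; rewrite expr2; lra.
Qed.

(** The constant is [5 n], from the pointwise bound, times [3 / (1 - |b|) = 6 n], from the mean of
    the kernel. *)
Lemma circ_int_test_le n b (r : R) : (0 < n)%N -> cnorm b = 1 - (2 * n%:R)^-1 -> 0 <= r < 1 ->
  (circ_int (absdisc (test_deriv n b)) r <= (30 * n%:R ^+ 2 * r ^+ n.-1)%:E * disc_area R)%E.
Proof.
move=> n0 bE /andP[r0 r1]; have n0' : 0 < n%:R :> R by rewrite ltr0n.
have t0 : 0 < (2 * n%:R : R)^-1 by rewrite invr_gt0 mulr_gt0.
have b1 : cnorm b < 1 by rewrite bE gtrBl.
have b0 := cnorm_ge0 b.
have [N N0 HN] : exists2 N, (0 < N)%N & cnorm b ^+ N <= 1 / 2.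
  have [N0 H] := @cvgC0_geom R b b1 (1 / 2) (divr_gt0 ltr01 (ltr0Sn _ 1)).
  by exists N0.+1 => //; have := H _ (leqnSn _); rewrite subr0 cnormX.
have hf : hol 1 (test_deriv n b) := hol_deriv (fun z => @test_funP n b z b1).
apply: (@circ_int_mean_le N) => //.
- exact: measurable_absdisc.
- exact: absdisc_ge0.
- by rewrite !mulr_ge0 ?exprn_ge0.
move=> p pr; have p1 := le_lt_trans pr r1.
have pk i : cxnorm (cxmul (rt R N i) p) = cxnorm p.
  by rewrite /cxnorm toC_cxmul cnormM cnorm_rt mul1r.
rewrite (eq_bigr (fun i : 'I_N => (cnorm (test_deriv n b (rt R N i * toC p)))%:E)); last first.
  by move=> i _; rewrite absdiscE ?toC_cxmul// pk.
rewrite sumEFin lee_fin.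
apply: (@le_trans _ _ (\sum_(i < N) 5 * n%:R * r ^+ n.-1 * cnorm (1 - b * toC p * rt R N i)^-1 ^+ 2)).
  apply: ler_sum => i _; have di : disc (rt R N i * toC p) by rewrite /disc /= cnormM cnorm_rt mul1r.
  apply: (le_trans (test_deriv_le n0 bE di)).
  have -> : b * toC p * rt R N i = b * (rt R N i * toC p) by ring.
  rewrite [cnorm (rt R N i * toC p)]cnormM cnorm_rt mul1r ler_wpM2r ?sqr_ge0// ler_wpM2l ?mulr_ge0//.
  by rewrite lerXn2r ?nnegrE ?cnorm_ge0.
have bp : cnorm (b * toC p) <= cnorm b.
  by rewrite cnormM ler_piMr// ltW.
have := mean_geometric_sqr_le N0 bp b1 HN.
rewrite -mulr_sumr; have -> : 3 / (1 - cnorm b) = 6 * n%:R.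
  by rewrite bE opprB addrC subrK invrK; ring.
have P0 : 0 <= 5 * n%:R * r ^+ n.-1 by rewrite !mulr_ge0 ?exprn_ge0.
by move=> /(ler_wpM2l P0) /le_trans; apply; rewrite le_eqVlt; apply/orP; left; apply/eqP; ring.
Qed.

(** The polar density [2 r] doubles the constant 30 and raises [r^(n-1)] to [r^n], so that the
    radial integral is the moment of order [n]. *)
Lemma disc_int_test_le w n b (v : R) : radial_weight w -> (0 < n)%N ->
  cnorm b = 1 - (2 * n%:R)^-1 -> disc_area R = v%:E ->
  (disc_int w (test_deriv n b) <= (60 * v * (n%:R ^+ 2 * moment w n))%:E)%E.
Proof.
move=> hw n0 bE vE; have v0 : 0 < v by rewrite -lte_fin -vE disc_area_gt0.
have b1 : cnorm b < 1 by rewrite bE gtrBl invr_gt0 mulr_gt0// ltr0n.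
have hf : hol 1 (test_deriv n b) := hol_deriv (fun z => @test_funP n b z b1).
have mH := measurable_absdisc hf; have H0 := absdisc_ge0 (test_deriv n b).
rewrite disc_int_polar// mulrA EFinM moment_wt//.
have mpow : measurable_fun setT (fun s : R => ((s ^+ n)%:E * wt w s)%E).
  apply: emeasurable_funM; last exact: measurable_wt.
  by apply/measurable_EFinP; exact: measurable_funX.
have c0 : 0 <= 60 * v * n%:R ^+ 2 by rewrite !mulr_ge0 ?exprn_ge0// ltW.
have mcirc := measurable_circ_int mH H0; have circ0 r := circ_int_ge0 r H0.
have circ_le r := @circ_int_test_le n b r n0 bE.
move: (circ_int _) mcirc circ0 circ_le => K mK K0 K_le.
have pw0 s : s \in (`[0%R, 1%R[ : interval R) -> (0 <= (s ^+ n)%:E * wt w s)%E.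
  by rewrite in_itv/= => /andP[s0 _]; rewrite mule_ge0 ?wt_ge0// lee_fin exprn_ge0.
rewrite -ge0_integralZl_EFin//; last by exact: measurable_funTS.
apply: ge0_le_integral.
- by [].
- by move=> r _; rewrite !mule_ge0 ?wt_ge0// lee_fin mulr_ge0.
- apply: measurable_funTS; apply: emeasurable_funM; first exact: measurable_wt.
  apply: emeasurable_funM => //; apply/measurable_EFinP.
  by apply: measurable_funM => //; exact: normr_measurable.
- by apply: measurable_funeM; exact: measurable_funTS.
move=> r; rewrite /= in_itv/= => r01; have /andP[r0 r1] := r01.
rewrite [leRHS]muleA [leRHS]muleC; apply: lee_wpmul2l; first exact: wt_ge0.
rewrite (ger0_norm r0); apply: (@le_trans _ _ ((2 * r)%:E * ((30 * n%:R ^+ 2 * r ^+ n.-1)%:E * v%:E))%E).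
  by apply: lee_wpmul2l; [rewrite lee_fin mulr_ge0|rewrite -vE; exact: K_le].
have -> : r ^+ n = r * r ^+ n.-1 by rewrite -exprS prednK.
rewrite -!EFinM lee_fin le_eqVlt; apply/orP; left; apply/eqP; ring.
Qed.

End TestFunctions.

(** * Growth of the derivative of a symbol *)

Section Symbols.
Variable R : realType.
Local Notation C := (complex R).
Implicit Types (z a b : C) (g : C -> C) (w : R -> R).

Lemma symbol_deriv_bound w g g' : radial_weight w -> in_T_D1_Hinf w g g' ->
  exists2 A : R, 0 <= A & forall n a, (0 < n)%N -> cnorm a = 1 - (2 * n%:R)^-1 ->
    cnorm (g' a) <= A * (n%:R * moment w n).
Proof.
move=> hw [dg [K HK]].
have [v v0 vE] : exists2 v : R, 0 < v & disc_area R = v%:E.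
  have := disc_area_gt0 R; have := disc_area_lty R; case: (disc_area R) => // v _ v0.
  by exists v.
pose D := pi^-1 * (60 * v).
have D0 : 0 <= D by rewrite mulr_ge0 ?invr_ge0 ?pi_ge0// mulr_ge0// ltW.
have hg' : hol 1 g' := hol_deriv dg.
have mom0 n : 0 <= moment w n.
  rewrite -lee_fin moment_wt//; apply: integral_ge0 => s; rewrite /= in_itv/= => /andP[s0 _].
  by rewrite mule_ge0 ?wt_ge0// lee_fin exprn_ge0.
exists (8 * `|K| * D) => [|n a n0 aE]; first by do 2 apply: mulr_ge0 => //.
have n0' : 0 < n%:R :> R by rewrite ltr0n.
have t0 : 0 < (2 * n%:R : R)^-1 by rewrite invr_gt0 mulr_gt0.
have a1 : cnorm a < 1 by rewrite aE gtrBl.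
have bE : cnorm a^* = 1 - (2 * n%:R)^-1 by rewrite cnormJ.
have b1 : cnorm a^* < 1 by rewrite cnormJ.
pose f := test_fun n a^*; pose f' := test_deriv n a^*.
have df : analytic_disc f f' by move=> z z1; exact: test_funP.
have hf : hol 1 f by move=> z z1; exists (f' z); exact: df.
have normf : (D1_norm w f f' <= (D * (n%:R ^+ 2 * moment w n))%:E)%E.
  have f0 : f 0 = 0 by rewrite /f /test_fun expr0n gtn_eqF// mul0r.
  rewrite D1_normE f0 cnorm0 adde0 /D -mulrA EFinM.
  by apply: lee_wpmul2l; [rewrite lee_fin invr_ge0 pi_ge0|exact: disc_int_test_le].
have fD : in_D1 w f f' by split=> //; apply: le_lt_trans normf _; rewrite ltry.
have Tbound z : disc z -> cnorm (Tg g' f z) <= `|K| * (D * (n%:R ^+ 2 * moment w n)).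
  move=> dz; rewrite -lee_fin EFinM; apply: (le_trans (HK _ _ fD _ dz)).
  apply: (@le_trans _ _ (`|K|%:E * D1_norm w f f')%E).
    by apply: lee_wpmul2r; [exact: D1_norm_ge0|rewrite lee_fin ler_norm].
  by apply: lee_wpmul2l.
have := cauchy_estimate (fun z dz => Tg_deriv hf hg' dz) Tbound a1.
rewrite cnormM {1}aE opprB addrC subrK.
(* Bernoulli's inequality gives [|a|^n >= 1/2], and [1 - |a|^2 <= 2 (1 - |a|) = 1/n]. *)
have fa : 1 / 2 * n%:R ^+ 2 <= cnorm (f a).
  rewrite /f /test_fun cnormM !cnormX cnormV; apply: ler_pM.
  - by [].
  - exact: sqr_ge0.
  - rewrite aE; apply: le_trans (bernoulli_le n _).
      by rewrite invfM mulrCA mulfV ?lt0r_neq0// mulr1; lra.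
    by rewrite (ltW t0)/= -subr_ge0 -aE cnorm_ge0.
  - rewrite mulrC mulcJ -(rmorph1 (real_complex R)) -rmorphB cnorm_real.
    have a0 := cnorm_ge0 a.
    have d0 : 0 < 1 - cnorm a ^+ 2 by rewrite subr_gt0 expr_lt1.
    rewrite gtr0_norm// lerXn2r ?nnegrE ?invr_ge0 ?(ltW n0') ?(ltW d0)//.
    rewrite -[leLHS]invrK lef_pV2 ?posrE ?invr_gt0//.
    have -> : n%:R^-1 = 2 * (2 * n%:R)^-1 :> R by field; rewrite lt0r_neq0.
    have -> : (2 * n%:R)^-1 = 1 - cnorm a by rewrite aE; ring.
    by rewrite expr2; nra.
have G0 := cnorm_ge0 (g' a).
move: fa; set F := cnorm (f a); set G := cnorm (g' a) in G0 *; set N : R := n%:R in n0' t0 *.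
move=> /(ler_wpM2r G0) fG FG.
have : 1 / 2 * N ^+ 2 * G * (2 * N)^-1 <= 2 * (`|K| * (D * (N ^+ 2 * moment w n))).
  by apply: le_trans FG; rewrite ler_wpM2r// ltW.
have -> : 1 / 2 * N ^+ 2 * G * (2 * N)^-1 = (1 / 4 * G) * N by field; rewrite lt0r_neq0.
have -> : 2 * (`|K| * (D * (N ^+ 2 * moment w n))) =
   (2 * `|K| * D * (N * moment w n)) * N by ring.
by rewrite ler_pM2r// => h; lra.
Qed.

Lemma nonconstant_deriv_neq0 g g' : analytic_disc g g' ->
  ~ (forall z, disc z -> g z = g 0) -> exists2 z, disc z & g' z != 0.
Proof.
move=> dg nc; apply/not_exists2P => H; apply: nc => z dz.
have seg (t : R) : 0 <= t <= 1 -> disc (0 + t%:C * z).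
  move=> /andP[t0 t1]; rewrite /disc /= add0r cnormM cnorm_real ger0_norm//.
  by apply: le_lt_trans dz; rewrite ler_piMl ?cnorm_ge0.
have := @mean_value_segment R g g' 0 z 0 0.
rewrite add0r mul0r subr0 mul0r => h; apply/eqP.
rewrite -subr_eq0 -cnorm_eq0 eq_le cnorm_ge0 andbT; apply: h => t t01.
  exact/dg/seg.
have [//|/negP/negPn/eqP ->] := H (0 + t%:C * z); first by move/(_ (seg _ t01)).
by rewrite subr0 cnorm0.
Qed.

(** Fix [z0] with [g' z0] nonzero. For [n >= m] the circle of radius [1 - 1/(2n)] surrounds [z0] at
    distance at least [(1 - |z0|)/2], and the bound for [g'] on it passes to [z0]. For [n < m] the
    moments are nonincreasing, so [moment w m] is a lower bound. *)
Lemma nonconstant_symbol_moment w g g' : radial_weight w ->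
  (forall r, 0 <= r < 1 -> 0 < omega_hat w r) -> in_T_D1_Hinf w g g' ->
  ~ (forall z, disc z -> g z = g 0) ->
  exists2 c : R, 0 < c & forall n, (0 < n)%N -> c <= n%:R * moment w n.
Proof.
move=> hw hpos gT nc; have [dg _] := gT.
have [z0 dz0 g'0] := nonconstant_deriv_neq0 dg nc.
have [A A0 HA] := symbol_deriv_bound hw gT.
have hg' : hol 1 g' := hol_deriv dg.
have G0 : 0 < cnorm (g' z0) by rewrite cnorm_gt0.
set G := cnorm (g' z0) in G0.
have x0 := cnorm_ge0 z0; have x1 : cnorm z0 < 1 by [].
set x := cnorm z0 in x0 x1.
have d0 : 0 < 1 - x by rewrite subr_gt0.
have [m Hm] : exists m : nat, (1 - x)^-1 <= m%:R.
  by exists (Num.bound (1 - x)^-1); apply: ltW; apply: archi_boundP; rewrite invr_ge0 ltW.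
have m0 : (0 < m)%N by rewrite -(ltr0n R) (lt_le_trans _ Hm)// invr_gt0.
have A1 : 0 < A + 1 by rewrite ltr_wpDl.
exists (Num.min (G * (1 - x) / (2 * (A + 1))) (moment w m)).
  by rewrite lt_min moment_gt0// andbT !divr_gt0 ?mulr_gt0.
move=> n n0; have n0' : 1 <= n%:R :> R by rewrite ler1n.
have W0 := moment_gt0 hw hpos n.
have [mn|nm] := leqP m n; last first.
  apply: (@le_trans _ _ (moment w n)); last by rewrite ler_peMl// ltW.
  by rewrite ge_min moment_nincr ?orbT// ltnW.
have tx : (2 * n%:R)^-1 <= (1 - x) / 2.
  rewrite invfM mulrC ler_pM2r ?invr_gt0// -[leRHS]invrK lef_pV2 ?posrE ?invr_gt0//; last by lra.
  by apply: (le_trans Hm); rewrite ler_nat.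
have t0 : 0 < (2 * n%:R : R)^-1 by rewrite invr_gt0 mulr_gt0// (lt_le_trans ltr01).
set t := (2 * n%:R)^-1 in tx t0.
have rho1 : 1 - t < 1 by rewrite gtrBl.
have wrho : x < 1 - t by lra.
have := @circle_bound_inside R g' (1 - t) (A * (n%:R * moment w n)) z0 hg' rho1 wrho (HA n ^~ n0).
rewrite -/G -/x => le.
have nW : 0 <= n%:R * moment w n by rewrite mulr_ge0// ltW.
have q : (1 - t) / (1 - t - x) <= 2 / (1 - x).
  rewrite ler_pdivrMr; last by lra.
  rewrite mulrAC ler_pdivlMr//; nra.
rewrite ge_min; apply/orP; left; rewrite ler_pdivrMr ?mulr_gt0//.
have {}le : G <= A * (n%:R * moment w n) * (2 / (1 - x)).
  by apply: (le_trans le); rewrite ler_wpM2l// mulr_ge0.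
move: le; rewrite [leRHS]mulrA ler_pdivlMr// => /le_trans; apply.
by move: (n%:R * moment w n) nW => y y0; nra.
Qed.

End Symbols.

(** * The moment series and the lower bound for the moments *)

Section MomentSeries.
Variable R : realType.

Lemma ereal_sup_eqy (T : Type) (A : set T) (F : T -> \bar R) :
  ereal_sup [set F x | x in A] = +oo%E <->
  ~ exists K : R, forall x, A x -> (F x <= K%:E)%E.
Proof.
split=> [supy [K HK]|unb].
  have : (ereal_sup [set F x | x in A] <= K%:E)%E.
    by apply: ge_ereal_sup => _ [x Ax <-]; exact: HK.
  by rewrite supy leNgt ltry.
apply: contrapT => /eqP supN; apply: unb; exists (fine (ereal_sup [set F x | x in A])) => x Ax.
have : (F x <= ereal_sup [set F x | x in A])%E by apply: ereal_sup_ubound; exists x.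
by move: supN; case: (ereal_sup _) => [s| |]//= _; rewrite leeNy_eq => /eqP ->; rewrite leNye.
Qed.

Variable w : R -> R.
Hypothesis hw : radial_weight w.
Hypothesis hpos : forall r, 0 <= r < 1 -> 0 < omega_hat w r.

Let term (r : R) (k : nat) : R := (r ^+ k) / ((k + 1)%:R * moment w k).

Let term_ge0 r k : 0 <= r -> 0 <= term r k.
Proof.
by move=> r0; rewrite divr_ge0 ?exprn_ge0// mulr_ge0// ltW// moment_gt0.
Qed.

(** The lower bound for the moments turns each term into at most [4 K r^k], and the factor [1 - r]
    makes the geometric series telescope. *)
Lemma moment_series_le (K r : R) : (forall r, 0 <= r < 1 -> 1 - r <= K * omega_hat w r) ->
  0 <= r < 1 -> ((1 - r)%:E * \sum_(1 <= k <oo) (term r k)%:E <= (4 * K)%:E)%E.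
Proof.
move=> tail /andP[r0 r1]; have [K0 HK] := moment_bound_of_tail hw hpos tail.
have d0 : 0 < 1 - r by rewrite subr_gt0.
have term_le k : term r k <= 4 * K * r ^+ k.
  rewrite /term addn1 mulrC ler_wpM2r ?exprn_ge0//.
  have W0 : 0 < k.+1%:R * moment w k by rewrite mulr_gt0 ?moment_gt0// ltr0n.
  by rewrite -[leLHS]div1r ler_pdivrMr.
suff : (\sum_(1 <= k <oo) (term r k)%:E <= (4 * K / (1 - r))%:E)%E.
  have dE : (0 <= (1 - r)%:E)%E by rewrite lee_fin ltW.
  by move=> /(lee_wpmul2l dE) /le_trans; apply; rewrite -EFinM lee_fin mulrC divfK ?gt_eqF.
apply: lime_le; first by apply: is_cvg_nneseries => k _ _; rewrite lee_fin term_ge0.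
apply: nearW => n; rewrite sumEFin lee_fin ler_pdivlMr//.
apply: (@le_trans _ _ (4 * K * (\sum_(1 <= k < n) r ^+ k * (1 - r)))).
  by rewrite -mulr_suml mulrA ler_wpM2r ?(ltW d0)// mulr_sumr; apply: ler_sum.
rewrite ler_piMr ?mulr_ge0 ?(ltW K0)//.
have [n0|n0] := leqP n 1; first by rewrite big_geq.
rewrite (eq_bigr (fun k => - r ^+ k.+1 - (- r ^+ k))); last by move=> k _; rewrite exprS; ring.
rewrite (telescope_sumr _ (ltnW n0)) expr1 opprK.
by have : 0 <= r ^+ n by [rewrite exprn_ge0]; lra.
Qed.

(** At [r = 1 - 1/(4n)] only the block [n <= k < 2n] is kept. There [r^k >= 1/2] and
    [(k + 1) moment w k <= 2n moment w n], so the [n] terms sum to at least [1 / (4 moment w n)];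
    the factor [1 - r] then yields the 16. *)
Lemma moment_bound_of_series (B : R) :
  (forall r, 0 <= r < 1 -> ((1 - r)%:E * \sum_(1 <= k <oo) (term r k)%:E <= B%:E)%E) ->
  exists2 c : R, 0 < c & forall n, (0 < n)%N -> c <= n%:R * moment w n.
Proof.
move=> HB; have B0 : 0 < `|B| + 1 by rewrite ltr_wpDl.
exists (16 * (`|B| + 1))^-1 => [|n n0]; first by rewrite invr_gt0 mulr_gt0.
have n0' : 0 < n%:R :> R by rewrite ltr0n.
have n1' : 1 <= n%:R :> R by rewrite ler1n.
have W0 := moment_gt0 hw hpos n.
pose t : R := (4 * n%:R)^-1.
have t0 : 0 < t by rewrite invr_gt0 mulr_gt0.
have tE : n%:R * t = 1 / 4 by rewrite /t; field; rewrite lt0r_neq0.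
have t1 : t <= 1 / 4 by rewrite -tE ler_peMl// ltW.
have r01 : 0 <= 1 - t < 1 by apply/andP; split; lra.
have /andP[r0 r1] := r01.
have := HB _ r01; rewrite opprB addrC subrK => HBt.
have low k : (n <= k < n + n)%N -> (4 * (n%:R * moment w n))^-1 <= term (1 - t) k.
  move=> /andP[nk kn]; have Wk := moment_gt0 hw hpos k.
  have h1 : 1 / 2 <= (1 - t) ^+ k.
    apply: le_trans (bernoulli_le k _); last by apply/andP; split; lra.
    have : k%:R * t <= (n + n)%:R * t by rewrite ler_wpM2r ?(ltW t0)// ler_nat ltnW.
    by rewrite natrD mulrDl tE; lra.
  have h2 : (k + 1)%:R * moment w k <= 2 * (n%:R * moment w n).
    rewrite mulrA; apply: ler_pM; rewrite ?(ltW Wk)//; last exact: moment_nincr.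
    by rewrite mulr_natl -mulrnA ler_nat; lia.
  have k0 : 0 < (k + 1)%:R * moment w k by rewrite mulr_gt0// ltr0n addn1.
  have -> : (4 * (n%:R * moment w n))^-1 = 1 / 2 * (2 * (n%:R * moment w n))^-1.
    by field; rewrite !lt0r_neq0.
  apply: ler_pM => //; first by rewrite invr_ge0 !mulr_ge0 ?(ltW W0)// ltW.
  by rewrite lef_pV2 ?posrE// !mulr_gt0.
have part : \sum_(n <= k < n + n) term (1 - t) k <= \sum_(1 <= k < n + n) term (1 - t) k.
  rewrite [leRHS](big_cat_nat n0) ?leq_addr//= lerDr.
  by apply: sumr_ge0 => k _; exact: term_ge0.
have sumlow : (4 * moment w n)^-1 <= \sum_(n <= k < n + n) term (1 - t) k.
  apply: (@le_trans _ _ (\sum_(n <= k < n + n) (4 * (n%:R * moment w n))^-1)).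
    rewrite sumr_const_nat addnK -[_ *+ n]mulr_natl le_eqVlt; apply/orP; left; apply/eqP.
    by field; rewrite !lt0r_neq0.
  by apply: ler_sum_nat => k /low.
have : (t%:E * (\sum_(1 <= k < n + n) term (1 - t) k)%:E <= B%:E)%E.
  apply: le_trans HBt; apply: lee_wpmul2l; first by rewrite lee_fin ltW.
  rewrite -sumEFin; apply: nneseries_lim_ge => k _ _; by rewrite lee_fin term_ge0.
rewrite -EFinM lee_fin => le.
have {}le : t * (4 * moment w n)^-1 <= B.
  by apply: le_trans le; rewrite ler_wpM2l ?(ltW t0)// (le_trans sumlow).
have {}le : t * (4 * moment w n)^-1 <= `|B| + 1.
  by apply: (le_trans le); rewrite (le_trans (ler_norm _))// lerDl.
move: le; rewrite /t -invfM (_ : 4 * n%:R * _ = 16 * (n%:R * moment w n)); last by ring.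
have nW : 0 < n%:R * moment w n by rewrite mulr_gt0.
rewrite -div1r ler_pdivrMr ?mulr_gt0// => le.
by rewrite -div1r ler_pdivrMr ?mulr_gt0//; lra.
Qed.

End MomentSeries.

(** * Equivalence of the four conditions *)

Theorem mainTheorem3 (R : realType) (w : R -> R)
  (hw : radial_weight w)
  (hpos : forall r : R, 0 <= r < 1 -> 0 < omega_hat w r)
  (hD : Dhat w) :
  let i_ := forall g g' : R[i] -> R[i], in_T_D1_Hinf w g g' ->
              forall z, disc z -> g z = g 0 in
  let ii_ := ereal_sup [set ((1 - r) / omega_hat w r)%:E | r in `[0, 1[%classic]
             = +oo%E in
  let iii_ := ereal_sup [set ((1 - r)%:E *
                 \sum_(1 <= k <oo) ((r ^+ k) / ((k + 1)%:R * moment w k))%:E)%E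
                 | r in `[0, 1[%classic] = +oo%E in
  let iv_ := ~ id_D1_bounded w in
  [/\ i_ <-> ii_, i_ <-> iii_ & i_ <-> iv_].
Proof.
move=> i_ ii_ iii_ iv_.
(* Every condition is compared with this one: (ii) and (iii) directly, (i) and (iv) through the
   cycle [tail], bounded identity, nonconstant symbol, [tail]. *)
pose tail := exists K : R, forall r, 0 <= r < 1 -> 1 - r <= K * omega_hat w r.
have iiE : ii_ <-> ~ tail.
  rewrite /ii_ ereal_sup_eqy; split=> H [K HK]; apply: H; exists K => r.
    by rewrite /= in_itv/= => r01; rewrite lee_fin ler_pdivrMr ?hpos// HK.
  by move=> r01; have := HK r; rewrite /= in_itv/= lee_fin ler_pdivrMr ?hpos//; apply.
have iiiE : iii_ <-> ~ tail.
  rewrite /iii_ ereal_sup_eqy; split=> H [K HK]; apply: H.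
    exists (4 * K) => r; rewrite /= in_itv/=; exact: moment_series_le.
  have [|c c0 Hc] := @moment_bound_of_series R w hw hpos K; last exact: tail_bound_of_moment hD c0 Hc.
  by move=> r r01; apply: HK; rewrite /= in_itv.
have tail_iv : tail -> id_D1_bounded w by move=> [K HK]; exact: tail_bound_id_bounded HK.
have iv_i : id_D1_bounded w -> ~ i_.
  move=> /(id_bounded_symbol_id hw) idT /(_ _ _ idT) H.
  (* The symbol [g(z) = z] takes different values at 0 and at 1/2. *)
  have h2 : disc ((1 / 2 : R)%:C) by rewrite /disc /= cnorm_real ger0_norm; lra.
  by have := H _ h2 => /complexI h; lra.
have i_tail : ~ i_ -> tail.
  move=> /existsNP[g /existsNP[g' /not_implyP[gT nc]]].
  have [c c0 Hc] := nonconstant_symbol_moment hw hpos gT nc.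
  exact: tail_bound_of_moment hD c0 Hc.
have iE : i_ <-> ~ tail.
  by split=> [hi /tail_iv/iv_i|nt]; [|apply: contrapT => /i_tail].
split; first by rewrite iE iiE.
  by rewrite iE iiiE.
rewrite iE; split=> [nt|niv]; last by move=> /tail_iv.
by move=> /iv_i/i_tail.
Qed.
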